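(* Let $B=\mathbb{C}\langle x,y\rangle/(y^2)$ with the $\mathbb{Z}$-grading $\deg x=\deg y=1$. Let $S=\varinjlim_n (S_n,\phi_n)$ be the direct limit, in the category of $\mathbb{C}$-algebras, of the directed system of algebras $S_n=M_{f_n}(\mathbb{C})\oplus M_{f_{n-1}}(\mathbb{C})$ ($n\ge 1$) and maps $\phi_n:S_n\to S_{n+1}$, $$\phi_n(a,b)=\left(\begin{pmatrix} a&0\\0&b\end{pmatrix},\,a\right).$$ Then there is an equivalence of categories $$\mathsf{QGr}(B)\;\equiv\;\mathsf{Mod}\,S$$ that restricts to an equivalence between $\mathsf{qgr}(B)$ and $\mathsf{mod}\,S$. Under the equivalence $\mathcal{O}$ corresponds to $S$ (viewed as a right $S$-module).
   Context: The Fibonacci numbers are $f_0=f_1=1$, $f_{n+1}=f_n+f_{n-1}$ for $n\ge1$. $\mathsf{Gr}\,B$ is the category of $\mathbb{Z}$-graded left $B$-modules with degree-preserving homomorphisms; $\mathsf{Fdim}\,B$ is its Serre subcategory of modules that are unions of their finite dimensional (graded) submodules; $\mathsf{QGr}\,B:=\mathsf{Gr}\,B/\mathsf{Fdim}\,B$ is the quotient category. $\mathsf{gr}\,B\subset \mathsf{Gr}\,B$ is the full subcategory of finitely presented graded modules (it is abelian because $B$ is coherent), $\mathsf{fdim}\,B$ is the full subcategory of finite dimensional graded modules, and $\mathsf{qgr}\,B:=\mathsf{gr}\,B/\mathsf{fdim}\,B$, which is identified with the full subcategory of finitely presented objects of $\mathsf{QGr}\,B$. $\mathcal{O}$ denotes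 the image of the left module $B$ in $\mathsf{QGr}\,B$. $\mathsf{Mod}\,S$ is the category of right $S$-modules and $\mathsf{mod}\,S$ its full subcategory of finitely presented modules. *)

(* Defs.v *)
From HB Require Import structures.
From mathcomp Require Import all_boot all_algebra.
From mathcomp Require Import finmap.
From mathcomp Require Import boolp reals complex.
From mathcomp Require Import monalg.

Set Implicit Arguments.
Unset Strict Implicit.
Unset Printing Implicit Defensive.

Import GRing.Theory.
Local Open Scope ring_scope.
Local Open Scope quotient_scope.

(* Categories with a setoid of morphisms: [heq] is equality of morphisms. *)

Record category := Category {
  obj :> Type;
  hom : obj -> obj -> Type;
  heq : forall x y, hom x y -> hom x y -> Prop;
  idm : forall x, hom x x;
  cmp : forall x y z, hom y z -> hom x y -> hom x z;
  heq_refl : forall x y (f : hom x y), heq f f;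
  heq_sym : forall x y (f g : hom x y), heq f g -> heq g f;
  heq_trans : forall x y (f g h : hom x y), heq f g -> heq g h -> heq f h;
  cmp_heq : forall x y z (g g' : hom y z) (f f' : hom x y),
    heq g g' -> heq f f' -> heq (cmp g f) (cmp g' f');
  cmp1m : forall x y (f : hom x y), heq (cmp (idm y) f) f;
  cmpm1 : forall x y (f : hom x y), heq (cmp f (idm x)) f;
  cmpA : forall x y z t (h : hom z t) (g : hom y z) (f : hom x y),
    heq (cmp h (cmp g f)) (cmp (cmp h g) f)
}.

Arguments idm {c} x.

Definition isomorphic (C : category) (x y : C) : Prop :=
  exists (f : hom x y) (g : hom y x),
    heq (cmp g f) (idm x) /\ heq (cmp f g) (idm y).

Record functor (C D : category) := Functor {
  fobj :> C -> D;
  fmap : forall x y, hom x y -> hom (fobj x) (fobj y);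
  fmap_heq : forall x y (f g : hom x y), heq f g -> heq (fmap f) (fmap g);
  fmap_id : forall x, heq (fmap (idm x)) (idm (fobj x));
  fmap_cmp : forall x y z (g : hom y z) (f : hom x y),
    heq (fmap (cmp g f)) (cmp (fmap g) (fmap f))
}.

Definition functor_id (C : category) : functor C C :=
  @Functor C C id (fun _ _ f => f) (fun _ _ _ _ fg => fg)
    (fun x => heq_refl (idm x)) (fun _ _ _ g f => heq_refl (cmp g f)).

Section FunctorComp.
Variables (C D E : category) (G : functor D E) (F : functor C D).

Definition functor_comp : functor C E.
Proof.
refine (@Functor C E (fun x => G (F x)) (fun x y f => fmap G (fmap F f))
          _ _ _).
- by move=> x y f g fg; do 2!apply: fmap_heq.
- move=> x; apply: (heq_trans (fmap_heq G (fmap_id F x))); exact: fmap_id.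
- move=> x y z g f.
  by apply: (heq_trans (fmap_heq G (fmap_cmp F g f))); exact: fmap_cmp.
Defined.
End FunctorComp.

Definition nat_iso (C D : category) (F G : functor C D) : Prop :=
  exists (a : forall x, hom (F x) (G x)) (b : forall x, hom (G x) (F x)),
    [/\ forall x, heq (cmp (b x) (a x)) (idm (F x)),
        forall x, heq (cmp (a x) (b x)) (idm (G x))
      & forall x y (f : hom x y),
          heq (cmp (a y) (fmap F f)) (cmp (fmap G f) (a x))].

Definition is_equivalence (C D : category) (F : functor C D) : Prop :=
  exists G : functor D C,
    nat_iso (functor_comp G F) (functor_id C) /\
    nat_iso (functor_comp F G) (functor_id D).

Definition full_subcategory (C : category) (P : C -> Prop) : category :=
  @Category {x : C | P x}
    (fun x y => hom (sval x) (sval y)) (fun _ _ f g => heq f g)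
    (fun x => idm (sval x)) (fun _ _ _ g f => cmp g f)
    (fun _ _ => @heq_refl C _ _) (fun _ _ => @heq_sym C _ _)
    (fun _ _ => @heq_trans C _ _) (fun _ _ _ => @cmp_heq C _ _ _)
    (fun _ _ => @cmp1m C _ _) (fun _ _ => @cmpm1 C _ _)
    (fun _ _ _ _ => @cmpA C _ _ _ _).

Definition inclusion (C : category) (P : C -> Prop) :
    functor (full_subcategory P) C :=
  @Functor (full_subcategory P) C (fun x => sval x) (fun _ _ f => f)
    (fun _ _ _ _ fg => fg) (fun x => heq_refl (idm (sval x)))
    (fun _ _ _ g f => heq_refl (cmp g f)).

(* The localization C[W^-1]: the category presented by the morphisms of C and
   formal inverses of the morphisms in W, subject to the relations [loc_eq]. *)

Section Localization.
Variables (C : category) (W : forall x y : C, hom x y -> Prop).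

Inductive loc_hom : C -> C -> Type :=
| Loc x y of hom x y : loc_hom x y
| LocInv x y (w : hom x y) of W w : loc_hom y x
| LocCmp x y z of loc_hom y z & loc_hom x y : loc_hom x z.

Inductive loc_eq : forall x y, loc_hom x y -> loc_hom x y -> Prop :=
| loc_refl x y (f : loc_hom x y) : loc_eq f f
| loc_sym x y (f g : loc_hom x y) : loc_eq f g -> loc_eq g f
| loc_trans x y (f g h : loc_hom x y) :
    loc_eq f g -> loc_eq g h -> loc_eq f h
| loc_cmp_eq x y z (g g' : loc_hom y z) (f f' : loc_hom x y) :
    loc_eq g g' -> loc_eq f f' -> loc_eq (LocCmp g f) (LocCmp g' f')
| loc_1m x y (f : loc_hom x y) : loc_eq (LocCmp (Loc (idm y)) f) f
| loc_m1 x y (f : loc_hom x y) : loc_eq (LocCmp f (Loc (idm x))) f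
| loc_A x y z t (h : loc_hom z t) (g : loc_hom y z) (f : loc_hom x y) :
    loc_eq (LocCmp h (LocCmp g f)) (LocCmp (LocCmp h g) f)
| loc_heq x y (f g : hom x y) : heq f g -> loc_eq (Loc f) (Loc g)
| loc_cmp x y z (g : hom y z) (f : hom x y) :
    loc_eq (Loc (cmp g f)) (LocCmp (Loc g) (Loc f))
| loc_VK x y (w : hom x y) (Ww : W w) :
    loc_eq (LocCmp (LocInv Ww) (Loc w)) (Loc (idm x))
| loc_KV x y (w : hom x y) (Ww : W w) :
    loc_eq (LocCmp (Loc w) (LocInv Ww)) (Loc (idm y)).

Definition localization : category :=
  @Category C loc_hom loc_eq (fun x => Loc (idm x)) LocCmp
    loc_refl loc_sym loc_trans loc_cmp_eq loc_1m loc_m1 loc_A.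

End Localization.

Section LocalizationFunctor.
Variables (C D : category).
Variables (W : forall x y : C, hom x y -> Prop).
Variables (V : forall x y : D, hom x y -> Prop).
Variables (F : functor C D).
Hypothesis FW : forall x y (f : hom x y), W f -> V (fmap F f).

Fixpoint loc_map x y (f : loc_hom W x y) : loc_hom V (F x) (F y) :=
  match f with
  | Loc _ _ f => Loc V (fmap F f)
  | LocInv _ _ _ Ww => LocInv (FW Ww)
  | LocCmp _ _ _ g f => LocCmp (loc_map g) (loc_map f)
  end.

Lemma loc_map_eq x y (f g : loc_hom W x y) :
  loc_eq f g -> loc_eq (loc_map f) (loc_map g).
Proof.
elim=> {x y f g} /=.
- by move=> *; apply: loc_refl.
- by move=> x y f g _; apply: loc_sym.
- by move=> x y f g h _ fg _; apply: loc_trans.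
- by move=> x y z g g' f f' _ ? _ ?; apply: loc_cmp_eq.
- move=> x y f; apply: loc_trans (loc_1m _).
  by apply: loc_cmp_eq (loc_refl _); apply/loc_heq/fmap_id.
- move=> x y f; apply: loc_trans (loc_m1 _).
  by apply: loc_cmp_eq (loc_refl _) _; apply/loc_heq/fmap_id.
- by move=> *; apply: loc_A.
- by move=> x y f g fg; apply/loc_heq/fmap_heq.
- by move=> x y z g f; apply: loc_trans (loc_cmp _ _ _); apply/loc_heq/fmap_cmp.
- move=> x y w Ww; apply: (loc_trans (loc_VK (FW Ww))).
  by apply/loc_sym/loc_heq/fmap_id.
- move=> x y w Ww; apply: (loc_trans (loc_KV (FW Ww))).
  by apply/loc_sym/loc_heq/fmap_id.
Qed.

Definition localization_functor : functor (localization W) (localization V) :=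
  @Functor (localization W) (localization V) F loc_map loc_map_eq
    (fun x => loc_heq V (fmap_id F x)) (fun _ _ _ _ _ => loc_refl _).

End LocalizationFunctor.

Definition surjective (T U : Type) (f : T -> U) : Prop :=
  forall u, exists t, f t = u.

(* Exactness at the middle term. *)
Definition exact_at (T : Type) (U : Type) (V : nmodType)
    (f : T -> U) (g : U -> V) : Prop :=
  forall u, g u = 0 <-> exists t, f t = u.

Section Modules.
Variable A : pzRingType.

Definition Mod : category.
Proof.
refine (@Category (lmodType A) (fun M N => {linear M -> N})
  (fun M N f g => f =1 g) (fun M => idfun : {linear M -> M})
  (fun M N P g f => (g \o f : {linear M -> P})) _ _ _ _ _ _ _) => //.
- by move=> M N f g fg m.
- by move=> M N f g h fg gh m; rewrite fg gh.
- by move=> M N P g g' f f' gg' ff' m /=; rewrite ff' gg'.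
Defined.

Definition finitely_presented (M : lmodType A) : Prop :=
  exists (p q : nat) (h : {linear 'rV[A]_q -> 'rV[A]_p})
         (g : {linear 'rV[A]_p -> M}),
    exact_at h g /\ surjective g.

Definition fpMod : category := full_subcategory (C := Mod) finitely_presented.

End Modules.

(* A right S-module is a left module over the converse ring S^c; the right
   S-module S is the regular module (S^c)^o. *)
Definition RMod (S : pzRingType) : category := Mod S^c.
Definition fpRMod (S : pzRingType) : category := fpMod S^c.
Definition fpRMod_RMod (S : pzRingType) : functor (fpRMod S) (RMod S) :=
  @inclusion (RMod S) _.

(* V is the direct sum of the subgroups V_ i, i : int. *)
Definition is_grading (V : zmodType) (V_ : int -> V -> Prop) : Prop :=
  [/\ forall i, V_ i 0,
      forall i u v, V_ i u -> V_ i v -> V_ i (u - v),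
      forall v, exists (s : seq int) (u : int -> V),
        [/\ uniq s, forall i, V_ i (u i) & v = \sum_(i <- s) u i]
    & forall (s : seq int) (u : int -> V),
        uniq s -> (forall i, V_ i (u i)) -> \sum_(i <- s) u i = 0 ->
        forall i, i \in s -> u i = 0].

Record gralg (k : fieldType) := GrAlg {
  ga_alg :> algType k;
  ga_comp : int -> ga_alg -> Prop;
  ga_grading : is_grading ga_comp;
  ga_scale : forall i (c : k) a, ga_comp i a -> ga_comp i (c *: a);
  ga_one : ga_comp 0 1;
  ga_mul : forall i j a b,
    ga_comp i a -> ga_comp j b -> ga_comp (i + j) (a * b)
}.

Section GradedModules.
Variables (k : fieldType) (B : gralg k).

Record grmod := GrMod {
  gm_mod :> lmodType B;
  gm_comp : int -> gm_mod -> Prop;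
  gm_grading : is_grading gm_comp;
  gm_scale : forall i j a m,
    ga_comp i a -> gm_comp j m -> gm_comp (i + j) (a *: m)
}.

Record grhom (M N : grmod) := GrHom {
  gh_fun :> {linear M -> N};
  gh_degree : forall i m, gm_comp i m -> gm_comp i (gh_fun m)
}.

Definition grhom_id (M : grmod) : grhom M M :=
  @GrHom M M idfun (fun _ _ Mm => Mm).

Definition grhom_comp (M N P : grmod) (g : grhom N P) (f : grhom M N) :
    grhom M P :=
  @GrHom M P (g \o f : {linear M -> P})
    (fun i m Mm => gh_degree g (gh_degree f Mm)).

Definition Gr : category.
Proof.
refine (@Category grmod grhom (fun M N f g => f =1 g) grhom_id grhom_comp
  _ _ _ _ _ _ _) => //.
- by move=> M N f g fg m.
- by move=> M N f g h fg gh m; rewrite fg gh.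
- by move=> M N P g g' f f' gg' ff' m /=; rewrite ff' gg'.
Defined.

Definition finite_dimensional (M : grmod) : Prop :=
  exists (n : nat) (v : 'I_n -> M), forall m : M,
    exists c : 'I_n -> k, m = \sum_i (c i)%:A *: v i.

Definition Fdim (M : grmod) : Prop :=
  forall m : M, exists (N : grmod) (f : grhom N M),
    [/\ finite_dimensional N, injective f & exists n, f n = m].

Definition gr : category :=
  full_subcategory (C := Gr) (fun M : grmod => finitely_presented M).

(* The morphisms whose kernel K and cokernel L both satisfy T. *)
Definition iso_mod (T : grmod -> Prop) (M N : grmod) (f : grhom M N) : Prop :=
  exists (K L : grmod) (i : grhom K M) (p : grhom N L),
    [/\ T K /\ T L, injective i, exact_at i f, exact_at f p & surjective p].

(* The quotient of an abelian category by a Serre subcategory T is its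
   localization at the morphisms whose kernel and cokernel are in T. *)
Definition QGr : category := localization (C := Gr) (iso_mod Fdim).

(* Over a finitely generated connected graded algebra a finite dimensional graded
   module is finitely presented, so that the kernel and cokernel required here
   are objects of gr, and are the kernel and cokernel in gr. *)
Definition qgr : category :=
  localization (C := gr)
    (fun M N => @iso_mod finite_dimensional (sval M) (sval N)).

Lemma finite_dimensional_Fdim M : finite_dimensional M -> Fdim M.
Proof.
by move=> fM m; exists M, (grhom_id M); split=> //; exists m.
Qed.

Lemma iso_mod_Fdim M N (f : grhom M N) :
  iso_mod finite_dimensional f -> iso_mod Fdim f.
Proof.
move=> [K [L [i [p [[fK fL] *]]]]].
by exists K, L, i, p; split=> //; split; apply: finite_dimensional_Fdim.
Qed.

Definition qgr_QGr : functor qgr QGr :=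
  localization_functor (F := @inclusion Gr _)
    (fun M N => @iso_mod_Fdim (sval M) (sval N)).

Definition structure_module : grmod :=
  @GrMod (B^o : lmodType B) (@ga_comp k B) (ga_grading B) (@ga_mul k B).

End GradedModules.

Section IdealQuotient.
Variables (k : fieldType) (A : algType k).

Record ideal := Ideal {
  ideal_mem :> zmodClosed A;
  ideal_mull : forall a x, x \in ideal_mem -> a * x \in ideal_mem;
  ideal_mulr : forall a x, x \in ideal_mem -> x * a \in ideal_mem;
  ideal_proper : 1 \notin ideal_mem
}.

Variable J : ideal.

Definition alg_quot : Type := Quotient.quot J.

HB.instance Definition _ := GRing.Zmodule.on alg_quot.

Definition proj (a : A) : alg_quot := \pi_(Quotient.quot J) a.

Lemma projP a b : proj a = proj b <-> a - b \in ideal_mem J.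
Proof.
rewrite (@Quotient.idealrBE A J a b) /proj.
by split=> [->|/eqP].
Qed.

Lemma proj_surj : surjective proj.
Proof. by move=> u; exists (repr u); rewrite /proj reprK. Qed.

Lemma projB : {morph proj : a b / a - b}.
Proof. by move=> a b; rewrite /proj !piE. Qed.

HB.instance Definition _ := GRing.isZmodMorphism.Build A alg_quot proj projB.

Definition quot_mul (u v : alg_quot) : alg_quot := proj (repr u * repr v).
Definition quot_scale (c : k) (u : alg_quot) : alg_quot := proj (c *: repr u).

Lemma repr_proj a : repr (proj a) - a \in ideal_mem J.
Proof. by apply/projP; rewrite /proj reprK. Qed.

Lemma projM a b : quot_mul (proj a) (proj b) = proj (a * b).
Proof.
apply/projP; set a' := repr _; set b' := repr _.
have -> : a' * b' - a * b = (a' - a) * b' + a * (b' - b).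
  by rewrite mulrBl mulrBr addrA subrK.
by apply: rpredD; [apply: ideal_mulr | apply: ideal_mull]; exact: repr_proj.
Qed.

Lemma projZ c a : quot_scale c (proj a) = proj (c *: a).
Proof.
apply/projP; rewrite -scalerBr -[_ - a]mul1r scalerAl ideal_mull //.
exact: repr_proj.
Qed.

Let projE := (projM, projZ).
Let projD := raddfD proj.

Fact quot_mulA : associative quot_mul.
Proof.
move=> u v w; have [a <-] := proj_surj u; have [b <-] := proj_surj v.
by have [c <-] := proj_surj w; rewrite !projE mulrA.
Qed.

Fact quot_mul1l : left_id (proj 1) quot_mul.
Proof. by move=> u; have [a <-] := proj_surj u; rewrite projE mul1r. Qed.

Fact quot_mul1r : right_id (proj 1) quot_mul.
Proof. by move=> u; have [a <-] := proj_surj u; rewrite projE mulr1. Qed.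

Fact quot_mulDl : left_distributive quot_mul +%R.
Proof.
move=> u v w; have [a <-] := proj_surj u; have [b <-] := proj_surj v.
by have [c <-] := proj_surj w; rewrite -projD !projE -projD mulrDl.
Qed.

Fact quot_mulDr : right_distributive quot_mul +%R.
Proof.
move=> u v w; have [a <-] := proj_surj u; have [b <-] := proj_surj v.
by have [c <-] := proj_surj w; rewrite -projD !projE -projD mulrDr.
Qed.

Fact quot_one_neq0 : proj 1 != 0.
Proof.
apply/eqP; rewrite -(raddf0 proj) => /projP.
by rewrite subr0; apply/negP/ideal_proper.
Qed.

HB.instance Definition _ := GRing.Zmodule_isNzRing.Build alg_quot
  quot_mulA quot_mul1l quot_mul1r quot_mulDl quot_mulDr quot_one_neq0.

Fact quot_scaleA c d u : quot_scale c (quot_scale d u) = quot_scale (c * d) u.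
Proof. by have [a <-] := proj_surj u; rewrite !projE scalerA. Qed.

Fact quot_scale1 : left_id 1 quot_scale.
Proof. by move=> u; have [a <-] := proj_surj u; rewrite projE scale1r. Qed.

Fact quot_scaleDr : right_distributive quot_scale +%R.
Proof.
move=> c u v; have [a <-] := proj_surj u; have [b <-] := proj_surj v.
by rewrite -projD !projE -projD scalerDr.
Qed.

Fact quot_scaleDl u : {morph quot_scale^~ u : c d / c + d}.
Proof.
by move=> c d; have [a <-] := proj_surj u; rewrite !projE -projD scalerDl.
Qed.

HB.instance Definition _ := GRing.Zmodule_isLmodule.Build k alg_quot
  quot_scaleA quot_scale1 quot_scaleDr quot_scaleDl.

Fact quot_scaleAl (c : k) (u v : alg_quot) : c *: (u * v) = (c *: u) * v.
Proof.
have [a <-] := proj_surj u; have [b <-] := proj_surj v.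
by rewrite /GRing.scale /GRing.mul /= !projE scalerAl.
Qed.

Fact quot_scaleAr (c : k) (u v : alg_quot) : c *: (u * v) = u * (c *: v).
Proof.
have [a <-] := proj_surj u; have [b <-] := proj_surj v.
by rewrite /GRing.scale /GRing.mul /= !projE scalerAr.
Qed.

HB.instance Definition _ :=
  GRing.LSemiModule_isLSemiAlgebra.Build k alg_quot quot_scaleAl.
HB.instance Definition _ :=
  GRing.LSemiAlgebra_isSemiAlgebra.Build k alg_quot quot_scaleAr.

Fact proj_scalable : scalable proj.
Proof. by move=> c a; rewrite /GRing.scale /= projE. Qed.

Fact proj_monoid_morphism : monoid_morphism proj.
Proof. by split=> // a b; rewrite /GRing.mul /= projE. Qed.

HB.instance Definition _ :=
  GRing.isScalable.Build k A alg_quot _ proj proj_scalable.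
HB.instance Definition _ :=
  GRing.isMonoidMorphism.Build A alg_quot proj proj_monoid_morphism.

End IdealQuotient.

Section GeneratedIdeal.
Variables (k : fieldType) (A : algType k) (r : A).

Definition gen_ideal : {pred A} :=
  [pred a | `[< exists s : seq (A * A), a = \sum_(p <- s) p.1 * r * p.2 >]].

Lemma gen_idealP a :
  reflect (exists s : seq (A * A), a = \sum_(p <- s) p.1 * r * p.2)
          (a \in gen_ideal).
Proof. exact: asboolP. Qed.

Fact gen_ideal_zmod_closed : zmod_closed gen_ideal.
Proof.
split; first by apply/gen_idealP; exists [::]; rewrite big_nil.
move=> _ _ /gen_idealP[s ->] /gen_idealP[t ->]; apply/gen_idealP.
exists (s ++ [seq (- p.1, p.2) | p <- t]).
rewrite big_cat big_map -sumrN; congr (_ + _).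
by apply: eq_bigr => p _; rewrite !mulNr.
Qed.

HB.instance Definition _ :=
  GRing.isZmodClosed.Build A gen_ideal gen_ideal_zmod_closed.

Fact gen_ideal_mull a x : x \in gen_ideal -> a * x \in gen_ideal.
Proof.
move=> /gen_idealP[s ->]; apply/gen_idealP.
exists [seq (a * p.1, p.2) | p <- s]; rewrite big_map mulr_sumr.
by apply: eq_bigr => p _; rewrite !mulrA.
Qed.

Fact gen_ideal_mulr a x : x \in gen_ideal -> x * a \in gen_ideal.
Proof.
move=> /gen_idealP[s ->]; apply/gen_idealP.
exists [seq (p.1, p.2 * a) | p <- s]; rewrite big_map mulr_suml.
by apply: eq_bigr => p _; rewrite !mulrA.
Qed.

Hypothesis gen_ideal_proper : 1 \notin gen_ideal.

Definition principal_ideal : ideal A :=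
  Ideal gen_ideal_mull gen_ideal_mulr gen_ideal_proper.

End GeneratedIdeal.

Section FreeAlgebra.
Variables (k : fieldType) (I : choiceType).

(* The free algebra on I: the monoid algebra of the words on I. *)
Definition freealg : Type := {malg k[{fmonom I}]}.

HB.instance Definition _ := GRing.Lalgebra.on freealg.

Lemma scale_malgU (c z : k) (w : {fmonom I}) :
  c *: (<< z *g w >> : freealg) = << c * z *g w >>.
Proof. by apply/malgP => v; rewrite mcoeffZ !mcoeffU mulrnAr. Qed.

Lemma mul_malgU (c d : k) (v w : {fmonom I}) :
  (<< c *g v >> : freealg) * << d *g w >> = << c * d *g mmul v w >>.
Proof. exact: fgmulUU. Qed.

Fact freealg_scaleAr (c : k) (a b : freealg) : c *: (a * b) = a * (c *: b).
Proof.
rewrite [RHS](malgMEw (fsubset_refl _) (msuppZ_le c b)) malgME scaler_sumr.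
apply: eq_bigr => v _; rewrite scaler_sumr; apply: eq_bigr => w _.
by rewrite scale_malgU mcoeffZ mulrCA.
Qed.

HB.instance Definition _ :=
  GRing.LSemiAlgebra_isSemiAlgebra.Build k freealg freealg_scaleAr.

Definition homog_part (i : int) (a : freealg) : freealg :=
  [malg w in msupp a => if (fdeg w)%:Z == i then a@_w else 0].

Lemma homog_partE i a w :
  (homog_part i a)@_w = if (fdeg w)%:Z == i then a@_w else 0.
Proof. by rewrite mcoeffE; case: msuppP => //; rewrite if_same. Qed.

Fact homog_part_is_zmod_morphism i : zmod_morphism (homog_part i).
Proof.
move=> a b; apply/malgP => w; rewrite mcoeffB !homog_partE mcoeffB.
by case: ifP; rewrite ?subr0.
Qed.

HB.instance Definition _ i :=
  GRing.isZmodMorphism.Build freealg freealg (homog_part i)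
    (homog_part_is_zmod_morphism i).

Lemma homog_partD i (a b : freealg) :
  homog_part i (a + b) = homog_part i a + homog_part i b.
Proof. exact: raddfD. Qed.

Lemma homog_partU i (c : k) (w : {fmonom I}) :
  homog_part i << c *g w >> = if (fdeg w)%:Z == i then << c *g w >> else 0.
Proof.
apply/malgP => v; rewrite homog_partE (fun_if (mcoeff v)) mcoeff0 !mcoeffU.
by have [<-|] := eqVneq w v => //; rewrite mulr0n !if_same.
Qed.

Definition homogeneous (i : int) (a : freealg) : Prop :=
  forall w, a@_w != 0 -> (fdeg w)%:Z = i.

Lemma homog_part_homogeneous i a : homogeneous i (homog_part i a).
Proof. by move=> w; rewrite homog_partE; case: ifP => [/eqP|]; rewrite ?eqxx. Qed.

Lemma homog_part_id i j a :
  homogeneous j a -> homog_part i a = if j == i then a else 0.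
Proof.
move=> ha; apply/malgP => w; rewrite homog_partE (fun_if (mcoeff w)) mcoeff0.
have [->|/ha ->//] := eqVneq (a@_w) 0; by rewrite !if_same.
Qed.

Lemma homogeneousM i j a b :
  homogeneous i a -> homogeneous j b -> homogeneous (i + j) (a * b).
Proof.
move=> ha hb w; rewrite mcoeff_neq0 => /msuppM_le[v [v' [+ + ->]]].
rewrite -!mcoeff_neq0 => /ha <- /hb <-.
by rewrite fdegM.
Qed.

Lemma sum_homog_part (a : freealg) :
  a = \sum_(i <- undup [seq (fdeg w)%:Z | w <- msupp a]) homog_part i a.
Proof.
apply/malgP => w; rewrite raddf_sum /=.
under eq_bigr do rewrite homog_partE.
have [aw|/mcoeff_outdom ->] := boolP (w \in msupp a); last first.
  by rewrite big1 // => i _; rewrite if_same.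
have wa : (fdeg w)%:Z \in undup [seq (fdeg v)%:Z | v <- msupp a].
  by rewrite mem_undup; exact: (map_f (fun v : {fmonom I} => (fdeg v)%:Z) aw).
rewrite (bigD1_seq _ wa (undup_uniq _)) /=.
by rewrite eqxx big1 ?addr0 // => i; rewrite eq_sym => /negPf->.
Qed.

End FreeAlgebra.

Section AlgebraB.
Variable k : fieldType.

Local Notation F := (freealg k 'I_2).

(* The generators x and y are the letters 0 and 1 of 'I_2. *)
Definition free_y : F := << fmu ord_max >>.

Local Notation ysq := (free_y ^+ 2).
Local Notation yy := (mmul (fmu ord_max) (fmu ord_max) : {fmonom 'I_2}).

Lemma ysqE : ysq = << yy >>.
Proof. by rewrite expr2 mul_malgU mulr1. Qed.

Fact y_sq_proper : 1 \notin gen_ideal ysq.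
Proof.
apply/gen_idealP => -[s /(congr1 (mcoeff mone))].
rewrite rmorph1 rmorph_sum big1 => [/eqP|p _]; first by rewrite oner_eq0.
rewrite ysqE !rmorphM /= mcoeffU.
by rewrite -fdeg_eq0 fdegM !fdegU mulr0n mulr0 mul0r.
Qed.

Lemma mulrDMl (A : pzRingType) (a b c d : A) :
  (a + b) * c * d = a * c * d + b * c * d.
Proof. by rewrite !mulrDl. Qed.

Lemma homog_part_gen_ideal i (a : F) :
  a \in gen_ideal ysq -> homog_part i a \in gen_ideal ysq.
Proof.
move=> /gen_idealP[s ->]; rewrite raddf_sum rpred_sum // => p _ /=.
move: p => [a' b] /=; rewrite [a']monalgE.
apply: (big_ind (fun a : F => homog_part i (a * ysq * b) \in gen_ideal ysq)).
- by rewrite !mul0r raddf0 rpred0.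
- move=> a1 a2 h1 h2.
  rewrite (mulrDMl (a1 : F) a2 ysq b).
  rewrite homog_partD; exact: rpredD h1 h2.
move=> v _; set c := a'@_v; rewrite [b]monalgE.
apply: (big_ind (fun b : F =>
  homog_part i ((<< c *g v >> : F) * ysq * b) \in gen_ideal ysq)).
- by rewrite mulr0 raddf0 rpred0.
- move=> b1 b2 h1 h2; rewrite (mulrDr (_ * ysq : F)) homog_partD.
  exact: rpredD h1 h2.
move=> w _; set d := b@_w.
have -> : (<< c *g v >> : F) * ysq * << d *g w >>
          = << c * d *g mmul (mmul v yy) w >>.
  by rewrite ysqE mul_malgU mulr1 mul_malgU.
rewrite homog_partU; case: ifP => _; last exact: rpred0.
apply/gen_idealP; exists [:: (<< c *g v >>, << d *g w >>)].
by rewrite big_seq1 ysqE /= mul_malgU mulr1 mul_malgU.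
Qed.

Definition y_sq_ideal : ideal F := principal_ideal y_sq_proper.
Definition B_alg : algType k := alg_quot y_sq_ideal.

Definition B_comp (i : int) (b : B_alg) : Prop :=
  exists a : F, homogeneous i a /\ b = proj y_sq_ideal a.

Lemma B_grading : is_grading B_comp.
Proof.
split.
- move=> i; exists 0; split; last by rewrite raddf0.
  by move=> w; rewrite mcoeff0 eqxx.
- move=> i _ _ [a [ha ->]] [b [hb ->]]; exists (a - b); split.
    move=> w; rewrite mcoeffB.
    by have [->|/ha//] := eqVneq a@_w 0; rewrite sub0r oppr_eq0 => /hb.
  by rewrite raddfB.
- move=> u; have [a <-] := proj_surj u.
  exists (undup [seq (fdeg w)%:Z | w <- msupp a]).
  exists (fun i => proj y_sq_ideal (homog_part i a)); split.
  + exact: undup_uniq.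
  + by move=> i; exists (homog_part i a); split=> //; apply: homog_part_homogeneous.
  + by rewrite {1}[a]sum_homog_part raddf_sum.
- move=> s u us /choice[a ha] us0 i si.
  have [hai ->] := ha i.
  move: us0; under eq_bigr do rewrite (ha _).2.
  rewrite -raddf_sum -(raddf0 (proj y_sq_ideal)) => /projP; rewrite subr0.
  move=> /(homog_part_gen_ideal i); rewrite raddf_sum /= => ai.
  apply/projP; rewrite subr0; move: ai.
  rewrite (bigD1_seq i) //= (homog_part_id _ hai) eqxx big1 ?addr0 // => j ji.
  by rewrite (homog_part_id _ (ha j).1) (negPf ji).
Qed.

Lemma B_scale i (c : k) (b : B_alg) : B_comp i b -> B_comp i (c *: b).
Proof.
move=> [a [ha ->]]; exists (c *: a); split; last by rewrite linearZ.
move=> w; rewrite mcoeffZ.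
by have [->|/ha//] := eqVneq a@_w 0; rewrite mulr0 eqxx.
Qed.

Lemma B_one : B_comp 0 1.
Proof.
exists 1; split; last by rewrite rmorph1.
move=> w; rewrite mcoeff1; have [->|] := eqVneq w mone; last by rewrite eqxx.
by rewrite fdeg1.
Qed.

Lemma B_mul i j (b b' : B_alg) :
  B_comp i b -> B_comp j b' -> B_comp (i + j) (b * b').
Proof.
move=> [a [ha ->]] [a' [ha' ->]]; exists (a * a').
by split; [apply: homogeneousM | rewrite rmorphM].
Qed.

Definition B : gralg k := GrAlg B_grading B_scale B_one B_mul.

End AlgebraB.

Definition is_direct_limit (k : fieldType) (A : nat -> algType k)
    (phi : forall n, {lrmorphism A n -> A n.+1}) (L : algType k)
    (iota : forall n, {lrmorphism A n -> L}) : Prop :=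
  (forall n a, iota n.+1 (phi n a) = iota n a) /\
  forall (T : algType k) (psi : forall n, {lrmorphism A n -> T}),
    (forall n a, psi n.+1 (phi n a) = psi n a) ->
    exists u : {lrmorphism L -> T},
      (forall n a, u (iota n a) = psi n a) /\
      forall v : {lrmorphism L -> T},
        (forall n a, v (iota n a) = psi n a) -> v =1 u.

(* An explicit direct limit of a sequence of algebras: sequences that are eventually
   compatible with the transition maps, modulo those that eventually vanish. *)

Section DirectLimit.
Variables (k : fieldType) (A : nat -> algType k).
Variable phi : forall n, {lrmorphism A n -> A n.+1}.

Definition coherent_from (N : nat) (a : forall n, A n) : Prop :=
  forall n, (N <= n)%N -> a n.+1 = phi n (a n).

Record cohseq := CohSeq {
  cs_fun :> forall n, A n;
  cs_coh : exists N, coherent_from N cs_fun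
}.

HB.instance Definition _ := gen_eqMixin cohseq.
HB.instance Definition _ := gen_choiceMixin cohseq.

Lemma cohseqP (a b : cohseq) : (forall n, a n = b n) -> a = b.
Proof.
case: a b => [a ha] [b hb] /= ab.
have {}ab := functional_extensionality_dep ab; case: b / ab hb => hb.
by congr CohSeq; apply: Prop_irrelevance.
Qed.

Fact coh_add (a b : cohseq) : exists N, coherent_from N (fun n => a n + b n).
Proof.
have [M aM] := cs_coh a; have [N bN] := cs_coh b; exists (maxn M N) => n.
by rewrite geq_max => /andP[/aM-> /bN->]; rewrite raddfD.
Qed.

Fact coh_mul (a b : cohseq) : exists N, coherent_from N (fun n => a n * b n).
Proof.
have [M aM] := cs_coh a; have [N bN] := cs_coh b; exists (maxn M N) => n.
by rewrite geq_max => /andP[/aM-> /bN->]; rewrite rmorphM.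
Qed.

Fact coh_opp (a : cohseq) : exists N, coherent_from N (fun n => - a n).
Proof. by have [M aM] := cs_coh a; exists M => n /aM->; rewrite raddfN. Qed.

Fact coh_scale c (a : cohseq) : exists N, coherent_from N (fun n => c *: a n).
Proof. by have [M aM] := cs_coh a; exists M => n /aM->; rewrite linearZ. Qed.

Fact coh_zero : exists N, coherent_from N (fun n => 0).
Proof. by exists 0%N => n _; rewrite raddf0. Qed.

Fact coh_one : exists N, coherent_from N (fun n => 1).
Proof. by exists 0%N => n _; rewrite rmorph1. Qed.

Definition cs_add a b := CohSeq (coh_add a b).
Definition cs_mul a b := CohSeq (coh_mul a b).
Definition cs_opp a := CohSeq (coh_opp a).
Definition cs_scale c a := CohSeq (coh_scale c a).
Definition cs_zero := CohSeq coh_zero.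
Definition cs_one := CohSeq coh_one.

Fact cs_addA : associative cs_add.
Proof. by move=> a b c; apply: cohseqP => n; apply: addrA. Qed.
Fact cs_addC : commutative cs_add.
Proof. by move=> a b; apply: cohseqP => n; apply: addrC. Qed.
Fact cs_add0 : left_id cs_zero cs_add.
Proof. by move=> a; apply: cohseqP => n; apply: add0r. Qed.
Fact cs_addN : left_inverse cs_zero cs_opp cs_add.
Proof. by move=> a; apply: cohseqP => n; apply: addNr. Qed.

HB.instance Definition _ :=
  GRing.isZmodule.Build cohseq cs_addA cs_addC cs_add0 cs_addN.

Fact cs_mulA : associative cs_mul.
Proof. by move=> a b c; apply: cohseqP => n; apply: mulrA. Qed.
Fact cs_mul1l : left_id cs_one cs_mul.
Proof. by move=> a; apply: cohseqP => n; apply: mul1r. Qed.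
Fact cs_mul1r : right_id cs_one cs_mul.
Proof. by move=> a; apply: cohseqP => n; apply: mulr1. Qed.
Fact cs_mulDl : left_distributive cs_mul cs_add.
Proof. by move=> a b c; apply: cohseqP => n; apply: mulrDl. Qed.
Fact cs_mulDr : right_distributive cs_mul cs_add.
Proof. by move=> a b c; apply: cohseqP => n; apply: mulrDr. Qed.
Fact cs_one_neq0 : cs_one != cs_zero.
Proof.
apply/eqP => /(congr1 (fun a : cohseq => a 0%N)) /eqP.
by rewrite oner_eq0.
Qed.

HB.instance Definition _ := GRing.Zmodule_isNzRing.Build cohseq
  cs_mulA cs_mul1l cs_mul1r cs_mulDl cs_mulDr cs_one_neq0.

Fact cs_scaleA c d a : cs_scale c (cs_scale d a) = cs_scale (c * d) a.
Proof. by apply: cohseqP => n; apply: scalerA. Qed.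
Fact cs_scale1 : left_id 1 cs_scale.
Proof. by move=> a; apply: cohseqP => n; apply: scale1r. Qed.
Fact cs_scaleDr : right_distributive cs_scale cs_add.
Proof. by move=> c a b; apply: cohseqP => n; apply: scalerDr. Qed.
Fact cs_scaleDl a : {morph cs_scale^~ a : c d / c + d >-> cs_add c d}.
Proof. by move=> c d; apply: cohseqP => n; apply: scalerDl. Qed.

HB.instance Definition _ := GRing.Zmodule_isLmodule.Build k cohseq
  cs_scaleA cs_scale1 cs_scaleDr cs_scaleDl.

Fact cs_scaleAl (c : k) (a b : cohseq) : c *: (a * b) = (c *: a) * b.
Proof. by apply: cohseqP => n; apply: scalerAl. Qed.
Fact cs_scaleAr (c : k) (a b : cohseq) : c *: (a * b) = a * (c *: b).
Proof. by apply: cohseqP => n; apply: scalerAr. Qed.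

HB.instance Definition _ :=
  GRing.LSemiModule_isLSemiAlgebra.Build k cohseq cs_scaleAl.
HB.instance Definition _ :=
  GRing.LSemiAlgebra_isSemiAlgebra.Build k cohseq cs_scaleAr.

Definition evz : {pred cohseq} :=
  [pred a : cohseq | `[< exists N, forall n, (N <= n)%N -> a n = 0 >]].

Lemma evzP (a : cohseq) :
  reflect (exists N, forall n, (N <= n)%N -> a n = 0) (a \in evz).
Proof. exact: asboolP. Qed.

Fact evz_zmod_closed : zmod_closed evz.
Proof.
split; first by apply/evzP; exists 0%N.
move=> a b /evzP[M aM] /evzP[N bN]; apply/evzP; exists (maxn M N) => n.
by rewrite geq_max => /andP[/aM an /bN bn]; rewrite /= an bn oppr0 addr0.
Qed.

HB.instance Definition _ := GRing.isZmodClosed.Build cohseq evz evz_zmod_closed.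

Fact evz_mull a x : x \in evz -> a * x \in evz.
Proof.
by move=> /evzP[N xN]; apply/evzP; exists N => n /xN xn; rewrite /= xn mulr0.
Qed.

Fact evz_mulr a x : x \in evz -> x * a \in evz.
Proof.
by move=> /evzP[N xN]; apply/evzP; exists N => n /xN xn; rewrite /= xn mul0r.
Qed.

Fact evz_proper : 1 \notin evz.
Proof. by apply/evzP => -[N /(_ N (leqnn N)) /eqP]; rewrite oner_eq0. Qed.

Definition evz_ideal : ideal cohseq := Ideal evz_mull evz_mulr evz_proper.

Definition dirlim : algType k := alg_quot evz_ideal.

Local Notation cls := (proj evz_ideal).

Lemma clsP (a b : cohseq) N : (forall n, (N <= n)%N -> a n = b n) ->
  cls a = cls b.
Proof.
move=> ab; apply/projP/evzP; exists N => n /ab abn.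
have -> : (a - b) n = a n - b n by [].
by rewrite abn subrr.
Qed.

Fixpoint ext n (a : A n) m : A m :=
  match n =P m with
  | ReflectT e => eq_rect n A a m e
  | ReflectF _ => if m is m'.+1 return A m then phi m' (ext a m') else 0
  end.

Lemma ext_id n (a : A n) : ext a n = a.
Proof. by case: n a => [|n] a /=; case: eqP => // e; rewrite eq_axiomK. Qed.

Lemma extS n (a : A n) m : (n <= m)%N -> ext a m.+1 = phi m (ext a m).
Proof. by move=> nm /=; case: eqP => // e; case/negP: (ltnn m); rewrite -{1}e. Qed.

Fact coh_ext n (a : A n) : exists N, coherent_from N (ext a).
Proof. by exists n => m; apply: extS. Qed.

Lemma ext_coh (a : cohseq) N m : coherent_from N a -> (N <= m)%N ->
  ext (a N) m = a m.
Proof.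
move=> aN /subnK <-; elim: (m - N)%N => [|d IHd]; first exact: ext_id.
by rewrite addSn extS ?leq_addl // IHd aN ?leq_addl.
Qed.

Definition inj_seq n (a : A n) : cohseq := CohSeq (coh_ext a).
Definition dirlim_in n (a : A n) : dirlim := cls (inj_seq a).

Lemma ext_ind n (P : forall m, A m -> A m -> A m -> Prop) (a b c : A n) :
  P n a b c ->
  (forall m x y z, P m x y z -> P m.+1 (phi m x) (phi m y) (phi m z)) ->
  forall m, (n <= m)%N -> P m (ext a m) (ext b m) (ext c m).
Proof.
move=> P0 PS m /subnK <-; elim: (m - n)%N => [|d IHd].
  by rewrite !ext_id.
by rewrite addSn !extS ?leq_addl //; apply: PS.
Qed.

Fact dirlim_in_is_linear n : linear (@dirlim_in n).
Proof.
move=> c a b; rewrite /dirlim_in -linearP; apply: (@clsP _ _ n) => m nm.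
rewrite [RHS]/(c *: ext a m + ext b m) /=.
apply: (@ext_ind n (fun m x y z => x = c *: y + z)) nm => //.
by move=> m' x y z ->; rewrite linearP.
Qed.

HB.instance Definition _ n :=
  GRing.isLinear.Build k (A n) dirlim _ (@dirlim_in n) (@dirlim_in_is_linear n).

Fact dirlim_in_is_monoid_morphism n : monoid_morphism (@dirlim_in n).
Proof.
split.
  rewrite -(rmorph1 cls); apply: (@clsP _ _ n) => m nm.
  apply: (@ext_ind n (fun m x y z => x = 1)) nm => //; try exact: 1.
  by move=> m' x y z ->; rewrite rmorph1.
move=> a b; rewrite /dirlim_in -rmorphM; apply: (@clsP _ _ n) => m nm.
rewrite [RHS]/(ext a m * ext b m) /=.
apply: (@ext_ind n (fun m x y z => x = y * z)) nm => //.
by move=> m' x y z ->; rewrite rmorphM.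
Qed.

HB.instance Definition _ n :=
  GRing.isMonoidMorphism.Build (A n) dirlim (@dirlim_in n)
    (@dirlim_in_is_monoid_morphism n).

Lemma cls_in (a : cohseq) N : coherent_from N a -> cls a = dirlim_in (a N).
Proof. by move=> aN; apply: (@clsP _ _ N) => m /(ext_coh aN). Qed.

Lemma dirlim_in_phi n (a : A n) : dirlim_in (phi n a) = dirlim_in a.
Proof.
rewrite [RHS](@cls_in _ n.+1); last by move=> m /ltnW; apply: extS.
by rewrite /= [X in _ = dirlim_in X](@extS n) // ext_id.
Qed.

Section Universal.
Variables (T : algType k) (psi : forall n, {lrmorphism A n -> T}).
Hypothesis psi_phi : forall n a, psi n.+1 (phi n a) = psi n a.

Lemma psi_coh (a : cohseq) N n : coherent_from N a -> (N <= n)%N ->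
  psi n (a n) = psi N (a N).
Proof.
move=> aN /subnK <-; elim: (n - N)%N => [//|d IHd].
by rewrite addSn aN ?leq_addl // psi_phi.
Qed.

Definition out (u : dirlim) : T :=
  let a := repr u : cohseq in let N := sval (cid (cs_coh a)) in psi N (a N).

Lemma out_cls (a : cohseq) N : coherent_from N a -> out (cls a) = psi N (a N).
Proof.
move=> aN; rewrite /out; case: cid => M /= bM.
have /evzP[P abP] := @repr_proj _ _ evz_ideal a.
pose n := maxn M (maxn N P).
rewrite -(psi_coh (n := n) bM) ?leq_maxl //.
rewrite -(psi_coh (n := n) aN); last by rewrite !leq_max leqnn orbT.
congr (psi n _); apply/eqP; rewrite -subr_eq0; apply/eqP.
by apply: abP; rewrite !leq_max leqnn !orbT.
Qed.

Lemma coh2 (u v : dirlim) : exists n (a b : A n),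
  u = dirlim_in a /\ v = dirlim_in b.
Proof.
have [a <-] := proj_surj u; have [b <-] := proj_surj v.
have [M aM] := cs_coh a; have [N bN] := cs_coh b.
exists (maxn M N), (a (maxn M N)), (b (maxn M N)); split; apply: cls_in => n.
  by rewrite geq_max => /andP[/aM].
by rewrite geq_max => /andP[_ /bN].
Qed.

Lemma out_in n (a : A n) : out (dirlim_in a) = psi n a.
Proof.
rewrite (@out_cls _ n); last by move=> m; apply: extS.
by rewrite /= ext_id.
Qed.

Fact out_is_linear : linear out.
Proof.
move=> c u v; have [n [a [b [-> ->]]]] := coh2 u v.
by rewrite -linearP !out_in linearP.
Qed.

HB.instance Definition _ :=
  GRing.isLinear.Build k dirlim T _ out out_is_linear.

Fact out_is_monoid_morphism : monoid_morphism out.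
Proof.
split; first by rewrite -(rmorph1 (@dirlim_in 0)) out_in rmorph1.
move=> u v; have [n [a [b [-> ->]]]] := coh2 u v.
by rewrite -rmorphM !out_in rmorphM.
Qed.

HB.instance Definition _ :=
  GRing.isMonoidMorphism.Build dirlim T out out_is_monoid_morphism.

Definition dirlim_out : {lrmorphism dirlim -> T} := out.

End Universal.

Lemma dirlimP : is_direct_limit phi (fun n => @dirlim_in n : {lrmorphism _ -> _}).
Proof.
split; first exact: dirlim_in_phi.
move=> T psi psi_phi; exists (dirlim_out psi_phi); split.
  by move=> n a; apply: out_in.
move=> v vpsi u; have [n [a [_ [-> _]]]] := coh2 u u.
by rewrite [LHS]vpsi; symmetry; apply: out_in.
Qed.

End DirectLimit.

Fixpoint fib (n : nat) : nat :=
  if n is m.+1 then (if m is l.+1 then fib m + fib l else 1)%N else 1%N.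

Lemma fib_gt0 n : (0 < fib n)%N.
Proof. by elim: n => [|[|n] IHn] //=; rewrite addn_gt0 IHn. Qed.

Section FibonacciSystem.
Variable k : fieldType.

(* The algebras are indexed from 0: [Sn n] is M_{f_{n+1}} + M_{f_n}, that is,
   S_{n+1}. *)
Definition Sn (n : nat) : Type := ('M[k]_(fib n.+1) * 'M[k]_(fib n))%type.

HB.instance Definition _ n := GRing.PzRing.on (Sn n).
HB.instance Definition _ n := GRing.Lmodule.on (Sn n).

Fact Sn_one_neq0 n : 1 != 0 :> Sn n.
Proof.
apply/eqP => /(congr1 (fun a : Sn n => a.2)) /matrixP.
move/(_ (Ordinal (fib_gt0 n)) (Ordinal (fib_gt0 n))) => /eqP.
by rewrite !mxE eqxx oner_eq0.
Qed.

HB.instance Definition _ n :=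
  GRing.PzSemiRing_isNonZero.Build (Sn n) (@Sn_one_neq0 n).

Fact Sn_scaleAl n (c : k) (a b : Sn n) : c *: (a * b) = (c *: a) * b.
Proof. congr pair; exact: scalemxAl. Qed.

HB.instance Definition _ n :=
  GRing.LSemiModule_isLSemiAlgebra.Build k (Sn n) (@Sn_scaleAl n).

Fact Sn_scaleAr n (c : k) (a b : Sn n) : c *: (a * b) = a * (c *: b).
Proof. congr pair; exact: scalemxAr. Qed.

HB.instance Definition _ n :=
  GRing.LSemiAlgebra_isSemiAlgebra.Build k (Sn n) (@Sn_scaleAr n).

Definition phi n (a : Sn n) : Sn n.+1 := (block_mx a.1 0 0 a.2, a.1).

Fact phi_is_linear n : linear (@phi n).
Proof.
move=> c a b; congr pair => /=.
by rewrite scale_block_mx add_block_mx !scaler0 !addr0.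
Qed.

HB.instance Definition _ n :=
  GRing.isLinear.Build k (Sn n) (Sn n.+1) _ (@phi n) (@phi_is_linear n).

Fact phi_is_monoid_morphism n : monoid_morphism (@phi n).
Proof.
split; first by congr pair; rewrite /= -scalar_mx_block.
move=> a b; congr pair => /=.
rewrite -[RHS]/(block_mx a.1 0 0 a.2 *m block_mx b.1 0 0 b.2).
by rewrite mulmx_block !mulmx0 !mul0mx !addr0 !add0r.
Qed.

HB.instance Definition _ n :=
  GRing.isMonoidMorphism.Build (Sn n) (Sn n.+1) (@phi n)
    (@phi_is_monoid_morphism n).

End FibonacciSystem.

(* Main.v *)
From HB Require Import structures.
From mathcomp Require Import all_boot all_algebra.
From mathcomp Require Import finmap boolp reals complex monalg.
From mathcomp Require Import zify.
Require Import Defs.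

(** The functor to S-modules is M |-> Hom(O, M), computed by hand. Since y y = 0, an
    element m of a graded module is determined up to torsion by x m and y m, and y m
    is determined up to torsion by x y m alone. Trading m for the pair (x m, x y m) is
    the isomorphism of O with O(-1) + O(-2) in QGr; its iterates identify O with the
    sum of f_(n+1) copies of O(-n-1) and f_n copies of O(-n-2). On the rows with
    f_(n+1) entries in M_(n+1) and f_n entries in M_(n+2) the algebra S_n acts by
    right multiplication, and the trade (tstep) carries rows of level n to rows of
    level n+1 compatibly with phi. The colimit F0 M of these rows is a right S-module.
    A homogeneous row dies in the colimit exactly if its entries are torsion (inj_eq0,
    inj_torsion), so F0 inverts the morphisms with torsion kernel and cokernel
    (F0_inverts) and factors through QGr as FQ.

    Conversely an S-module N gives the graded module G0 N with one copy of N in each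
    degree n+1, on which x and y act through the matrix units of S that describe the
    trade. The matrix units recover N from G0 N (counit_injective, counit_surjective),
    and they show that the comparison Jmap of the positive part of M with G0 (F0 M)
    has torsion kernel and cokernel (Jmap_ker, Jmap_coker). This is the equivalence of
    QGr with the category of S-modules (FQ_equivalence).

    For the finitely presented objects the key fact is that a finitely presented
    graded module coincides in large degrees with a free one: there M_(n+1) is the
    direct sum of x M_n and y M_n, x is injective on M_n, and the elements of M_n
    killed by y are those of y M_(n-1) (finitely_presented_tame). Bases of x M_n and
    of x y M_n generate a free submodule of finite codimension, for every large n
    (free_tail). Consequently the free modules with generators in large degrees behave
    in qgr like projective objects: morphisms of qgr become morphisms of modules after
    restriction to such a tail (loc_fraction, tail_lift), and equations that hold up
    to torsion become equations (F0map_eq_tail). This gives fullness and faithfulness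
    on qgr (qF_full, qF_faithful). The image of a free module with generators in
    degrees d_l + 1 is the direct sum of the right ideals e_l S for idempotents e_l of
    S (F0_Pd_finitely_presented), so finitely presented objects go to finitely
    presented modules. Every finitely presented S-module arises in this way, because
    the entries of a matrix that presents it lie in a single S_n
    (F0_essentially_surjective). Finally B itself is free on a generator of degree 0,
    and F0 turns bases of degree 0 into bases (hat_sum_injective, hat_sum_surjective),
    so F0 B is S. *)

Set Implicit Arguments.
Unset Strict Implicit.
Unset Printing Implicit Defensive.

Import GRing.Theory.
Local Open Scope ring_scope.
Local Open Scope quotient_scope.

(** * Localizations and equivalences of categories *)

Definition inverse_pair (C : category) (x y : C) (f : hom x y) (g : hom y x) :=
  heq (cmp g f) (idm x) /\ heq (cmp f g) (idm y).

Definition invertible (C : category) (x y : C) (f : hom x y) : Prop :=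
  exists g, inverse_pair f g.

Lemma cmp_congr_l (C : category) (x y z : C) (g : hom y z) (f f' : hom x y) :
  heq f f' -> heq (cmp g f) (cmp g f').
Proof. by apply: cmp_heq; apply: heq_refl. Qed.

Lemma cmp_congr_r (C : category) (x y z : C) (g g' : hom y z) (f : hom x y) :
  heq g g' -> heq (cmp g f) (cmp g' f).
Proof. by move=> h; apply: cmp_heq h (heq_refl _). Qed.

Lemma invertible_epi (C : category) (x y z : C) (f : hom x y) (g h : hom y z) :
  invertible f -> heq (cmp g f) (cmp h f) -> heq g h.
Proof.
move=> [f' [_ ff']] gh.
have E (u : hom y z) : heq u (cmp (cmp u f) f').
  apply: heq_trans (cmpA _ _ _); apply/heq_sym.
  exact: heq_trans (cmp_congr_l u ff') (cmpm1 u).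
by apply: heq_trans (E g) _; apply: heq_trans (heq_sym (E h)); apply: cmp_congr_r.
Qed.

Lemma invertible_mono (C : category) (x y z : C) (f : hom y z) (g h : hom x y) :
  invertible f -> heq (cmp f g) (cmp f h) -> heq g h.
Proof.
move=> [f' [f'f _]] gh.
have E (u : hom x y) : heq u (cmp f' (cmp f u)).
  apply/heq_sym/(heq_trans (cmpA _ _ _)).
  exact: heq_trans (cmp_congr_r u f'f) (cmp1m u).
by apply: heq_trans (E g) _; apply: heq_trans (heq_sym (E h)); apply: cmp_congr_l.
Qed.

Lemma invertible_cmp (C : category) (x y z : C) (g : hom y z) (f : hom x y) :
  invertible g -> invertible f -> invertible (cmp g f).
Proof.
move=> [g' [g'g gg']] [f' [f'f ff']]; exists (cmp f' g'); split.
  apply: heq_trans (cmpA _ _ _) _; apply: heq_trans f'f; apply: cmp_congr_r.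
  apply: heq_trans (heq_sym (cmpA _ _ _)) _.
  by apply: heq_trans (cmpm1 f'); apply: cmp_congr_l.
apply: heq_trans (cmpA _ _ _) _; apply: heq_trans gg'; apply: cmp_congr_r.
apply: heq_trans (heq_sym (cmpA _ _ _)) _.
by apply: heq_trans (cmpm1 g); apply: cmp_congr_l.
Qed.

Lemma invertible_fmap (C D : category) (F : functor C D) (x y : C) (f : hom x y) :
  invertible f -> invertible (fmap F f).
Proof.
move=> [g [gf fg]]; exists (fmap F g); split.
  apply: heq_trans (heq_sym (fmap_cmp F g f)) _.
  exact: heq_trans (fmap_heq F gf) (fmap_id F x).
apply: heq_trans (heq_sym (fmap_cmp F f g)) _.
exact: heq_trans (fmap_heq F fg) (fmap_id F y).
Qed.

Section LocLift.
Variables (C D : category) (W : forall x y : C, hom x y -> Prop).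
Variables (F : functor C D).
Hypothesis FW : forall x y (f : hom x y), W f -> invertible (fmap F f).

Fixpoint loc_lift_map x y (f : loc_hom W x y) : hom (F x) (F y) :=
  match f with
  | Loc _ _ f => fmap F f
  | LocInv _ _ _ Ww => sval (cid (FW Ww))
  | LocCmp _ _ _ g f => cmp (loc_lift_map g) (loc_lift_map f)
  end.

Lemma loc_lift_map_eq x y (f g : loc_hom W x y) :
  loc_eq f g -> heq (loc_lift_map f) (loc_lift_map g).
Proof.
elim=> {x y f g} /=.
- by move=> *; apply: heq_refl.
- by move=> x y f g _; apply: heq_sym.
- by move=> x y f g h _ fg _; apply: heq_trans.
- by move=> x y z g g' f f' _ ? _ ?; apply: cmp_heq.
- move=> x y f; apply: heq_trans (cmp1m _).
  by apply: cmp_congr_r; apply: fmap_id.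
- move=> x y f; apply: heq_trans (cmpm1 _).
  by apply: cmp_congr_l; apply: fmap_id.
- by move=> *; apply: cmpA.
- by move=> x y f g fg; apply/fmap_heq.
- by move=> x y z g f; apply: fmap_cmp.
- move=> x y w Ww; case: cid => /= g [gw _].
  by apply: heq_trans gw _; apply/heq_sym/fmap_id.
- move=> x y w Ww; case: cid => /= g [_ wg].
  by apply: heq_trans wg _; apply/heq_sym/fmap_id.
Qed.

(** The inverses of the images of the morphisms in W are chosen one by one; by uniqueness
    of inverses the choices are compatible. *)
Definition loc_lift : functor (localization W) D :=
  @Functor (localization W) D F loc_lift_map loc_lift_map_eq
    (fun x => fmap_id F x) (fun _ _ _ g f => heq_refl _).

End LocLift.

Lemma invertible_Loc (C : category) (W : forall x y : C, hom x y -> Prop)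
    (x y : C) (w : hom x y) : W x y w ->
  invertible (C := localization W) (Loc W w).
Proof. by move=> Ww; exists (LocInv Ww); split; [apply: loc_VK|apply: loc_KV]. Qed.

Section LocFunctor.
Variables (C : category) (W : forall x y : C, hom x y -> Prop).

Definition loc_functor : functor C (localization W) :=
  @Functor C (localization W) id (fun _ _ f => Loc W f) (fun _ _ _ _ fg => loc_heq W fg)
    (fun _ => loc_refl _) (fun _ _ _ g f => loc_cmp W g f).

End LocFunctor.

(** Only the formal inverses of W need an argument: a commuting square whose horizontal
    sides are invertible still commutes after inverting them. *)
Lemma loc_natural (C D : category) (W : forall x y : C, hom x y -> Prop)
    (F G : functor (localization W) D) (a : forall x, hom (F x) (G x)) :
  (forall (x y : C) (f : @hom C x y),
     heq (cmp (a y) (fmap F (Loc W f))) (cmp (fmap G (Loc W f)) (a x))) ->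
  forall x y (f : hom (c := localization W) x y),
    heq (cmp (a y) (fmap F f)) (cmp (fmap G f) (a x)).
Proof.
move=> aN x y f; elim: {x y} f => [x y f|x y w Ww|x y z g IHg f IHf].
- exact: aN.
- set i : hom (c := localization W) y x := LocInv Ww.
  have wI := invertible_Loc Ww.
  apply: (invertible_epi (invertible_fmap F wI)).
  have iw (H : functor (localization W) D) :
      heq (cmp (fmap H i) (fmap H (Loc W w))) (idm (H x)).
    apply: heq_trans (heq_sym (fmap_cmp H _ _)) _.
    exact: heq_trans (fmap_heq H (loc_VK Ww)) (fmap_id H x).
  apply: heq_trans (heq_sym (cmpA _ _ _)) _.
  apply: heq_trans (cmp_congr_l _ (iw F)) _; apply: heq_trans (cmpm1 _) _.
  apply: heq_sym; apply: heq_trans (heq_sym (cmpA _ _ _)) _.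
  apply: heq_trans (cmp_congr_l _ (aN _ _ w)) _.
  apply: heq_trans (cmpA _ _ _) _.
  exact: heq_trans (cmp_congr_r _ (iw G)) (cmp1m _).
- apply: heq_trans (cmp_congr_l _ (fmap_cmp F _ _)) _.
  apply: heq_trans (cmpA _ _ _) _.
  apply: heq_trans (cmp_congr_r _ IHg) _.
  apply: heq_trans (heq_sym (cmpA _ _ _)) _.
  apply: heq_trans (cmp_congr_l _ IHf) _.
  apply: heq_trans (cmpA _ _ _) _.
  exact: cmp_congr_r (heq_sym (fmap_cmp G _ _)).
Qed.

(** The inverse functor picks a preimage of every object and transports morphisms along
    the chosen isomorphisms. *)
Lemma full_faithful_equivalence (C D : category) (F : functor C D) :
  (forall y, exists x, isomorphic (F x) y) ->
  (forall x y (h : hom (F x) (F y)), exists f, heq (fmap F f) h) ->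
  (forall x y (f g : hom x y), heq (fmap F f) (fmap F g) -> heq f g) ->
  is_equivalence F.
Proof.
move=> Fsurj Ffull Ffaith.
have [g0 g0P] := choice Fsurj.
have iP y : exists e : hom (F (g0 y)) y, invertible e.
  by have [f [g fg]] := g0P y; exists f, g.
pose e y := sval (cid (iP y)).
have eP y : invertible (e y) by rewrite /e; case: cid.
pose e' y := sval (cid (eP y)).
have e'e y : heq (cmp (e' y) (e y)) (idm _) by rewrite /e'; case: cid => ? [].
have ee' y : heq (cmp (e y) (e' y)) (idm _) by rewrite /e'; case: cid => ? [].
pose g1 y y' (h : hom y y') := sval (cid (Ffull _ _ (cmp (e' y') (cmp h (e y))))).
have g1P y y' (h : hom y y') : heq (fmap F (g1 _ _ h)) (cmp (e' y') (cmp h (e y))).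
  by rewrite /g1; case: cid.
have eN y y' (h : hom y y') : heq (cmp (e y') (fmap F (g1 _ _ h))) (cmp h (e y)).
  apply: heq_trans (cmp_congr_l _ (g1P _ _ h)) _.
  apply: heq_trans (cmpA _ _ _) _.
  exact: heq_trans (cmp_congr_r _ (ee' _)) (cmp1m _).
have eU x y (u v : hom x (g0 y)) :
    heq (cmp (e y) (fmap F u)) (cmp (e y) (fmap F v)) -> heq u v.
  by move=> uv; apply/Ffaith/(invertible_mono (eP y)).
have g1_heq y y' (h h' : hom y y') : heq h h' -> heq (g1 _ _ h) (g1 _ _ h').
  move=> hh'; apply: eU; apply: heq_trans (eN _ _ h) _.
  exact: heq_trans (cmp_congr_r _ hh') (heq_sym (eN _ _ h')).
have g1_id y : heq (g1 _ _ (idm y)) (idm (g0 y)).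
  apply: eU; apply: heq_trans (eN _ _ _) _; apply: heq_trans (cmp1m _) _.
  apply: heq_sym; apply: heq_trans (cmp_congr_l _ (fmap_id F _)) _.
  exact: cmpm1.
have g1_cmp y y' y'' (h' : hom y' y'') (h : hom y y') :
    heq (g1 _ _ (cmp h' h)) (cmp (g1 _ _ h') (g1 _ _ h)).
  apply: eU; apply: heq_trans (eN _ _ _) _.
  apply: heq_sym; apply: heq_trans (cmp_congr_l _ (fmap_cmp F _ _)) _.
  apply: heq_trans (cmpA _ _ _) _.
  apply: heq_trans (cmp_congr_r _ (eN _ _ _)) _.
  apply: heq_trans (heq_sym (cmpA _ _ _)) _.
  apply: heq_trans (cmp_congr_l _ (eN _ _ _)) _.
  exact: cmpA.
pose G : functor D C := Functor g1_heq g1_id g1_cmp.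
exists G; split; last first.
  by exists e, e'; split=> //; apply: eN.
have uP x : exists u : hom (g0 (F x)) x, heq (fmap F u) (e (F x)) by apply: Ffull.
have vP x : exists v : hom x (g0 (F x)), heq (fmap F v) (e' (F x)) by apply: Ffull.
exists (fun x => sval (cid (uP x))), (fun x => sval (cid (vP x))).
split=> [x|x|x y f] /=.
- case: cid => v /= vE; case: cid => u /= uE.
  apply: Ffaith; apply: heq_trans (fmap_cmp F _ _) _.
  apply: heq_trans (cmp_heq vE uE) _.
  exact: heq_trans (e'e _) (heq_sym (fmap_id F _)).
- case: cid => u /= uE; case: cid => v /= vE.
  apply: Ffaith; apply: heq_trans (fmap_cmp F _ _) _.
  apply: heq_trans (cmp_heq uE vE) _.
  exact: heq_trans (ee' _) (heq_sym (fmap_id F _)).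
- case: cid => u /= uE; case: cid => v /= vE.
  apply: Ffaith; apply: heq_trans (fmap_cmp F _ _) _.
  apply: heq_trans (cmp_congr_r _ uE) _.
  apply: heq_trans (eN _ _ _) _.
  apply: heq_sym; apply: heq_trans (fmap_cmp F _ _) _.
  by apply: cmp_congr_l.
Qed.

Lemma invertible_heq (C : category) (x y : C) (f g : hom x y) :
  heq f g -> invertible f -> invertible g.
Proof.
move=> fg [f' [f'f ff']]; exists f'; split.
  exact: heq_trans (cmp_congr_l _ (heq_sym fg)) f'f.
exact: heq_trans (cmp_congr_r _ (heq_sym fg)) ff'.
Qed.

(** A functor out of a localization can be tested on a class T of objects that are
    projective up to W: every object receives a morphism in W from an object of T,
    and morphisms from objects of T lift along W after a further refinement in W. *)
Section LocalizationCover.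
Variables (C D : category) (W : forall x y : C, hom x y -> Prop) (T : C -> Prop).
Variable F : functor (localization W) D.
Local Notation LF := (loc_functor W).

Hypothesis cover : forall x, exists p, T p /\ exists f : hom p x, W f.
Hypothesis lift : forall (x y p : C) (w : hom x y) (f : hom p y), W w -> T p ->
  exists q (s : hom q p) (g : hom q x), [/\ T q, W s & heq (cmp w g) (cmp f s)].

(** Lifting along w replaces the formal inverse of w by an actual morphism, at the price
    of shrinking the source; by induction this removes all formal inverses. *)
Lemma loc_fraction (x y p : C) (h : loc_hom W x y) (f : hom p x) : T p ->
  exists q (s : hom q p) (g : hom q y), [/\ T q, invertible (fmap LF s)
    & heq (cmp (h : hom (LF x) (LF y)) (fmap LF (cmp f s))) (fmap LF g)].
Proof using lift.
elim: h p f => {x y} [x y h|x y w Ww|x y z h IHh h' IHh'] p f Tp.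
- exists p, (idm p), (cmp h (cmp f (idm p))); split=> //; last exact: heq_sym (fmap_cmp LF h _).
  exact: invertible_heq (heq_sym (fmap_id LF _)) (ex_intro _ _ (conj (cmp1m _) (cmp1m _))).
- have [q [s [g [Tq sW gE]]]] := lift f Ww Tp; have sI := invertible_Loc sW.
  pose i : hom (LF y) (LF x) := LocInv Ww.
  have wi : heq (cmp (fmap LF w) i) (idm _) := loc_KV Ww.
  exists q, s, g; split=> //; apply: (invertible_mono (invertible_Loc Ww)).
  apply: heq_trans (cmpA _ i _) _; apply: heq_trans (cmp_congr_r _ wi) _.
  apply: heq_trans (cmp1m _) _; apply: heq_trans _ (fmap_cmp LF w g).
  exact: fmap_heq (heq_sym gE).
- have [q1 [s1 [g1 [Tq1 s1I E1]]]] := IHh' p f Tp.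
  have [q2 [s2 [g2 [Tq2 s2I E2]]]] := IHh q1 g1 Tq1.
  exists q2, (cmp s1 s2), g2; split=> //.
    exact: invertible_heq (heq_sym (fmap_cmp LF _ _)) (invertible_cmp s1I s2I).
  apply: heq_trans _ E2; apply: heq_trans (heq_sym (cmpA _ _ _)) _; apply: cmp_congr_l.
  apply: heq_trans (cmp_congr_l _ (fmap_heq LF (cmpA f s1 s2))) _.
  apply: heq_trans (cmp_congr_l _ (fmap_cmp LF _ _)) _.
  apply: heq_trans (cmpA _ _ _) _; apply: heq_trans (cmp_congr_r _ E1) _.
  exact: heq_sym (fmap_cmp LF g1 s2).
Qed.

(** On a common refinement both morphisms become morphisms of C, where equality can be
    tested by the hypothesis. *)
Lemma loc_faithful :
  (forall (p y : C) (f g : hom p y), T p ->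
     heq (fmap F (fmap LF f)) (fmap F (fmap LF g)) ->
     exists q (s : hom q p), W s /\ heq (cmp f s) (cmp g s)) ->
  forall (x y : localization W) (h h' : hom x y), heq (fmap F h) (fmap F h') -> heq h h'.
Proof using cover lift.
move=> eqF x y h h' hh'; have [p [Tp [f fW]]] := cover x.
have fI : invertible (fmap LF f) := invertible_Loc fW.
have [q1 [s1 [g1 [Tq1 s1I E1]]]] := loc_fraction h f Tp.
have [q2 [s2 [g2 [Tq2 s2I E2]]]] := loc_fraction h' (cmp f s1) Tq1.
have uI : invertible (fmap LF (cmp (cmp f s1) s2)).
  apply: invertible_heq (heq_sym (fmap_cmp LF _ _)) (invertible_cmp _ s2I).
  exact: invertible_heq (heq_sym (fmap_cmp LF _ _)) (invertible_cmp fI s1I).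
set u := cmp (cmp f s1) s2 in uI E2.
have E1' : heq (cmp h (fmap LF u)) (fmap LF (cmp g1 s2)).
  apply: heq_trans _ (heq_sym (fmap_cmp LF g1 s2)).
  apply: heq_trans (cmp_congr_l _ (fmap_cmp LF _ _)) _.
  by apply: heq_trans (cmpA _ _ _) _; apply: cmp_congr_r.
have F12 : heq (fmap F (fmap LF (cmp g1 s2))) (fmap F (fmap LF g2)).
  apply: heq_trans (heq_sym (fmap_heq F E1')) (heq_trans (fmap_cmp F h (fmap LF u)) _).
  apply: heq_trans (cmp_congr_r _ hh') _.
  exact: heq_trans (heq_sym (fmap_cmp F h' (fmap LF u))) (fmap_heq F E2).
have [q3 [s3 [s3W s3E]]] := eqF _ _ _ _ Tq2 F12.
apply: (invertible_epi uI); apply: (invertible_epi (invertible_Loc s3W)).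
apply: heq_trans (cmp_congr_r _ E1') (heq_trans _ (cmp_congr_r _ (heq_sym E2))).
apply: heq_trans (heq_sym (fmap_cmp LF (cmp g1 s2) s3)) (heq_trans _ (fmap_cmp LF g2 s3)).
exact: fmap_heq.
Qed.

Lemma loc_full :
  (forall (p y : C) (h : hom (F p) (F y)), T p -> exists q (s : hom q p) (g : hom q y),
     W s /\ heq (fmap F (fmap LF g)) (cmp h (fmap F (fmap LF s)))) ->
  forall (x y : localization W) (h : hom (F x) (F y)), exists f, heq (fmap F f) h.
Proof using cover.
move=> Ffull x y h; have [p [Tp [f fW]]] := cover x.
have fI : invertible (fmap LF f) := invertible_Loc fW.
have [q [s [g [sW gE]]]] := Ffull _ _ (cmp h (fmap F (fmap LF f))) Tp.
have uI : invertible (cmp (fmap LF f) (fmap LF s)) := invertible_cmp fI (invertible_Loc sW).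
have [t [tu _]] := uI; exists (cmp (fmap LF g) t).
apply: (invertible_epi (invertible_fmap F uI)).
apply: heq_trans (heq_sym (fmap_cmp F _ _)) _.
apply: heq_trans (fmap_heq F (heq_sym (cmpA _ _ _))) _.
apply: heq_trans (fmap_heq F (cmp_congr_l _ tu)) _.
apply: heq_trans (fmap_heq F (cmpm1 _)) _; apply: heq_trans gE _.
apply: heq_trans (heq_sym (cmpA _ _ _)) _.
exact: cmp_congr_l (heq_sym (fmap_cmp F _ _)).
Qed.

End LocalizationCover.

Section Corestriction.
Variables (C D : category) (P : D -> Prop) (F : functor C D).
Hypothesis FP : forall x, P (F x).

Definition corestriction : functor C (full_subcategory P) :=
  @Functor C (full_subcategory P) (fun x => exist P (F x) (FP x)) (fun _ _ f => fmap F f)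
    (fun _ _ _ _ => @fmap_heq _ _ F _ _ _ _) (fmap_id F) (fun _ _ _ => @fmap_cmp _ _ F _ _ _).

Lemma corestrictionK : nat_iso F (functor_comp (inclusion P) corestriction).
Proof.
exists (fun x => idm (F x)), (fun x => idm (F x)); split.
- by move=> x; apply: cmp1m.
- by move=> x; apply: cmp1m.
- by move=> x y f; apply: heq_trans (cmp1m _) (heq_sym (cmpm1 _)).
Qed.

End Corestriction.

(** * Homogeneous components *)

Section Components.
Variables (V : zmodType) (V_ : int -> V -> Prop).
Hypothesis Vgr : is_grading V_.

Lemma grading0 i : V_ i 0. Proof. by case: Vgr. Qed.

Lemma gradingB i u v : V_ i u -> V_ i v -> V_ i (u - v).
Proof. by case: Vgr => _ + _ _; apply. Qed.

Lemma gradingN i u : V_ i u -> V_ i (- u).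
Proof. by move=> Vu; rewrite -sub0r; apply: gradingB => //; apply: grading0. Qed.

Lemma gradingD i u v : V_ i u -> V_ i v -> V_ i (u + v).
Proof. by move=> Vu /gradingN Vv; have := gradingB Vu Vv; rewrite opprK. Qed.

Lemma grading_sum i I (r : seq I) (P : pred I) (u : I -> V) :
  (forall j, P j -> V_ i (u j)) -> V_ i (\sum_(j <- r | P j) u j).
Proof. by move=> h; apply: big_ind => //; [apply: grading0|apply: gradingD]. Qed.

Definition decomposition (v : V) (w : int -> V) : Prop :=
  (forall i, V_ i (w i)) /\
  exists s : seq int, [/\ uniq s, forall i, i \notin s -> w i = 0
                        & v = \sum_(i <- s) w i].

Lemma big_widen (s s' : seq int) (w : int -> V) : uniq s -> uniq s' ->
  {subset s <= s'} -> (forall i, i \notin s -> w i = 0) ->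
  \sum_(i <- s') w i = \sum_(i <- s) w i.
Proof.
move=> us us' ss' w0; rewrite (bigID (mem s)) /= [X in _ + X]big1 ?addr0 //.
rewrite -big_filter; apply: perm_big; apply: uniq_perm => //.
  exact: filter_uniq.
by move=> i; rewrite mem_filter; case: (boolP (i \in s)) => //= /ss'.
Qed.

Lemma decomposition_exists v : exists w, decomposition v w.
Proof.
have [_ _ /(_ v)[s [u [us uV ->]]] _] := Vgr.
exists (fun i => if i \in s then u i else 0); split.
  by move=> i; case: ifP => // _; apply: grading0.
exists s; split=> //; first by move=> i /negPf->.
by apply: eq_big_seq => i ->.
Qed.

Lemma decompositionB v v' w w' : decomposition v w -> decomposition v' w' ->
  decomposition (v - v') (fun i => w i - w' i).
Proof.
move=> [wV [s [us ws ->]]] [wV' [s' [us' ws' ->]]]; split.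
  by move=> i; apply: gradingB.
exists (undup (s ++ s')); split.
- exact: undup_uniq.
- move=> i; rewrite mem_undup mem_cat negb_or => /andP[/ws-> /ws'->].
  by rewrite subrr.
- rewrite sumrB; congr (_ - _); apply/esym/big_widen => //;
    try exact: undup_uniq.
    by move=> i is_; rewrite mem_undup mem_cat is_.
  by move=> i is_; rewrite mem_undup mem_cat is_ orbT.
Qed.

Lemma decomposition_unique v w w' :
  decomposition v w -> decomposition v w' -> w =1 w'.
Proof.
move=> vw vw'; have := decompositionB vw vw'; rewrite subrr.
move=> [dV [s [us d0 ds]]] i; apply/eqP; rewrite -subr_eq0; apply/eqP.
have [/d0//|is_] := boolP (i \notin s).
have [_ _ _] := Vgr; move=> /(_ s _ us dV (esym ds) i); apply.
by rewrite negbK in is_.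
Qed.

(** The homogeneous component of degree i. *)
Definition pr (i : int) (v : V) : V := sval (cid (decomposition_exists v)) i.

Lemma pr_decomposition v : decomposition v (pr^~ v).
Proof. by rewrite /pr; case: cid. Qed.

Lemma decomposition_pr v w : decomposition v w -> forall i, pr i v = w i.
Proof. by move=> vw; apply: decomposition_unique (pr_decomposition v) vw. Qed.

Lemma pr_homog i v : V_ i (pr i v).
Proof. by have [] := pr_decomposition v. Qed.

Lemma pr_zmod_morphism i : zmod_morphism (pr i).
Proof.
move=> u v; apply: decomposition_pr (decompositionB _ _) _;
  exact: pr_decomposition.
Qed.

HB.instance Definition _ i := GRing.isZmodMorphism.Build V V (pr i)
  (pr_zmod_morphism i).

Lemma pr_of_homog j v : V_ j v -> forall i, pr i v = if i == j then v else 0.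
Proof.
move=> vj; apply: decomposition_pr; split.
  by move=> i; case: eqP => [->|_] //; apply: grading0.
exists [:: j]; split=> //; last by rewrite big_seq1 eqxx.
by move=> i; rewrite inE => /negPf->.
Qed.

Lemma pr_id i v : V_ i v -> pr i v = v.
Proof. by move=> /pr_of_homog->; rewrite eqxx. Qed.

Lemma pr_pr i j v : pr i (pr j v) = if i == j then pr j v else 0.
Proof. exact: pr_of_homog (pr_homog j v) i. Qed.

Lemma pr_sum v : exists s : seq int,
  [/\ uniq s, forall i, i \notin s -> pr i v = 0 & v = \sum_(i <- s) pr i v].
Proof. by have [] := pr_decomposition v. Qed.

Lemma pr_eq0 v : (forall i, pr i v = 0) -> v = 0.
Proof. by move=> v0; have [s [_ _ ->]] := pr_sum v; rewrite big1. Qed.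

Lemma pr_bound v : exists D : nat, forall i : int, pr i v != 0 ->
  (- D%:Z <= i <= D%:Z)%R.
Proof.
have [s [_ v0 _]] := pr_sum v; exists (\max_(i <- s) absz i)%N => i vi.
have is_ : i \in s by apply: contraNT vi => /v0->; rewrite eqxx.
have : (absz i <= \max_(i <- s) absz i)%N.
  by rewrite (big_rem i) //= leq_maxl.
lia.
Qed.

End Components.

Section GradedModuleTheory.
Variables (k : fieldType) (B : gralg k).

Definition gpr (M : grmod B) i : M -> M := pr (gm_grading M) i.
HB.instance Definition _ (M : grmod B) i :=
  GRing.isZmodMorphism.Build M M (@gpr M i) (pr_zmod_morphism (gm_grading M) i).

Lemma gpr_homog (M : grmod B) i (m : M) : gm_comp i (gpr i m).
Proof. exact: pr_homog. Qed.

Lemma gpr_eq0 (M : grmod B) (m : M) : (forall i, gpr i m = 0) -> m = 0.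
Proof. exact: pr_eq0. Qed.

Lemma gpr_sum (M : grmod B) (m : M) : exists s : seq int,
  [/\ uniq s, forall i, i \notin s -> gpr i m = 0 & m = \sum_(i <- s) gpr i m].
Proof. exact: pr_sum. Qed.

Lemma gpr_hom (M N : grmod B) (f : grhom M N) i m : gpr i (f m) = f (gpr i m).
Proof.
have [s [us s0 sE]] := pr_sum (gm_grading M) m.
apply: (decomposition_pr (gm_grading N) (w := fun i => f (gpr i m))); split.
  by move=> j; apply/gh_degree/gpr_homog.
exists s; split=> //; first by move=> j /s0 mj; rewrite /gpr mj raddf0.
by rewrite {1}sE raddf_sum.
Qed.

Lemma gpr_scale (M : grmod B) d (a : B) i (m : M) : ga_comp d a ->
  gpr i (a *: m) = a *: gpr (i - d) m.
Proof.
move=> ad; have [s [us s0 sE]] := pr_sum (gm_grading M) m.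
apply: (decomposition_pr (gm_grading M) (w := fun i => a *: gpr (i - d) m)); split.
  by move=> j; have := gm_scale ad (gpr_homog (j - d) m); rewrite subrKC.
exists [seq j + d | j <- s]; split.
- by rewrite map_inj_uniq //; apply: addIr.
- move=> j js; rewrite /gpr s0 ?scaler0 //; apply: contra js => js.
  by apply/mapP; exists (j - d); rewrite ?subrK.
- rewrite {1}sE scaler_sumr big_map; apply: eq_bigr => j _.
  by rewrite addrK.
Qed.

Lemma ga_comp_scalar (c : k) : ga_comp 0 (c%:A : B).
Proof. exact/ga_scale/ga_one. Qed.

Lemma gm_comp_scalar (M : grmod B) i (c : k) (m : M) :
  gm_comp i m -> gm_comp i ((c%:A : B) *: m).
Proof. by move=> mi; have := gm_scale (ga_comp_scalar c) mi; rewrite add0r. Qed.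

Lemma gpr_scalar (M : grmod B) i (c : k) (m : M) :
  gpr i ((c%:A : B) *: m) = c%:A *: gpr i m.
Proof. by rewrite (gpr_scale _ _ (ga_comp_scalar c)) subr0. Qed.

Lemma ga_pr_scale i (c : k) (b : B) :
  pr (ga_grading B) i (c *: b) = c *: pr (ga_grading B) i b.
Proof.
rewrite -(mulr_algl c b) -(mulr_algl c (pr _ _ _)).
exact: (gpr_scalar (M := structure_module B)).
Qed.

Lemma ga_pr_mul a i (b : B) : ga_comp 1 a ->
  pr (ga_grading B) i (a * b) = a * pr (ga_grading B) (i - 1) b.
Proof. exact: (gpr_scale (M := structure_module B)). Qed.

(** A predicate on the elements rather than a module of its own, so that kernels, images
    and spans can be formed directly; gs_grmod and gq_grmod are the submodule and the
    quotient. *)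
Record gsub (M : grmod B) := GSub {
  gs_mem :> M -> Prop;
  gs0 : gs_mem 0;
  gsB : forall u v, gs_mem u -> gs_mem v -> gs_mem (u - v);
  gsZ : forall b u, gs_mem u -> gs_mem (b *: u);
  gs_gpr : forall i u, gs_mem u -> gs_mem (gpr i u)
}.

Section SubQuotient.
Variables (M : grmod B) (K : gsub M).

Lemma gsN u : K u -> K (- u).
Proof. by move=> Ku; rewrite -sub0r; apply: gsB => //; apply: gs0. Qed.

Lemma gsD u v : K u -> K v -> K (u + v).
Proof. by move=> Ku /gsN Kv; have := gsB Ku Kv; rewrite opprK. Qed.

Lemma gs_sum I (r : seq I) (P : pred I) (u : I -> M) :
  (forall j, P j -> K (u j)) -> K (\sum_(j <- r | P j) u j).
Proof. by move=> h; apply: big_ind => //; [apply: gs0|apply: gsD]. Qed.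

Definition gs_pred : {pred M} := [pred m | `[< K m >]].

Lemma gs_predP m : reflect (K m) (m \in gs_pred).
Proof. exact: asboolP. Qed.

Fact gs_submod_closed : submod_closed gs_pred.
Proof.
split; first exact/gs_predP/gs0.
move=> b u v /gs_predP Ku /gs_predP Kv; apply/gs_predP.
by apply: gsD => //; apply: gsZ.
Qed.

HB.instance Definition _ := GRing.isSubmodClosed.Build B M gs_pred gs_submod_closed.

Definition gs_type : Type := {m : M | m \in gs_pred}.
HB.instance Definition _ := SubType.on gs_type.
HB.instance Definition _ := Choice.on gs_type.
HB.instance Definition _ := [SubChoice_isSubLmodule of gs_type by <:].

Definition gs_mk m (Km : K m) : gs_type :=
  exist (fun m => is_true (m \in gs_pred)) m (introT (gs_predP m) Km).

Definition gs_comp i (u : gs_type) : Prop := gm_comp i (val u).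

Lemma val_decomposition (u : gs_type) : exists w : int -> gs_type,
  forall i, val (w i) = gpr i (val u).
Proof.
have h i : K (gpr i (val u)) by apply/gs_gpr/gs_predP/valP.
by exists (fun i => gs_mk (h i)).
Qed.

Fact gs_grading : is_grading gs_comp.
Proof.
split.
- by move=> i; rewrite /gs_comp raddf0; apply: grading0 (gm_grading M) _.
- move=> i u v ui vi; rewrite /gs_comp raddfB.
  exact: (gradingB (gm_grading M)).
- move=> u; have [w wE] := val_decomposition u.
  have [s [us _ sE]] := pr_sum (gm_grading M) (val u).
  exists s, w; split=> //.
    by move=> i; rewrite /gs_comp wE; apply: gpr_homog.
  apply: val_inj; rewrite raddf_sum /= {1}sE; apply: eq_bigr => i _.
  by rewrite wE.
- move=> s u us uV u0 i is_; apply: val_inj; rewrite raddf0.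
  have [_ _ _] := gm_grading M; move=> /(_ s (fun i => val (u i)) us uV).
  by apply=> //; rewrite -[LHS](raddf_sum val) u0 raddf0.
Qed.

Fact gs_scale i j a (u : gs_type) :
  ga_comp i a -> gs_comp j u -> gs_comp (i + j) (a *: u).
Proof. by move=> ai uj; rewrite /gs_comp linearZ; apply: gm_scale. Qed.

Definition gs_grmod : grmod B := GrMod gs_grading gs_scale.

Definition gs_incl : grhom gs_grmod M :=
  @GrHom k B gs_grmod M (val : {linear gs_type -> M}) (fun i m mi => mi).

Lemma gs_incl_inj : injective gs_incl.
Proof. exact: val_inj. Qed.

Lemma gs_incl_mem (u : gs_grmod) : K (gs_incl u).
Proof. exact/gs_predP/valP. Qed.

Lemma gs_incl_surj m : K m -> exists u : gs_grmod, gs_incl u = m.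
Proof. by move=> Km; exists (gs_mk Km). Qed.

Lemma gs_lift (N : grmod B) (f : grhom N M) : (forall n, K (f n)) ->
  exists g : grhom N gs_grmod, forall n, gs_incl (g n) = f n.
Proof.
move=> h; pose g n : gs_type := gs_mk (h n).
have g_lin : linear g by move=> a u v; apply: val_inj; rewrite [RHS]linearP /= linearP.
pose gL : {linear N -> gs_grmod} := HB.pack g (GRing.isLinear.Build B N gs_type _ g g_lin).
have g_deg i n : gm_comp i n -> gm_comp (g := gs_grmod) i (gL n) by apply: (gh_degree f).
by exists (GrHom g_deg).
Qed.

Definition gq_type : Type := Quotient.quot gs_pred.
HB.instance Definition _ := GRing.Zmodule.on gq_type.

Definition gq_pi (m : M) : gq_type := \pi_(Quotient.quot gs_pred) m.

Lemma gq_piP u v : gq_pi u = gq_pi v <-> K (u - v).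
Proof.
split=> [|/gs_predP] uv; last first.
  by apply/eqP; rewrite -(@Quotient.idealrBE M gs_pred).
by apply/gs_predP; rewrite (@Quotient.idealrBE M gs_pred); apply/eqP.
Qed.

Lemma gq_pi_surj u : exists m, gq_pi m = u.
Proof. by exists (repr u); rewrite /gq_pi reprK. Qed.

Fact gq_pi_zmod_morphism : zmod_morphism gq_pi.
Proof. by move=> u v; rewrite /gq_pi !piE. Qed.

HB.instance Definition _ :=
  GRing.isZmodMorphism.Build M gq_type gq_pi gq_pi_zmod_morphism.

Definition gq_scale (b : B) (u : gq_type) : gq_type := gq_pi (b *: repr u).

Lemma gq_scaleE b m : gq_scale b (gq_pi m) = gq_pi (b *: m).
Proof.
by apply/gq_piP; rewrite -scalerBr; apply/gsZ/gq_piP; rewrite /gq_pi reprK.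
Qed.

Fact gq_scaleA a b u : gq_scale a (gq_scale b u) = gq_scale (a * b) u.
Proof. by have [m <-] := gq_pi_surj u; rewrite !gq_scaleE scalerA. Qed.

Fact gq_scale1 : left_id 1 gq_scale.
Proof. by move=> u; have [m <-] := gq_pi_surj u; rewrite gq_scaleE scale1r. Qed.

Fact gq_scaleDr : right_distributive gq_scale +%R.
Proof.
move=> a u v; have [m <-] := gq_pi_surj u; have [n <-] := gq_pi_surj v.
by rewrite -raddfD !gq_scaleE -raddfD scalerDr.
Qed.

Fact gq_scaleDl u : {morph gq_scale^~ u : a b / a + b}.
Proof.
by move=> a b; have [m <-] := gq_pi_surj u; rewrite !gq_scaleE -raddfD scalerDl.
Qed.

HB.instance Definition _ := GRing.Zmodule_isLmodule.Build B gq_type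
  gq_scaleA gq_scale1 gq_scaleDr gq_scaleDl.

Fact gq_pi_scalable : scalable gq_pi.
Proof. by move=> b m; rewrite /GRing.scale /= gq_scaleE. Qed.

HB.instance Definition _ :=
  GRing.isScalable.Build B M gq_type _ gq_pi gq_pi_scalable.

Definition gq_comp i (u : gq_type) : Prop := exists m, gm_comp i m /\ u = gq_pi m.

Fact gq_grading : is_grading gq_comp.
Proof.
split.
- move=> i; exists 0; rewrite raddf0; split=> //.
  exact: grading0 (gm_grading M) _.
- move=> i _ _ [m [mi ->]] [n [ni ->]]; exists (m - n); rewrite raddfB.
  by split=> //; apply: (gradingB (gm_grading M)).
- move=> u; have [m <-] := gq_pi_surj u.
  have [s [us _ sE]] := pr_sum (gm_grading M) m.
  exists s, (fun i => gq_pi (gpr i m)); split=> //.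
    by move=> i; exists (gpr i m); split=> //; apply: gpr_homog.
  by rewrite {1}sE raddf_sum.
- move=> s u us /choice[m mP] u0 i is_; have [mi ->] := mP i.
  have {}u0 : gq_pi (\sum_(j <- s) m j) = gq_pi 0.
    by rewrite raddf_sum raddf0 -[RHS]u0; apply: eq_bigr => j _; case: (mP j).
  rewrite -(raddf0 gq_pi); apply/gq_piP; move/gq_piP: u0; rewrite !subr0.
  move=> /(gs_gpr i); rewrite raddf_sum (bigD1_seq i) //= big1 => [|j ji].
    by rewrite addr0 /gpr pr_id.
  by rewrite /gpr (pr_of_homog _ (proj1 (mP j))) eq_sym (negPf ji).
Qed.

Fact gq_gm_scale i j a (u : gq_type) :
  ga_comp i a -> gq_comp j u -> gq_comp (i + j) (a *: u).
Proof.
move=> ai [m [mj ->]]; exists (a *: m); rewrite linearZ.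
by split=> //; apply: gm_scale.
Qed.

Definition gq_grmod : grmod B := GrMod gq_grading gq_gm_scale.

Definition gq_proj : grhom M gq_grmod :=
  @GrHom k B M gq_grmod (gq_pi : {linear M -> gq_type})
    (fun i m mi => ex_intro _ m (conj mi erefl)).

Lemma gq_proj_surj : surjective gq_proj.
Proof. exact: gq_pi_surj. Qed.

Lemma gq_projP m : gq_proj m = 0 <-> K m.
Proof.
by rewrite -(raddf0 gq_proj); split=> [/gq_piP|?]; last apply/gq_piP;
  rewrite subr0.
Qed.

End SubQuotient.

Section KernelImage.
Variables (M N : grmod B) (f : grhom M N).

Definition gker : gsub M.
Proof.
refine (@GSub M (fun m => f m = 0) _ _ _ _).
- by rewrite raddf0.
- by move=> u v /= u0 v0; rewrite linearB /= u0 v0 subrr.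
- by move=> b u u0; rewrite linearZ /= u0 scaler0.
- by move=> i u /= u0; rewrite -gpr_hom u0 raddf0.
Defined.

Definition gim : gsub N.
Proof.
refine (@GSub N (fun n => exists m, f m = n) _ _ _ _).
- by exists 0; rewrite raddf0.
- by move=> _ _ [u <-] [v <-]; exists (u - v); rewrite raddfB.
- by move=> b _ [u <-]; exists (b *: u); rewrite linearZ.
- by move=> i _ [u <-]; exists (gpr i u); rewrite gpr_hom.
Defined.

Lemma iso_mod_canonical (T : grmod B -> Prop) :
  T (gs_grmod gker) -> T (gq_grmod gim) -> iso_mod T f.
Proof.
move=> Tk Tc; exists (gs_grmod gker), (gq_grmod gim), (gs_incl gker), (gq_proj gim).
split=> //.
- exact: gs_incl_inj.
- move=> m; split=> [m0|[u <-]]; last exact: (gs_incl_mem u).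
  exact: (@gs_incl_surj _ gker).
- by move=> n; apply: gq_projP.
- exact: gq_proj_surj.
Qed.

End KernelImage.

Definition gspan (M : grmod B) (q : nat) (v : 'I_q -> M) (D : 'I_q -> int)
  (vD : forall i, gm_comp (D i) (v i)) : gsub M.
Proof.
refine (@GSub M (fun m => exists b : 'I_q -> B, m = \sum_i b i *: v i) _ _ _ _).
- by exists (fun _ => 0); rewrite big1 // => i _; rewrite scale0r.
- move=> _ _ [b ->] [c ->]; exists (fun i => b i - c i).
  by rewrite -sumrB; apply: eq_bigr => i _; rewrite scalerBl.
- move=> a _ [b ->]; exists (fun i => a * b i).
  by rewrite scaler_sumr; apply: eq_bigr => i _; rewrite scalerA.
- move=> i _ [b ->].
  exists (fun l => pr (ga_grading B) (i - D l) (b l)).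
  rewrite raddf_sum; apply: eq_bigr => l _.
  have [s [us s0 sE]] := pr_sum (ga_grading B) (b l).
  rewrite {1}sE scaler_suml raddf_sum /=.
  have E j : gpr i (pr (ga_grading B) j (b l) *: v l) =
             if j == i - D l then pr (ga_grading B) (i - D l) (b l) *: v l else 0.
    rewrite (gpr_scale _ _ (pr_homog (ga_grading B) j (b l))).
    rewrite /gpr (pr_of_homog _ (vD l)).
    have -> : (i - j == D l) = (j == i - D l).
      by rewrite subr_eq [D l + j]addrC -subr_eq eq_sym.
    by case: eqP => [->|]; rewrite ?scaler0.
  under eq_bigr do rewrite E.
  have [is_|is_] := boolP (i - D l \in s); last first.
    rewrite s0 // scale0r big1_seq // => j /= js.
    by case: eqP => // ji; rewrite -ji js in is_.
  rewrite (bigD1_seq _ is_ us) /= eqxx big1 ?addr0 // => j /negPf ->.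
  by [].
Defined.

End GradedModuleTheory.

(** * The algebra B *)

Section FreeAlgebraWords.
Variables (k : fieldType) (I : choiceType).
Local Notation F := (freealg k I).

Definition mono (s : seq I) : F := << FMonom s >>.
Definition gen (i : I) : F := << fmu i >>.

Lemma mono_nil : mono [::] = 1.
Proof. by rewrite /mono -fmoneE. Qed.

Lemma mono_cat s t : mono (s ++ t) = mono s * mono t.
Proof. by rewrite /mono mul_malgU mulr1 /mmul /= fmmulE. Qed.

Lemma genE i : gen i = mono [:: i].
Proof. by rewrite /gen fmuE. Qed.

Lemma mono_cons i s : mono (i :: s) = gen i * mono s.
Proof. by rewrite genE -mono_cat. Qed.

Lemma mono_sum (a : F) : a = \sum_(w <- msupp a) a@_w *: mono w.
Proof.
rewrite {1}[a]monalgE; apply: eq_bigr => w _.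
by rewrite /mono fmK scale_malgU mulr1.
Qed.

Lemma freealg_ind (P : F -> Prop) :
  (forall a b, P a -> P b -> P (a + b)) -> (forall c a, P a -> P (c *: a)) ->
  P 1 -> (forall i a, P a -> P (gen i * a)) -> forall a, P a.
Proof.
move=> PD PZ P1 Pg a; rewrite [a]mono_sum.
apply: big_ind => // [|w _]; first by rewrite -(scale0r 1); apply: PZ.
apply: PZ; case: w => s /=; elim: s => [|i s IHs]; rewrite ?mono_nil //.
by rewrite mono_cons; apply: Pg.
Qed.

Lemma freealg_mono_ind (P : F -> Prop) :
  (forall a b, P a -> P b -> P (a + b)) -> (forall c a, P a -> P (c *: a)) ->
  (forall s, P (mono s)) -> forall a, P a.
Proof.
move=> PD PZ Pm a; rewrite [a]mono_sum.
apply: big_ind => // [|w _]; first by rewrite -(scale0r 1); apply: PZ; rewrite -mono_nil.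
by apply: PZ; case: w.
Qed.

(** The coefficient of v is that of i v in a: a leading letter i is deleted, and the words
    that do not start with i go to 0. *)
Definition lder (i : I) (a : F) : F :=
  [malg v in [fset FMonom (behead (w : seq I)) | w : {fmonom I} in msupp a]%fset =>
     a@_(mmul (fmu i) v)].

Lemma lderE i a v : (lder i a)@_v = a@_(mmul (fmu i) v).
Proof.
rewrite mcoeffE; case: ifPn => // /negP vN; apply/esym/mcoeff_outdom/negP => va.
apply: vN; apply/imfsetP; exists (mmul (fmu i) v) => //=.
by rewrite fmM fmU /= fmK.
Qed.

Fact lder_zmod_morphism i : zmod_morphism (lder i).
Proof. by move=> a b; apply/malgP => v; rewrite mcoeffB !lderE mcoeffB. Qed.

HB.instance Definition _ i :=
  GRing.isZmodMorphism.Build F F (lder i) (lder_zmod_morphism i).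

Lemma lderD i a b : lder i (a + b) = lder i a + lder i b.
Proof. exact: raddfD. Qed.

Lemma lderZ i c a : lder i (c *: a) = c *: lder i a.
Proof. by apply/malgP => v; rewrite mcoeffZ !lderE mcoeffZ. Qed.

Lemma lder_gen i j a : lder i (gen j * a) = if i == j then a else 0.
Proof.
rewrite [a]mono_sum mulr_sumr raddf_sum (fun_if (fun b => b)).
transitivity (\sum_(w <- msupp a) if i == j then a@_w *: mono w else 0); last first.
  by case: ifP => // _; rewrite big1.
apply: eq_bigr => w _ /=; rewrite -scalerAr lderZ.
case: eqP => [<-|ij]; last first.
  rewrite -mono_cons; apply/malgP => v; rewrite mcoeffZ lderE mcoeffU mcoeff0.
  case: eqP => [/(congr1 val) /=|_]; last by rewrite mulr0n mulr0.
  by rewrite fmM fmU /= => -[/esym].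
congr (_ *: _); rewrite -mono_cons; apply/malgP => v; rewrite lderE !mcoeffU.
congr (_ *+ nat_of_bool _); apply/eqP/eqP => [/(congr1 val)|<-] /=.
  by rewrite fmM fmU /= => -[e]; apply: val_inj.
by apply: val_inj; rewrite /= fmM fmU.
Qed.

Lemma lder_gen_id i a : lder i (gen i * a) = a.
Proof. by rewrite lder_gen eqxx. Qed.

Lemma lder_gen_ne i j a : i != j -> lder i (gen j * a) = 0.
Proof. by rewrite lder_gen => /negPf->. Qed.

End FreeAlgebraWords.

Section IdealClosure.
Variables (k : fieldType) (A : algType k) (J : ideal A).

Lemma ideal0 : 0 \in J. Proof. exact: rpred0. Qed.

Lemma idealD a b : a \in J -> b \in J -> a + b \in J.
Proof. exact: rpredD. Qed.

Lemma idealZ c a : a \in J -> c *: a \in J.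
Proof. by move=> aJ; rewrite -[a]mul1r scalerAl; apply: ideal_mull. Qed.

Lemma proj_eq0 a : proj J a = 0 <-> a \in J.
Proof. by have := projP J a 0; rewrite raddf0 subr0. Qed.

End IdealClosure.

Lemma gen_ideal_mem (k : fieldType) (A : algType k) (r a b : A) :
  a * (r * b) \in gen_ideal r.
Proof. by apply/gen_idealP; exists [:: (a, b)]; rewrite big_seq1 mulrA. Qed.

Lemma mulrA4 (A : pzRingType) (a b c d : A) : a * b * c * d = a * (b * (c * d)).
Proof. by rewrite !mulrA. Qed.

(** It is enough to know that words act letter by letter, because they span. *)
Section WordAction.
Variables (k : fieldType) (I : Type) (A : algType k) (V : lmodType k).
Variables (g : I -> A) (m : seq I -> A) (op : I -> V -> V) (act : A -> V -> V).
Hypothesis m_ind : forall P : A -> Prop,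
  (forall a b, P a -> P b -> P (a + b)) -> (forall c a, P a -> P (c *: a)) ->
  (forall s, P (m s)) -> forall a, P a.
Hypothesis m_nil : m [::] = 1.
Hypothesis m_cons : forall i s, m (i :: s) = g i * m s.
Hypothesis opP : forall i c u v, op i (c *: u + v) = c *: op i u + op i v.
Hypothesis actD : forall a b v, act (a + b) v = act a v + act b v.
Hypothesis actZ : forall c a v, act (c *: a) v = c *: act a v.
Hypothesis act_m : forall s v, act (m s) v = foldr op v s.

Lemma word_act_gen i a v : act (g i * a) v = op i (act a v).
Proof.
elim/m_ind: a => [a b IHa IHb|c a IHa|s].
- rewrite mulrDr !actD IHa IHb -[in RHS](scale1r (act a v)).
  by rewrite opP scale1r.
- rewrite -scalerAr !actZ IHa -[in RHS](addr0 (c *: _)) opP.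
  have := opP i (-1) 0 0.
  by rewrite scaler0 addr0 scaleN1r addNr => ->; rewrite addr0.
- by rewrite -m_cons !act_m.
Qed.

Lemma word_act1 v : act 1 v = v.
Proof. by rewrite -m_nil act_m. Qed.

Lemma word_actM a b v : act (a * b) v = act a (act b v).
Proof.
elim/m_ind: a => [a a' IHa IHb|c a IHa|s].
- by rewrite mulrDl !actD IHa IHb.
- by rewrite -scalerAl !actZ IHa.
- elim: s => [|i s IHs]; first by rewrite m_nil mul1r word_act1.
  by rewrite m_cons -mulrA !word_act_gen IHs.
Qed.

End WordAction.

Section AlgebraStructure.
Variable k : fieldType.
Local Notation F := (freealg k 'I_2).
Local Notation J := (y_sq_ideal k).
Local Notation B := (B k).
Local Notation i0 := (ord0 : 'I_2).
Local Notation i1 := (ord_max : 'I_2).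

Definition xB : B := proj J (gen k i0).
Definition yB : B := proj J (gen k i1).

Lemma ord2P (i : 'I_2) : i = i0 \/ i = i1.
Proof. by case: i => [[|[|//]]] h; [left|right]; apply: val_inj. Qed.

Lemma yByB : yB * yB = 0.
Proof.
rewrite /yB -rmorphM; apply/proj_eq0.
by apply/gen_idealP; exists [:: (1, 1)]; rewrite big_seq1 /= mul1r mulr1 expr2.
Qed.

Lemma yB_xB_deg : ga_comp 1 xB /\ ga_comp 1 yB.
Proof.
have h (i : 'I_2) : homogeneous 1 (gen k i).
  move=> w; rewrite /gen mcoeffU; have [<-|_] := eqVneq (fmu i) w; first by rewrite fdegU.
  by rewrite mulr0n eqxx.
by split; [exists (gen k i0)|exists (gen k i1)].
Qed.

Lemma xB_deg : ga_comp 1 xB. Proof. by case: yB_xB_deg. Qed.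
Lemma yB_deg : ga_comp 1 yB. Proof. by case: yB_xB_deg. Qed.

Lemma B_ind (P : B -> Prop) :
  (forall a b, P a -> P b -> P (a + b)) -> (forall (c : k) a, P a -> P (c *: a)) ->
  P 1 -> (forall a, P a -> P (xB * a)) -> (forall a, P a -> P (yB * a)) ->
  forall a, P a.
Proof.
move=> PD PZ P1 Px Py u; have [a <-] := proj_surj u.
elim/freealg_ind: a => [a b Pa Pb|c a Pa||i a Pa].
- by rewrite raddfD; apply: PD.
- by rewrite linearZ; apply: PZ.
- by rewrite rmorph1.
- by rewrite rmorphM; have [->|->] := ord2P i; [apply: Px|apply: Py].
Qed.

(** Deleting the leading letter of a y y b leaves the ideal only if a is empty, and then
    the letter is y and the result is y b. *)
Lemma lder_y_sq_ideal (i : 'I_2) a : a \in J ->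
  exists2 b, lder i a - gen k i1 * b \in J & i = i0 -> b = 0.
Proof.
move=> /gen_idealP[s ->]; elim: s => [|p s [b bJ b0]].
  by exists 0; rewrite ?big_nil ?raddf0 ?mulr0 ?subr0 ?ideal0.
rewrite big_cons lderD.
suff [c cJ c0] : exists2 c, lder i (p.1 * free_y k ^+ 2 * p.2) - gen k i1 * c \in J
                  & i = i0 -> c = 0.
  exists (c + b); last by move=> ii; rewrite c0 // b0 // addr0.
  by rewrite mulrDr opprD addrACA; exact: (idealD cJ bJ).
move: p.1 p.2 => a' d {p s b bJ b0 a}.
elim/freealg_ind: a' => [a b|c a||j a].
- move=> [c cJ c0] [e eJ e0]; exists (c + e); last first.
    by move=> ii; rewrite c0 // e0 // addr0.
  by rewrite !mulrDl lderD mulrDr opprD addrACA; exact: (idealD cJ eJ).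
- move=> [e eJ e0]; exists (c *: e); last by move=> ii; rewrite e0 // scaler0.
  by rewrite -!scalerAl lderZ -scalerAr -scalerBr; exact: (idealZ _ eJ).
- rewrite mul1r expr2 -mulrA -/(gen k i1) lder_gen.
  case: eqP => [->|_]; last by exists 0; rewrite ?mulr0 ?subr0 ?ideal0.
  by exists d => //; rewrite subrr ideal0.
- move=> _; exists 0 => //; rewrite mulr0 subr0 mulrA4 lder_gen.
  case: ifP => _; last exact: ideal0.
  exact: gen_ideal_mem.
Qed.

Lemma lder_x (a b : F) : lder i0 (gen k i0 * a + gen k i1 * b) = a.
Proof.
have a1 : lder i0 (gen k i0 * a) = a by exact: lder_gen_id.
have b0 : lder i0 (gen k i1 * b) = 0 by exact: lder_gen_ne.
transitivity (a + 0); last exact: addr0.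
transitivity (lder i0 (gen k i0 * a) + lder i0 (gen k i1 * b)); first exact: lderD.
exact: congr2 a1 b0.
Qed.

Lemma lder_y (a b : F) : lder i1 (gen k i0 * a + gen k i1 * b) = b.
Proof.
have a0 : lder i1 (gen k i0 * a) = 0 by exact: lder_gen_ne.
have b1 : lder i1 (gen k i1 * b) = b by exact: lder_gen_id.
transitivity (0 + b); last exact: add0r.
transitivity (lder i1 (gen k i0 * a) + lder i1 (gen k i1 * b)); first exact: lderD.
exact: congr2 a0 b1.
Qed.

(** Deleting the leading letter x or y from a representative of x b + y c returns b or c,
    which is thereby determined modulo the ideal, respectively modulo y. *)
Lemma B_xy_inj (b c : B) : xB * b + yB * c = 0 -> b = 0 /\ exists d, c = yB * d.
Proof.
have [a <-] := proj_surj b; have [a' <-] := proj_surj c.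
rewrite -!rmorphM -raddfD => /proj_eq0 aJ; split.
  have [e + /(_ erefl) e0] := lder_y_sq_ideal i0 aJ.
  rewrite e0 mulr0 subr0 lder_x => h.
  exact: (proj2 (proj_eq0 _ _) h).
have [e + _] := lder_y_sq_ideal i1 aJ.
rewrite lder_y => h.
by exists (proj J e); rewrite -rmorphM; exact: (proj2 (projP _ _ _) h).
Qed.

Section Action.
Variables (V : lmodType k) (X Y : {linear V -> V}).
Hypothesis YY : forall v, Y (Y v) = 0.

Definition letter_act (i : 'I_2) (v : V) : V := if i == i0 then X v else Y v.
Definition word_act (s : seq 'I_2) (v : V) : V := foldr letter_act v s.
Definition free_act (a : F) (v : V) : V := \sum_(w <- msupp a) a@_w *: word_act w v.

Lemma letter_actP i c u v :
  letter_act i (c *: u + v) = c *: letter_act i u + letter_act i v.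
Proof. by rewrite /letter_act; case: ifP; rewrite linearP. Qed.

Lemma word_actP s c u v : word_act s (c *: u + v) = c *: word_act s u + word_act s v.
Proof. by elim: s => //= i s ->; rewrite letter_actP. Qed.

Lemma free_actEw (a : F) (D : {fset {fmonom 'I_2}}) v : (msupp a `<=` D)%fset ->
  free_act a v = \sum_(w <- D) a@_w *: word_act w v.
Proof.
move=> aD; rewrite /free_act; apply: big_fset_incl => // w _ /mcoeff_outdom ->.
by rewrite scale0r.
Qed.

Lemma free_actD a b v : free_act (a + b) v = free_act a v + free_act b v.
Proof.
rewrite (free_actEw v (msuppD_le a b)).
rewrite (free_actEw v (fsubsetUl (msupp a) (msupp b))).
rewrite (free_actEw v (fsubsetUr (msupp a) (msupp b))) -big_split /=.
by apply: eq_bigr => w _; rewrite mcoeffD scalerDl.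
Qed.

Lemma free_actZ c a v : free_act (c *: a) v = c *: free_act a v.
Proof.
rewrite (free_actEw v (msuppZ_le c a)) scaler_sumr; apply: eq_bigr => w _.
by rewrite mcoeffZ scalerA.
Qed.

Lemma free_actP a c u v : free_act a (c *: u + v) = c *: free_act a u + free_act a v.
Proof.
rewrite /free_act scaler_sumr -big_split; apply: eq_bigr => w _ /=.
by rewrite word_actP scalerDr !scalerA mulrC.
Qed.

Lemma free_act_mono s v : free_act (mono k s) v = word_act s v.
Proof. by rewrite /free_act msuppU1 big_seq_fset1 mcoeffUU scale1r. Qed.

Let free_word_actM := word_actM (@freealg_mono_ind k _) (@mono_nil k _)
  (@mono_cons k _) letter_actP free_actD free_actZ free_act_mono.

Lemma free_actM a b v : free_act (a * b) v = free_act a (free_act b v).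
Proof. exact: free_word_actM. Qed.

Lemma free_act1 v : free_act 1 v = v.
Proof. exact: word_act1 (@mono_nil k _) free_act_mono v. Qed.

Lemma free_act_gen i v : free_act (gen k i) v = letter_act i v.
Proof. by rewrite genE free_act_mono. Qed.

Lemma free_act0 a : free_act a 0 = 0.
Proof. by have := free_actP a (-1) 0 0; rewrite scaler0 addr0 scaleN1r addNr. Qed.

Lemma free_act_relation a b v : free_act (a * (free_y k * free_y k) * b) v = 0.
Proof.
rewrite (free_actM (a * _) b) (free_actM a) (free_actM (free_y k)).
by rewrite !(free_act_gen i1) /letter_act /= YY free_act0.
Qed.

Lemma free_act_ideal a v : a \in J -> free_act a v = 0.
Proof.
move=> /gen_idealP[s ->].
elim: s => [|p s IHs]; first by rewrite big_nil -(scale0r 0) free_actZ scale0r.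
rewrite big_cons free_actD IHs addr0; exact: free_act_relation.
Qed.

Definition B_act (b : B) : V -> V := free_act (repr (b : alg_quot J)).

Lemma B_act_proj a v : B_act (proj J a) v = free_act a v.
Proof.
have h := free_act_ideal v (repr_proj J a).
have E : repr (proj J a) = (repr (proj J a) - a) + a by rewrite subrK.
by rewrite /B_act E free_actD h add0r.
Qed.

End Action.
End AlgebraStructure.

(** These properties of B suffice for everything that follows: generation by x and y, the
    relations between x B and y B, and the presentation by y y = 0, in the form that two
    operators X and Y with Y Y = 0 define an action. Stating them abstractly keeps the
    construction of B as a quotient of a free algebra from being unfolded. *)
Record fibAlg (k : fieldType) := FibAlg {
  fa_gr :> gralg k;
  fx : fa_gr;
  fy : fa_gr;
  fx_deg : ga_comp 1 fx;
  fy_deg : ga_comp 1 fy;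
  fyy : fy * fy = 0;
  fa_ind : forall P : fa_gr -> Prop,
    (forall a b, P a -> P b -> P (a + b)) ->
    (forall (c : k) a, P a -> P (c *: a)) ->
    P 1 -> (forall a, P a -> P (fx * a)) -> (forall a, P a -> P (fy * a)) ->
    forall a, P a;
  fxy_inj : forall b c : fa_gr, fx * b + fy * c = 0 ->
    b = 0 /\ exists d, c = fy * d;
  fa_act : forall (V : lmodType k) (X Y : {linear V -> V}),
    (forall v, Y (Y v) = 0) -> exists act : fa_gr -> V -> V,
    [/\ forall a b v, act (a + b) v = act a v + act b v,
        forall a c u v, act a (c *: u + v) = c *: act a u + act a v,
        forall c a v, act (c *: a) v = c *: act a v,
        forall a b v, act (a * b) v = act a (act b v)
      & forall v, [/\ act 1 v = v, act fx v = X v & act fy v = Y v]]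
}.

Lemma B_action_exists (k : fieldType) (V : lmodType k) (X Y : {linear V -> V}) :
  (forall v, Y (Y v) = 0) -> exists act : B k -> V -> V,
    [/\ forall a b v, act (a + b) v = act a v + act b v,
        forall a c u v, act a (c *: u + v) = c *: act a u + act a v,
        forall c a v, act (c *: a) v = c *: act a v,
        forall a b v, act (a * b) v = act a (act b v)
      & forall v, [/\ act 1 v = v, act (xB k) v = X v & act (yB k) v = Y v]].
Proof.
move=> YY; exists (@B_act k V X Y).
have P := @B_act_proj k V X Y YY; split.
- move=> a b v; have [a' <-] := proj_surj a; have [b' <-] := proj_surj b.
  rewrite -raddfD; exact: (etrans (P _ _) (etrans (free_actD _ _ _ _ _)
    (esym (congr2 +%R (P _ _) (P _ _))))).
- move=> a c u v; exact: free_actP.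
- move=> c a v; have [a' <-] := proj_surj a.
  rewrite -linearZ; exact: (etrans (P _ _) (etrans (free_actZ _ _ _ _ _)
    (esym (congr1 _ (P _ _))))).
- move=> a b v; have [a' <-] := proj_surj a; have [b' <-] := proj_surj b.
  rewrite -rmorphM; exact: (etrans (P _ _) (etrans (free_actM _ _ _ _ _)
    (esym (etrans (P _ _) (congr1 _ (P _ _)))))).
- move=> v; split.
  + rewrite -(rmorph1 (proj (y_sq_ideal k))).
    exact: (etrans (P _ _) (free_act1 _ _ _)).
  + exact: (etrans (P _ _) (free_act_gen _ _ ord0 v)).
  + exact: (etrans (P _ _) (free_act_gen _ _ ord_max v)).
Qed.

Definition B_fib (k : fieldType) : fibAlg k :=
  FibAlg (xB_deg k) (yB_deg k) (yByB k) (@B_ind k) (@B_xy_inj k)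
    (@B_action_exists k).

(** * Torsion *)

Section Torsion.
Variables (k : fieldType) (B : fibAlg k).
Implicit Types (M N : grmod B).

Local Notation x := (fx B).
Local Notation y := (fy B).

Lemma fa_decomp (b : B) : exists (c : k) b1 b2, b = c%:A + x * b1 + y * b2.
Proof.
elim/fa_ind: b.
- move=> a b [c [a1 [a2 ->]]] [d [b1 [b2 ->]]].
  exists (c + d), (a1 + b1), (a2 + b2).
  by rewrite scalerDl !mulrDr addrACA; congr (_ + _); rewrite addrACA.
- move=> c a [d [a1 [a2 ->]]]; exists (c * d), (c *: a1), (c *: a2).
  by rewrite !scalerDr scalerA !scalerAr.
- by exists 1, 0, 0; rewrite !mulr0 !addr0 scale1r.
- by move=> a _; exists 0, a, 0; rewrite mulr0 addr0 scale0r add0r.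
- by move=> a _; exists 0, 0, a; rewrite mulr0 addr0 scale0r add0r.
Qed.

Lemma scalar_comm (V : lmodType B) (c : k) (b : B) (v : V) :
  (c%:A : B) *: (b *: v) = b *: ((c%:A : B) *: v).
Proof. by rewrite !scalerA mulr_algl mulr_algr. Qed.

Lemma yyv (V : lmodType B) (v : V) : y *: (y *: v) = 0.
Proof. by rewrite scalerA fyy scale0r. Qed.

(** By generation, x, y and the scalars are enough. *)
Lemma stable_ind (V : lmodType B) (S : V -> Prop) :
  S 0 -> (forall u v, S u -> S v -> S (u + v)) ->
  (forall (c : k) u, S u -> S (c%:A *: u)) ->
  (forall u, S u -> S (x *: u)) -> (forall u, S u -> S (y *: u)) ->
  forall b u, S u -> S (b *: u).
Proof.
move=> S0 SD SZ Sx Sy b; elim/fa_ind: b => [a b IHa IHb|c a IHa||a IHa|a IHa] u Su.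
- by rewrite scalerDl; apply: SD; [apply: IHa|apply: IHb].
- by rewrite -[c *: a]mulr_algl -scalerA; apply/SZ/IHa.
- by rewrite scale1r.
- by rewrite -scalerA; apply/Sx/IHa.
- by rewrite -scalerA; apply/Sy/IHa.
Qed.

(** The same reduction for linearity and for the grading. *)
Lemma xy_scalable (V V' : lmodType B) (f : {additive V -> V'}) :
  (forall (c : k) u, f (c%:A *: u) = c%:A *: f u) ->
  (forall u, f (x *: u) = x *: f u) -> (forall u, f (y *: u) = y *: f u) ->
  scalable f.
Proof.
move=> fc fx fy b; elim/fa_ind: b => [a b IHa IHb|c a IHa||a IHa|a IHa] u.
- by rewrite !scalerDl raddfD IHa IHb.
- by rewrite -[c *: a]mulr_algl -!scalerA fc IHa.
- by rewrite !scale1r.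
- by rewrite -!scalerA fx IHa.
- by rewrite -!scalerA fy IHa.
Qed.

Lemma xy_graded (V : lmodType B) (V_ : int -> V -> Prop) :
  (forall i, V_ i 0) -> (forall i u v, V_ i u -> V_ i v -> V_ i (u + v)) ->
  (forall i (c : k) u, V_ i u -> V_ i (c%:A *: u)) ->
  (forall i u, V_ i u -> V_ (i + 1) (x *: u)) ->
  (forall i u, V_ i u -> V_ (i + 1) (y *: u)) ->
  forall i j a u, ga_comp i a -> V_ j u -> V_ (i + j) (a *: u).
Proof.
move=> V0 VD Vc Vx Vy i j a u ai uj.
suff h b : forall d, V_ (d + j) (pr (ga_grading B) d b *: u).
  by rewrite -(pr_id (ga_grading B) ai).
elim/fa_ind: b => [b c IHb IHc|c b IHb||b IHb|b IHb] d.
- by rewrite raddfD scalerDl; apply: VD.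
- by rewrite ga_pr_scale -[c *: _]mulr_algl -scalerA; apply: Vc.
- rewrite (pr_of_homog _ (ga_one B)); case: eqP => [->|_].
    by rewrite add0r scale1r.
  by rewrite scale0r.
- rewrite (ga_pr_mul _ _ (fx_deg B)) -scalerA; have := Vx _ _ (IHb (d - 1)).
  by rewrite addrAC subrK.
- rewrite (ga_pr_mul _ _ (fy_deg B)) -scalerA; have := Vy _ _ (IHb (d - 1)).
  by rewrite addrAC subrK.
Qed.

Lemma x_homog M i (m : M) : gm_comp i m -> gm_comp (i + 1) (x *: m).
Proof. by rewrite addrC; apply/gm_scale/fx_deg. Qed.

Lemma y_homog M i (m : M) : gm_comp i m -> gm_comp (i + 1) (y *: m).
Proof. by rewrite addrC; apply/gm_scale/fy_deg. Qed.

Lemma gpr_x M i (m : M) : gpr i (x *: m) = x *: gpr (i - 1) m.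
Proof. exact/gpr_scale/fx_deg. Qed.

Lemma gpr_y M i (m : M) : gpr i (y *: m) = y *: gpr (i - 1) m.
Proof. exact/gpr_scale/fy_deg. Qed.

(** All words of length n in x and y map m into Q. For Q = 0 and unspecified n this is
    torsion; for Q the image of a morphism it measures the cokernel. *)
Fixpoint killed (V : lmodType B) (Q : V -> Prop) (n : nat) (m : V) : Prop :=
  if n is n'.+1 then killed Q n' (x *: m) /\ killed Q n' (y *: m) else Q m.

Lemma killed_impl (V : lmodType B) (Q Q' : V -> Prop) n m :
  (forall v, Q v -> Q' v) -> killed Q n m -> killed Q' n m.
Proof.
move=> QQ'; elim: n m => [|n IHn] m /=; first exact: QQ'.
by move=> [/IHn ? /IHn].
Qed.

Lemma killed_map (V V' : lmodType B) (f : {linear V -> V'}) (Q : V' -> Prop) n m :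
  killed Q n (f m) <-> killed (fun v => Q (f v)) n m.
Proof. by elim: n m => [|n IHn] m //=; rewrite -!linearZ !IHn. Qed.

Lemma killedD (V : lmodType B) (Q : V -> Prop) n m :
  (forall u v, Q u -> Q v -> Q (u + v)) ->
  forall m', killed Q n m -> killed Q n m' -> killed Q n (m + m').
Proof.
move=> QD; elim: n m => [|n IHn] m m' /=; first exact: QD.
by rewrite !scalerDr => -[? ?] [? ?]; split; apply: IHn.
Qed.

Lemma killed_stable (V : lmodType B) (Q : V -> Prop) n m :
  (forall v, Q v -> Q (x *: v)) -> (forall v, Q v -> Q (y *: v)) ->
  Q m -> killed Q n m.
Proof.
by move=> Qx Qy; elim: n m => [|n IHn] m Qm //=; split; apply: IHn; auto.
Qed.

Lemma killed_le (V : lmodType B) (Q : V -> Prop) n n' m :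
  (forall v, Q v -> Q (x *: v)) -> (forall v, Q v -> Q (y *: v)) ->
  (n <= n')%N -> killed Q n m -> killed Q n' m.
Proof.
move=> Qx Qy; elim: n n' m => [|n IHn] [|n'] m //= nn'.
- by move=> Qm; split; apply: killed_stable; auto.
- by move=> [? ?]; split; apply: IHn.
Qed.

Definition torsion (V : lmodType B) (m : V) : Prop :=
  exists n, killed (fun v => v = 0) n m.

Lemma killed0_le (V : lmodType B) n n' (m : V) : (n <= n')%N ->
  killed (fun v => v = 0) n m -> killed (fun v => v = 0) n' m.
Proof. by apply: killed_le => v ->; rewrite scaler0. Qed.

Lemma torsion0 (V : lmodType B) : torsion (0 : V).
Proof. by exists 0%N. Qed.

Lemma torsionD (V : lmodType B) (u v : V) : torsion u -> torsion v -> torsion (u + v).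
Proof.
move=> [n un] [n' vn']; exists (maxn n n'); apply: killedD.
- by move=> ? ? -> ->; rewrite addr0.
- exact: killed0_le (leq_maxl _ _) un.
- exact: killed0_le (leq_maxr _ _) vn'.
Qed.

Lemma torsion_sum (V : lmodType B) I (r : seq I) (P : pred I) (u : I -> V) :
  (forall i, P i -> torsion (u i)) -> torsion (\sum_(i <- r | P i) u i).
Proof. by move=> h; apply: big_ind => //; [apply: torsion0|apply: torsionD]. Qed.

Lemma torsion_hom (V V' : lmodType B) (f : {linear V -> V'}) u :
  torsion u -> torsion (f u).
Proof.
move=> [n un]; exists n; apply/killed_map; apply: killed_impl un => v ->.
exact: raddf0.
Qed.

(** There are only two words of length 1, so the exponents have a maximum. *)
Lemma killed_torsion (V : lmodType B) n (m : V) : killed (@torsion V) n m -> torsion m.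
Proof.
elim: n m => [//|n IHn] m /= [/IHn[a am] /IHn[b bm]]; exists (maxn a b).+1.
split; [exact: killed0_le (leq_maxl _ _) am|exact: killed0_le (leq_maxr _ _) bm].
Qed.

(** ** Linear spans over the ground field *)

(** By recursion on the list, so that no family of coefficients has to be carried along. *)
Fixpoint kspan (V : lmodType B) (L : seq V) (u : V) : Prop :=
  if L is v :: L' then exists c : k, kspan L' (u - c%:A *: v) else u = 0.

Lemma kspan0 (V : lmodType B) (L : seq V) : kspan L 0.
Proof. by elim: L => //= v L IHL; exists 0; rewrite !scale0r subr0. Qed.

Lemma kspanP (V : lmodType B) (L : seq V) (c : k) u v :
  kspan L u -> kspan L v -> kspan L (c%:A *: u + v).
Proof.
elim: L u v => [|w L IHL] u v /=; first by move=> -> ->; rewrite scaler0 addr0.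
move=> [a ua] [b vb]; exists (c * a + b).
suff -> : c%:A *: u + v - (c * a + b)%:A *: w
  = (c%:A : B) *: (u - (a%:A : B) *: w) + (v - (b%:A : B) *: w) by apply: IHL.
rewrite scalerBr scalerA mulr_algl scalerA !scalerDl opprD.
by rewrite addrACA.
Qed.

Lemma kspanD (V : lmodType B) (L : seq V) u v :
  kspan L u -> kspan L v -> kspan L (u + v).
Proof. by move=> uL vL; have := kspanP 1 uL vL; rewrite !scale1r. Qed.

Lemma kspanZ (V : lmodType B) (L : seq V) (c : k) u : kspan L u -> kspan L (c%:A *: u).
Proof. by move=> uL; have := kspanP c uL (kspan0 L); rewrite addr0. Qed.

Lemma kspanB (V : lmodType B) (L : seq V) u v :
  kspan L u -> kspan L v -> kspan L (u - v).
Proof. by move=> uL /(kspanZ (-1)); rewrite scaleN1r scaleNr scale1r; apply: kspanD. Qed.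

Lemma kspan_head (V : lmodType B) (L : seq V) v : kspan (v :: L) v.
Proof. by exists 1; rewrite !scale1r subrr; apply: kspan0. Qed.

Lemma kspan_behead (V : lmodType B) (L : seq V) v u : kspan L u -> kspan (v :: L) u.
Proof. by exists 0; rewrite !scale0r subr0. Qed.

Lemma kspan_mem (V : lmodType B) (L : seq V) v : v \in L -> kspan L v.
Proof.
elim: L => //= w L IHL; rewrite inE => /orP[/eqP->|/IHL]; first exact: kspan_head.
exact: kspan_behead.
Qed.

Lemma kspan_ind (V : lmodType B) (L : seq V) (S : V -> Prop) :
  S 0 -> (forall u v, S u -> S v -> S (u + v)) ->
  (forall (c : k) u, S u -> S (c%:A *: u)) ->
  {in L, forall v, S v} -> forall u, kspan L u -> S u.
Proof.
move=> S0 SD SZ; elim: L => [|w L IHL] LS u /=; first by move=> ->.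
move=> [c uc]; rewrite -[u](subrK ((c%:A : B) *: w)); apply: SD; last first.
  by apply/SZ/LS; rewrite mem_head.
by apply: IHL uc => v vL; apply: LS; rewrite inE vL orbT.
Qed.

Lemma kspan_sub (V : lmodType B) (L L' : seq V) u :
  {in L, forall v, kspan L' v} -> kspan L u -> kspan L' u.
Proof.
move=> LL'; apply: kspan_ind LL' u => //.
- exact: kspan0.
- exact: kspanD.
- exact: kspanZ.
Qed.

Lemma kspan_catl (V : lmodType B) (L L' : seq V) u : kspan L u -> kspan (L ++ L') u.
Proof.
by apply: kspan_sub => v vL; apply: kspan_mem; rewrite mem_cat vL.
Qed.

Lemma kspan_catr (V : lmodType B) (L L' : seq V) u : kspan L' u -> kspan (L ++ L') u.
Proof.
by apply: kspan_sub => v vL; apply: kspan_mem; rewrite mem_cat vL orbT.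
Qed.

Lemma kspan_map (V V' : lmodType B) (f : {linear V -> V'}) (L : seq V) u :
  injective f -> kspan (map f L) (f u) -> kspan L u.
Proof.
move=> fI; elim: L u => [|w L IHL] u /=; first by rewrite -(raddf0 f) => /fI.
by move=> [c]; rewrite -linearZ -linearB => /IHL; exists c.
Qed.

Lemma kspan_coef (V : lmodType B) (L : seq V) u : kspan L u ->
  exists c : 'I_(size L) -> k, u = \sum_i (c i)%:A *: tnth (in_tuple L) i.
Proof.
elim: L u => [|w L IHL] u /=.
  by move=> ->; exists (fun _ => 0); rewrite big_ord0.
move=> [c /IHL[d ud]].
exists (fun i => if unlift ord0 i is Some j then d j else c).
rewrite big_ord_recl unlift_none -[LHS](subrK ((c%:A : B) *: w)) addrC ud.
congr (_ *: _ + _); apply: eq_bigr => i _; rewrite liftK.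
by rewrite !(tnth_nth 0).
Qed.

Lemma finite_dimensional_kspan M (L : seq M) :
  (forall m, kspan L m) -> finite_dimensional M.
Proof.
by move=> h; exists (size L), (tnth (in_tuple L)) => m; apply: kspan_coef.
Qed.

Lemma gs_finite_dimensional M (K : gsub M) (L : seq M) :
  {in L, forall m, K m} -> (forall m, K m -> kspan L m) ->
  finite_dimensional (gs_grmod K).
Proof.
move=> LK KL; have [L' LL'] : exists L' : seq (gs_grmod K), map (gs_incl K) L' = L.
  elim: L LK {KL} => [|m L IHL] LK; first by exists [::].
  have [|L' <-] := IHL; first by move=> u uL; apply: LK; rewrite inE uL orbT.
  have [u <-] := gs_incl_surj (LK m (mem_head _ _)).
  by exists (u :: L').
apply: (finite_dimensional_kspan (L := L')) => u.
apply: (@kspan_map _ _ (gs_incl K)); first exact: gs_incl_inj.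
by rewrite LL'; apply/KL/gs_incl_mem.
Qed.

Lemma finite_dimensional_bound M : finite_dimensional M ->
  exists D : nat, forall i (m : M), (D%:Z < i)%R -> gpr i m = 0.
Proof.
move=> [n [v vP]].
have /choice[D DP] l : exists D : nat, forall i : int, gpr i (v l) != 0 ->
  (- D%:Z <= i <= D%:Z)%R by apply: pr_bound.
exists (\max_l D l)%N => i m Di; have [c ->] := vP m.
rewrite raddf_sum big1 //= => l _; rewrite gpr_scalar.
have [->|/DP] := eqVneq (gpr i (v l)) 0; first by rewrite scaler0.
have := leq_bigmax (F := D) l; lia.
Qed.

(** Each letter raises the lowest degree, while the degrees stay bounded above by D. *)
Lemma killed_bounded M (D L : int) n (m : M) :
  (forall i (m : M), (D < i)%R -> gpr i m = 0) ->
  (forall i, (i < L)%R -> gpr i m = 0) -> (D < L + n%:Z)%R ->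
  killed (fun v => v = 0) n m.
Proof.
move=> MD; elim: n L m => [|n IHn] L m mL DL /=.
  apply: gpr_eq0 => i.
  by have [/mL//|Li] := boolP (i < L)%R; apply: MD; lia.
split; apply: (IHn (L + 1)); try lia.
  by move=> i iL; rewrite gpr_x mL ?scaler0 //; lia.
by move=> i iL; rewrite gpr_y mL ?scaler0 //; lia.
Qed.

(** A finite dimensional module lives in finitely many degrees. *)
Lemma Fdim_torsion M : Fdim M -> forall m : M, torsion m.
Proof.
move=> Mfd m; have [N [f [/finite_dimensional_bound[D DP] _ [u <-]]]] := Mfd m.
apply: torsion_hom; have [D' D'P] := pr_bound (gm_grading N) u.
exists (D + D').+1; apply: (killed_bounded (D := D%:Z) (L := - D'%:Z)) => //; last by lia.
move=> i iD'; apply/eqP/negPn/negP => /D'P; lia.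
Qed.

(** The words of length less than n, applied to m; if the words of length n kill m they
    span the submodule generated by m. *)
Fixpoint orbit_words (V : lmodType B) (n : nat) (m : V) : seq V :=
  if n is n'.+1 then m :: orbit_words n' (x *: m) ++ orbit_words n' (y *: m)
  else [::].

Lemma orbit_words_homog M n i (m : M) : gm_comp i m ->
  {in orbit_words n m, forall v, exists j, gm_comp j v}.
Proof.
elim: n i m => //= n IHn i m mi v; rewrite inE => /orP[/eqP->|]; first by exists i.
by rewrite mem_cat => /orP[]; apply: IHn; [apply: x_homog mi|apply: y_homog mi].
Qed.

Lemma orbit_words_head (V : lmodType B) n (m : V) : killed (fun v => v = 0) n m ->
  kspan (orbit_words n m) m.
Proof. by case: n => [|n] /= h; [rewrite h|apply: (@kspan_head _ _ m)]. Qed.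

Lemma orbit_words_stable (V : lmodType B) n (m : V) : killed (fun v => v = 0) n m ->
  {in orbit_words n m, forall v, kspan (orbit_words n m) (x *: v) /\
     kspan (orbit_words n m) (y *: v)}.
Proof.
elim: n m => //= n IHn m [mx my] v; rewrite inE => /orP[/eqP->|].
  split; apply: (@kspan_behead _ _ m); [apply: kspan_catl|apply: kspan_catr];
    exact: orbit_words_head.
rewrite mem_cat => /orP[] vL.
- have [h1 h2] := IHn _ mx v vL.
  by split; apply: (@kspan_behead _ _ m); apply: kspan_catl.
- have [h1 h2] := IHn _ my v vL.
  by split; apply: (@kspan_behead _ _ m); apply: kspan_catr.
Qed.

Definition kspan_gsub M (L : seq M)
  (Lh : {in L, forall v, exists j, gm_comp j v})
  (Ls : {in L, forall v, kspan L (x *: v) /\ kspan L (y *: v)}) : gsub M.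
Proof.
refine (@GSub _ _ M (kspan L) (kspan0 L) (@kspanB _ L) _ _).
- apply: stable_ind; [exact: kspan0|exact: kspanD|exact: kspanZ| |].
  + apply: kspan_ind => [|u v|c u|v /Ls[]//].
    * by rewrite scaler0; apply: kspan0.
    * by rewrite scalerDr; apply: kspanD.
    * by rewrite -scalar_comm; apply: kspanZ.
  + apply: kspan_ind => [|u v|c u|v /Ls[]//].
    * by rewrite scaler0; apply: kspan0.
    * by rewrite scalerDr; apply: kspanD.
    * by rewrite -scalar_comm; apply: kspanZ.
- move=> i; apply: kspan_ind => [|u v|c u|v vL].
  + by rewrite raddf0; apply: kspan0.
  + by rewrite raddfD; apply: kspanD.
  + by rewrite gpr_scalar; apply: kspanZ.
  + have [j vj] := Lh v vL; rewrite /gpr (pr_of_homog _ vj).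
    by case: ifP => _; [apply: kspan_mem|apply: kspan0].
Defined.

Lemma torsion_span M (L : seq M) : {in L, forall v, exists j, gm_comp j v} ->
  {in L, forall v, torsion v} -> exists L' : seq M,
  [/\ {in L, forall v, kspan L' v}, {in L', forall v, exists j, gm_comp j v}
    & {in L', forall v, kspan L' (x *: v) /\ kspan L' (y *: v)}].
Proof.
elim: L => [|m L IHL] Lh Lt; first by exists [::].
have [||L' [LL' L'h L's]] := IHL.
- by move=> v vL; apply: Lh; rewrite inE vL orbT.
- by move=> v vL; apply: Lt; rewrite inE vL orbT.
have [j mj] := Lh m (mem_head _ _); have [n mn] := Lt m (mem_head _ _).
exists (orbit_words n m ++ L'); split=> v.
- rewrite inE => /orP[/eqP->|/LL'].
    exact/kspan_catl/orbit_words_head.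
  exact: kspan_catr.
- by rewrite mem_cat => /orP[/(orbit_words_homog mj)|/L'h].
- rewrite mem_cat => /orP[/(orbit_words_stable mn)|/L's] [h1 h2].
    by split; apply: kspan_catl.
  by split; apply: kspan_catr.
Qed.

(** An element lies in the submodule generated by its components, which is spanned by
    finitely many words as each component is torsion. *)
Lemma torsion_Fdim M : (forall m : M, torsion m) -> Fdim M.
Proof.
move=> Mt m; have [s [_ _ mE]] := pr_sum (gm_grading M) m.
have [||L [Lm Lh Ls]] := @torsion_span M [seq gpr i m | i <- s].
- by move=> v /mapP[i _ ->]; exists i; apply: gpr_homog.
- by move=> v _; apply: Mt.
pose K := kspan_gsub Lh Ls.
exists (gs_grmod K), (gs_incl K); split; last apply: gs_incl_surj.
- by apply: (@gs_finite_dimensional _ K L) => // v vL; apply: kspan_mem.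
- exact: gs_incl_inj.
- rewrite /K /= mE big_seq; apply: big_ind => [||i is_]; first exact: kspan0.
    exact: kspanD.
  by apply: Lm; apply: (map_f (fun i => gpr i m)).
Qed.

(** ** Morphisms that become invertible in the quotient category *)

Lemma gker_torsion M N (f : grhom M N) :
  (forall m, f m = 0 -> torsion m) -> Fdim (gs_grmod (gker f)).
Proof.
move=> ft; apply: torsion_Fdim => u.
have [n un] := ft _ (gs_incl_mem u); exists n.
apply: (killed_impl (Q := fun v => gs_incl (gker f) v = 0)).
  by move=> v v0; apply: (@gs_incl_inj _ _ _ (gker f)); rewrite v0 raddf0.
exact: (proj1 (killed_map (gs_incl (gker f)) _ _ _) un).
Qed.

Lemma gim_torsion M N (f : grhom M N) :
  (forall n : N, exists a, killed (gim f) a n) -> Fdim (gq_grmod (gim f)).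
Proof.
move=> ft; apply: torsion_Fdim => u; have [n <-] := gq_proj_surj u.
have [a na] := ft n; exists a; apply/killed_map.
by apply: killed_impl na => v /gq_projP.
Qed.

Lemma iso_mod_FdimI M N (f : grhom M N) :
  (forall m, f m = 0 -> torsion m) ->
  (forall n : N, exists a, killed (gim f) a n) -> iso_mod (@Fdim k B) f.
Proof.
by move=> ft gt; apply: iso_mod_canonical; [apply: gker_torsion|apply: gim_torsion].
Qed.

Lemma iso_mod_Fdim_ker M N (f : grhom M N) : iso_mod (@Fdim k B) f ->
  forall m, f m = 0 -> torsion m.
Proof.
move=> [K [L [i [p [[Kt Lt] iI exi exp ps]]]]] m /exi[u <-].
exact/torsion_hom/Fdim_torsion.
Qed.

Lemma iso_mod_Fdim_coker M N (f : grhom M N) : iso_mod (@Fdim k B) f ->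
  forall n : N, exists a, killed (gim f) a n.
Proof.
move=> [K [L [i [p [[Kt Lt] iI exi exp ps]]]]] n.
have [a na] := Fdim_torsion Lt (p n); exists a.
by move/killed_map: na; apply: killed_impl => v /exp.
Qed.

End Torsion.

(** * Row vectors over a module and the maps of the direct system *)

Section RowAction.
Variables (k : fieldType) (B : algType k).
Implicit Types (V : lmodType B).

Definition rmul V m n (v : 'rV[V]_m) (A : 'M[k]_(m, n)) : 'rV[V]_n :=
  \row_j \sum_i ((A i j)%:A : B) *: v 0 i.

Lemma rmulDl V m n (u v : 'rV[V]_m) (A : 'M[k]_(m, n)) :
  rmul (u + v) A = rmul u A + rmul v A.
Proof.
apply/rowP => j; rewrite !mxE -big_split; apply: eq_bigr => i _ /=.
by rewrite mxE scalerDr.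
Qed.

Lemma rmul0l V m n (A : 'M[k]_(m, n)) : rmul (0 : 'rV[V]_m) A = 0.
Proof. by apply/rowP => j; rewrite !mxE big1 // => i _; rewrite mxE scaler0. Qed.

Lemma rmulDr V m n (v : 'rV[V]_m) (A A' : 'M[k]_(m, n)) :
  rmul v (A + A') = rmul v A + rmul v A'.
Proof.
apply/rowP => j; rewrite !mxE -big_split; apply: eq_bigr => i _ /=.
by rewrite mxE !scalerDl.
Qed.

Lemma rmulA V m n p (v : 'rV[V]_m) (A : 'M[k]_(m, n)) (A' : 'M[k]_(n, p)) :
  rmul (rmul v A) A' = rmul v (A *m A').
Proof.
apply/rowP => j; rewrite !mxE.
under eq_bigr => i _ do rewrite mxE scaler_sumr.
rewrite exchange_big; apply: eq_bigr => i _ /=; rewrite mxE.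
rewrite !scaler_suml; apply: eq_bigr => l _.
by rewrite scalerA mulr_algl scalerA mulrC.
Qed.

Lemma rmul1 V m (v : 'rV[V]_m) : rmul v 1%:M = v.
Proof.
apply/rowP => j; rewrite mxE (bigD1 j) //= mxE eqxx !scale1r big1 ?addr0 // => i.
by rewrite mxE => /negPf->; rewrite !scale0r.
Qed.

Lemma rmul_block V m1 m2 n1 n2 (v : 'rV[V]_m1) (w : 'rV[V]_m2)
    (A : 'M[k]_(m1, n1)) (A' : 'M[k]_(m2, n2)) :
  rmul (row_mx v w) (block_mx A 0 0 A') = row_mx (rmul v A) (rmul w A').
Proof.
apply/rowP => j; rewrite !mxE big_split_ord /=.
case: (split_ordP j) => j' ->.
  rewrite [X in _ + X]big1 => [|i _].
    by rewrite addr0 mxE; apply: eq_bigr => i _; rewrite block_mxEul row_mxEl.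
  by rewrite block_mxEdl mxE !scale0r.
rewrite [X in X + _]big1 => [|i _].
  by rewrite add0r mxE; apply: eq_bigr => i _; rewrite block_mxEdr row_mxEr.
by rewrite block_mxEur mxE !scale0r.
Qed.

Lemma rmul_map V V' (f : {additive V -> V'}) m n (v : 'rV[V]_m) (A : 'M[k]_(m, n)) :
  (forall (c : k) u, f (c%:A *: u) = c%:A *: f u) ->
  rmul (map_mx f v) A = map_mx f (rmul v A).
Proof.
move=> fZ; apply/rowP => j; rewrite !mxE raddf_sum; apply: eq_bigr => i _ /=.
by rewrite mxE fZ.
Qed.

Lemma rmul_delta V m n (v : 'rV[V]_m) (i : 'I_m) (j : 'I_n) :
  rmul v (delta_mx i j) = \row_j' (v 0 i *+ (j' == j)).
Proof.
apply/rowP => j'; rewrite !mxE (bigD1 i) //= mxE eqxx big1 ?addr0 => [|i' ii].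
  by case: (j' == j); rewrite ?scale1r // !scale0r.
by rewrite mxE (negPf ii) !scale0r.
Qed.

End RowAction.

Section Levels.
Variables (k : fieldType) (B : fibAlg k).
Local Notation x := (fx B).
Local Notation y := (fy B).

(** Since S_n has index n + 1 in the usual numbering, level n has f_(n+1) entries and f_n
    entries. *)
Definition Xn (V : lmodType B) (n : nat) : Type :=
  ('rV[V]_(fib n.+1) * 'rV[V]_(fib n))%type.
HB.instance Definition _ (V : lmodType B) n := GRing.Zmodule.on (Xn V n).
Implicit Types V : lmodType B.

Definition xmul (V : lmodType B) (v : V) : V := x *: v.
Definition xymul (V : lmodType B) (v : V) : V := x *: (y *: v).

Fact xmul_zmod_morphism (V : lmodType B) : zmod_morphism (@xmul V).
Proof. by move=> u v; rewrite /xmul scalerBr. Qed.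
Fact xymul_zmod_morphism (V : lmodType B) : zmod_morphism (@xymul V).
Proof. by move=> u v; rewrite /xymul !scalerBr. Qed.
HB.instance Definition _ (V : lmodType B) :=
  GRing.isZmodMorphism.Build V V (@xmul V) (@xmul_zmod_morphism V).
HB.instance Definition _ (V : lmodType B) :=
  GRing.isZmodMorphism.Build V V (@xymul V) (@xymul_zmod_morphism V).

(** The isomorphism of O with O(-1) + O(-2) in the quotient category, seen on rows: an
    entry m of the first block is traded for x m and x y m, in the same order in which phi
    arranges the two blocks of S_n in S_(n+1). *)
Definition tstep (V : lmodType B) n (v : Xn V n) : Xn V n.+1 :=
  (row_mx (map_mx (@xmul V) v.1) v.2, map_mx (@xymul V) v.1).

Fact tstep_zmod_morphism V n : zmod_morphism (@tstep V n).
Proof.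
move=> u v; congr pair => /=; last exact: map_mxB.
by rewrite map_mxB opp_row_mx add_row_mx.
Qed.

HB.instance Definition _ (V : lmodType B) n :=
  GRing.isZmodMorphism.Build (Xn V n) (Xn V n.+1) (@tstep V n)
    (@tstep_zmod_morphism V n).

Lemma tstepD (V : lmodType B) n (u v : Xn V n) : tstep (u + v) = tstep u + tstep v.
Proof. exact: raddfD. Qed.
Lemma tstepB (V : lmodType B) n (u v : Xn V n) : tstep (u - v) = tstep u - tstep v.
Proof. exact: raddfB. Qed.
Lemma tstepN (V : lmodType B) n (v : Xn V n) : tstep (- v) = - tstep v.
Proof. exact: raddfN. Qed.
Lemma tstep0 (V : lmodType B) n : tstep (0 : Xn V n) = 0.
Proof. exact: raddf0. Qed.

Definition Xact (V : lmodType B) n (v : Xn V n) (a : Sn k n) : Xn V n :=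
  (rmul v.1 a.1, rmul v.2 a.2).

Lemma XactDl V n (u v : Xn V n) a : Xact (u + v) a = Xact u a + Xact v a.
Proof. by congr pair; rewrite /= rmulDl. Qed.

Lemma XactDr V n (v : Xn V n) a b : Xact v (a + b) = Xact v a + Xact v b.
Proof. by congr pair; rewrite /= rmulDr. Qed.

Lemma XactA V n (v : Xn V n) a b : Xact (Xact v a) b = Xact v (a * b).
Proof. by congr pair; rewrite /= rmulA. Qed.

Lemma Xact1 V n (v : Xn V n) : Xact v 1 = v.
Proof. by rewrite /Xact /= !rmul1; case: v. Qed.

Lemma tstep_act V n (v : Xn V n) (a : Sn k n) :
  tstep (Xact v a) = Xact (tstep v) (phi a).
Proof.
congr pair => /=.
  rewrite (rmul_block (map_mx (@xmul V) v.1) v.2 a.1 a.2) rmul_map // => c u.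
  by rewrite /xmul scalar_comm.
by rewrite rmul_map // => c u; rewrite /xymul !scalar_comm.
Qed.

Definition Xmap (V V' : lmodType B) (f : V -> V') n (v : Xn V n) : Xn V' n :=
  (map_mx f v.1, map_mx f v.2).

Fact Xmap_zmod_morphism (V V' : lmodType B) (f : {additive V -> V'}) n :
  zmod_morphism (@Xmap V V' f n).
Proof. by move=> u v; congr pair => /=; apply: map_mxB. Qed.

HB.instance Definition _ (V V' : lmodType B) (f : {additive V -> V'}) n :=
  GRing.isZmodMorphism.Build (Xn V n) (Xn V' n) (@Xmap V V' f n)
    (@Xmap_zmod_morphism V V' f n).

Lemma Xmap_tstep V V' (f : {linear V -> V'}) n (v : Xn V n) :
  Xmap f (tstep v) = tstep (Xmap f v).
Proof.
congr pair => /=.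
  rewrite map_row_mx -!map_mx_comp; congr row_mx; apply: eq_map_mx => u /=.
  by rewrite /xmul linearZ.
by rewrite -!map_mx_comp; apply: eq_map_mx => u /=; rewrite /xymul !linearZ.
Qed.

Lemma Xmap_act V V' (f : {additive V -> V'}) n (v : Xn V n) a :
  (forall (c : k) u, f (c%:A *: u) = c%:A *: f u) ->
  Xmap f (Xact v a) = Xact (Xmap f v) a.
Proof. by move=> fZ; congr pair => /=; rewrite rmul_map. Qed.

Section Homogeneous.
Variable M : grmod B.

(** Projection to the homogeneous elements at level n: the first coordinates
    have degree n+1 and the second ones degree n+2. *)
Definition Xpr n (v : Xn M n) : Xn M n :=
  (map_mx (gpr n.+1%:Z) v.1, map_mx (gpr n.+2%:Z) v.2).

Fact Xpr_zmod_morphism n : zmod_morphism (@Xpr n).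
Proof. by move=> u v; congr pair => /=; apply: map_mxB. Qed.

HB.instance Definition _ n :=
  GRing.isZmodMorphism.Build (Xn M n) (Xn M n) (@Xpr n) (@Xpr_zmod_morphism n).

Lemma XprD n (u v : Xn M n) : Xpr (u + v) = Xpr u + Xpr v.
Proof. exact: raddfD. Qed.
Lemma XprB n (u v : Xn M n) : Xpr (u - v) = Xpr u - Xpr v.
Proof. exact: raddfB. Qed.
Lemma XprN n (v : Xn M n) : Xpr (- v) = - Xpr v.
Proof. exact: raddfN. Qed.
Lemma Xpr0 n : Xpr (0 : Xn M n) = 0.
Proof. exact: raddf0. Qed.

Lemma gpr_gpr i (m : M) : gpr i (gpr i m) = gpr i m.
Proof. exact/pr_id/gpr_homog. Qed.

Lemma XprK n (v : Xn M n) : Xpr (Xpr v) = Xpr v.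
Proof.
by congr pair; rewrite /= -map_mx_comp; apply: eq_map_mx => m /=; rewrite gpr_gpr.
Qed.

Lemma Xpr_tstep n (v : Xn M n) : Xpr (tstep v) = tstep (Xpr v).
Proof.
congr pair => /=.
  rewrite map_row_mx -!map_mx_comp; congr row_mx; apply: eq_map_mx => u /=.
  by rewrite /xmul gpr_x; congr (_ *: gpr _ _); lia.
rewrite -!map_mx_comp; apply: eq_map_mx => u /=.
by rewrite /xymul gpr_x gpr_y; congr (_ *: (_ *: gpr _ _)); lia.
Qed.

Lemma Xpr_act n (v : Xn M n) a : Xpr (Xact v a) = Xact (Xpr v) a.
Proof. by congr pair => /=; rewrite rmul_map // => c u; apply: gpr_scalar. Qed.

Lemma Xpr_homog1 n (v : Xn M n) i : Xpr v = v -> gm_comp n.+1%:Z (v.1 0 i).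
Proof. by move=> <-; rewrite mxE; apply: gpr_homog. Qed.

Lemma Xpr_homog2 n (v : Xn M n) i : Xpr v = v -> gm_comp n.+2%:Z (v.2 0 i).
Proof. by move=> <-; rewrite mxE; apply: gpr_homog. Qed.

End Homogeneous.

Lemma Xpr_map (M N : grmod B) (f : grhom M N) n (v : Xn M n) :
  Xpr (Xmap f v) = Xmap f (Xpr v).
Proof.
by congr pair; rewrite /= -!map_mx_comp; apply: eq_map_mx => u /=; rewrite gpr_hom.
Qed.

Section Killed.
Variables (V : lmodType B) (Q : V -> Prop).
Hypothesis Qx : forall v, Q v -> Q (x *: v).
Hypothesis Qy : forall v, Q v -> Q (y *: v).
Hypothesis Q0 : Q 0.

Definition Xmem n (v : Xn V n) : Prop := (forall i, Q (v.1 0 i)) /\ (forall j, Q (v.2 0 j)).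

(** The entries of the second block wait one step before they are multiplied by x, hence
    the shift of the exponent. *)
Definition Xkilled (e : nat) n (v : Xn V n) : Prop :=
  (forall i, killed Q e.+1 (v.1 0 i)) /\ (forall j, killed Q e (v.2 0 j)).

Lemma Xkilled_tstep e n (v : Xn V n) : Xkilled e.+1 v -> Xkilled e (tstep v).
Proof.
move=> [v1 v2]; split=> i.
  case: (split_ordP i) => i' -> /=; last by rewrite row_mxEr; apply: v2.
  by rewrite row_mxEl mxE; case: (v1 i').
rewrite /= mxE; have [_ /= [? _]] := v1 i.
by [].
Qed.

Lemma Xkilled0_tstep n (v : Xn V n) : Xkilled 0 v -> Xmem (tstep v).
Proof.
move=> [v1 v2]; split=> i.
  case: (split_ordP i) => i' -> /=; last by rewrite row_mxEr; apply: v2.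
  by rewrite row_mxEl mxE; case: (v1 i').
by rewrite /= mxE; have [_ /= /Qx] := v1 i.
Qed.

(** The trade accounts for the words that end in x or in x y; those that end in y y act
    as 0. *)
Lemma tstep_Xkilled e n (v : Xn V n) : Xkilled e (tstep v) -> Xkilled e.+1 v.
Proof.
move=> [v1 v2]; have h2 j : killed Q e.+1 (v.2 0 j).
  by have := v1 (rshift _ j); rewrite /= row_mxEr.
split=> // i; have := v1 (lshift _ i); have := v2 i; rewrite /= row_mxEl !mxE.
move=> a [b c]; split; first by [].
split; first by [].
by rewrite scalerA fyy scale0r; apply: killed_stable.
Qed.

Lemma killed_Xkilled n (v : Xn V n) :
  (forall i, exists e, killed Q e (v.1 0 i)) -> (forall j, exists e, killed Q e (v.2 0 j)) ->
  exists e, Xkilled e v.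
Proof.
move=> /choice[e1 e1P] /choice[e2 e2P].
exists (maxn (\max_i e1 i) (\max_j e2 j)); split=> i.
  apply: (@killed_le _ _ _ _ (e1 i)) => //; apply: leqW; rewrite leq_max.
  by rewrite (leq_bigmax (F := e1)).
apply: (@killed_le _ _ _ _ (e2 i)) => //; rewrite leq_max.
by rewrite (leq_bigmax (F := e2)) orbT.
Qed.

End Killed.

Lemma Xmem_eq0 (V : lmodType B) n (v : Xn V n) : Xmem (fun u => u = 0) v <-> v = 0.
Proof.
split=> [[v1 v2]|->]; last by split=> i; rewrite mxE.
case: v v1 v2 => v1 v2 /= h1 h2; congr pair; apply/rowP => i; rewrite mxE.
  exact: h1.
exact: h2.
Qed.

End Levels.

(** * The functor to S-modules *)

(** A direct limit of algebras with injective maps is the increasing union of their images. *)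
Record fibLim (k : fieldType) := FibLim {
  fl_S :> algType k;
  iot : forall n, {lrmorphism Sn k n -> fl_S};
  iot_phi : forall n a, iot n.+1 (phi a) = iot n a;
  iot_surj : forall s, exists n a, iot n a = s;
  iot_inj : forall n a, iot n a = 0 -> a = 0
}.

Arguments iot_phi {k f n} a.
Arguments iot_inj {k f n} a _.

Lemma phi_eq0 (k : fieldType) n (a : Sn k n) : phi a = 0 -> a = 0.
Proof.
case: a => a b [h1 h2]; rewrite h2; congr pair.
have := congr1 (@drsubmx _ _ _ _ _) h1; rewrite block_mxKdr => ->.
by apply/matrixP => i j; rewrite !mxE.
Qed.

(** Injectivity and exhaustion hold by construction for the model dirlim of the limit, and
    the universal property of S transfers them. *)
Lemma fibLim_exists (k : fieldType) (S : algType k)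
    (iota : forall n : nat, {lrmorphism Sn k n -> S})
    (S_lim : is_direct_limit (A := fun n => Sn k n)
       (fun n => @phi k n : {lrmorphism Sn k n -> Sn k n.+1}) iota) :
  exists L : fibLim k, fl_S L = S.
Proof.
pose ph n := @phi k n : {lrmorphism Sn k n -> Sn k n.+1}.
have [iphi iuniv] := S_lim; have [dphi duniv] := dirlimP ph.
have [u [uE _]] := iuniv _ _ dphi; have [v [vE _]] := duniv _ _ iphi.
have [w [_ wU]] := iuniv _ _ iphi.
have vu s : v (u s) = s.
  transitivity (w s); last by apply/esym/(wU (idfun : {lrmorphism S -> S})).
  by apply: (wU (v \o u : {lrmorphism S -> S})) => n a /=; rewrite uE vE.
have isurj s : exists n a, iota n a = s.
  have [n [a [_ [ua _]]]] := coh2 (u s) (u s).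
  by exists n, a; rewrite -vE -[s]vu ua.
have iinj n a : iota n a = 0 -> a = 0.
  move=> a0; have : dirlim_in ph a = 0 by rewrite -uE a0 raddf0.
  rewrite -(raddf0 (@dirlim_in _ _ ph n)) => /projP /evzP[N NP].
  have {NP} : ext ph a (maxn n N) = 0.
    have := NP (maxn n N) (leq_maxr _ _).
    have csB (b c : cohseq ph) m : (b - c) m = b m - c m by [].
    rewrite csB /=.
    suff -> : ext ph (0 : Sn k n) (maxn n N) = 0 by rewrite subr0.
    have := leq_maxl n N; move: (maxn n N) => m /subnK <-.
    elim: (m - n)%N => [|d IHd]; first by rewrite ext_id.
    by rewrite addSn extS ?leq_addl // IHd; apply: raddf0.
  have := leq_maxl n N; move: (maxn n N) => m /subnK <-.
  elim: (m - n)%N => [|d IHd]; first by rewrite ext_id.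
  by rewrite addSn extS ?leq_addl // => /phi_eq0; apply: IHd.
by exists (FibLim iphi isurj iinj).
Qed.

Section Representatives.
Variables (k : fieldType) (L : fibLim k).

Lemma iot_eq n (a b : Sn k n) : iot L n a = iot L n b -> a = b.
Proof.
move=> ab; apply/eqP; rewrite -subr_eq0; apply/eqP/(iot_inj (f := L)).
by rewrite linearB /= ab subrr.
Qed.

Definition rep (s : L) (n : nat) : Sn k n :=
  if pselect (exists a, iot L n a = s) is left e then sval (cid e) else 0.

Lemma rep_iot n a : rep (iot L n a) n = a.
Proof.
rewrite /rep; case: pselect => [e|[]]; last by exists a.
by apply: iot_eq; case: cid.
Qed.

Lemma iot_le n m a : (n <= m)%N -> exists b, iot L m b = iot L n a.
Proof.
move=> /subnK <-; elim: (m - n)%N => [|d [b IHd]]; first by exists a.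
by exists (phi b); rewrite -IHd; exact: (iot_phi (f := L)).
Qed.

Lemma rep_ev (s : L) : exists N, forall n, (N <= n)%N -> iot L n (rep s n) = s.
Proof.
have [N [a <-]] := iot_surj s; exists N => n Nn.
by have [b <-] := iot_le a Nn; rewrite rep_iot.
Qed.

End Representatives.

Section F0.
Variables (k : fieldType) (B : fibAlg k).

Section Germs.
Variable M : grmod B.

(** A sequence of rows that from some level on consists of homogeneous rows and is
    compatible with tstep. The colimit is the quotient by the sequences that are
    eventually 0. *)
Record germ := Germ {
  gf :> forall n, Xn M n;
  gf_coh : exists N, forall n, (N <= n)%N -> gf n.+1 = tstep (gf n) /\ Xpr (gf n) = gf n
}.

HB.instance Definition _ := gen_eqMixin germ.
HB.instance Definition _ := gen_choiceMixin germ.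

Lemma germP (u v : germ) : (forall n, u n = v n) -> u = v.
Proof.
case: u v => [u hu] [v hv] /= uv.
have {}uv := functional_extensionality_dep uv; case: v / uv hv => hv.
by congr Germ; apply: Prop_irrelevance.
Qed.

Fact germ_add_coh (u v : germ) : exists N, forall n, (N <= n)%N ->
  u n.+1 + v n.+1 = tstep (u n + v n) /\ Xpr (u n + v n) = u n + v n.
Proof.
have [N uN] := gf_coh u; have [N' vN] := gf_coh v; exists (maxn N N') => n.
by rewrite geq_max tstepD XprD => /andP[/uN[-> ->] /vN[-> ->]].
Qed.

Fact germ_opp_coh (u : germ) : exists N, forall n, (N <= n)%N ->
  - u n.+1 = tstep (- u n) /\ Xpr (- u n) = - u n.
Proof. by have [N uN] := gf_coh u; exists N => n /uN[un ur]; rewrite tstepN XprN ur un. Qed.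

Fact germ_zero_coh : exists N, forall n, (N <= n)%N ->
  (0 : Xn M n.+1) = tstep (0 : Xn M n) /\ Xpr (0 : Xn M n) = 0.
Proof. by exists 0%N => n _; rewrite tstep0 Xpr0. Qed.

Definition germ_add u v := Germ (germ_add_coh u v).
Definition germ_opp u := Germ (germ_opp_coh u).
Definition germ_zero := Germ germ_zero_coh.

Fact germ_addA : associative germ_add.
Proof. by move=> u v w; apply: germP => n; apply: addrA. Qed.
Fact germ_addC : commutative germ_add.
Proof. by move=> u v; apply: germP => n; apply: addrC. Qed.
Fact germ_add0 : left_id germ_zero germ_add.
Proof. by move=> u; apply: germP => n; apply: add0r. Qed.
Fact germ_addN : left_inverse germ_zero germ_opp germ_add.
Proof. by move=> u; apply: germP => n; apply: addNr. Qed.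

HB.instance Definition _ :=
  GRing.isZmodule.Build germ germ_addA germ_addC germ_add0 germ_addN.

Definition germ0 : {pred germ} :=
  [pred u : germ | `[< exists N, forall n, (N <= n)%N -> u n = 0 >]].

Lemma germ0P (u : germ) :
  reflect (exists N, forall n, (N <= n)%N -> u n = 0) (u \in germ0).
Proof. exact: asboolP. Qed.

Fact germ0_zmod_closed : zmod_closed germ0.
Proof.
split; first by apply/germ0P; exists 0%N.
move=> u v /germ0P[N uN] /germ0P[N' vN]; apply/germ0P; exists (maxn N N') => n.
by rewrite geq_max => /andP[/uN un /vN vn]; rewrite /= un vn oppr0 addr0.
Qed.

HB.instance Definition _ := GRing.isZmodClosed.Build germ germ0 germ0_zmod_closed.

End Germs.

Variable L : fibLim k.
Implicit Types M : grmod B.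

(** The type records L so that the structure of a module over L can be inferred from it. *)
Definition F0 M : Type := let _ := L in Quotient.quot (@germ0 M).
HB.instance Definition _ M := GRing.Zmodule.on (F0 M).

Definition cls M (u : germ M) : F0 M := \pi_(Quotient.quot (@germ0 M)) u.

Lemma clsP M (u v : germ M) : cls u = cls v <-> exists N, forall n, (N <= n)%N -> u n = v n.
Proof.
transitivity (u - v \in @germ0 M).
  rewrite (@Quotient.idealrBE (germ M) (@germ0 M)); split=> [|/eqP//] uv.
  exact/eqP.
split=> [/germ0P[N uv]|[N uv]]; last first.
  apply/germ0P; exists N => n /uv uvn; have -> : (u - v) n = u n - v n by [].
  by rewrite uvn subrr.
exists N => n /uv uvn; apply/eqP; rewrite -subr_eq0; apply/eqP.
by rewrite -uvn.
Qed.

Lemma cls_surj M (u : F0 M) : exists g, cls g = u.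
Proof. by exists (repr u); rewrite /cls reprK. Qed.

Fact cls_zmod_morphism M : zmod_morphism (@cls M).
Proof. by move=> u v; rewrite /cls !piE. Qed.

HB.instance Definition _ M :=
  GRing.isZmodMorphism.Build (germ M) (F0 M) (@cls M) (@cls_zmod_morphism M).

(** The images of v at the levels m >= n, with 0 below. *)
Fixpoint Xext M n (v : Xn M n) m : Xn M m :=
  match n =P m with
  | ReflectT e => eq_rect n (Xn M) v m e
  | ReflectF _ => if m is m'.+1 return Xn M m then tstep (Xext v m') else 0
  end.

Lemma Xext_id M n (v : Xn M n) : Xext v n = v.
Proof. by case: n v => [|n] v /=; case: eqP => // e; rewrite eq_axiomK. Qed.

Lemma XextS M n (v : Xn M n) m : (n <= m)%N -> Xext v m.+1 = tstep (Xext v m).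
Proof. by move=> nm /=; case: eqP => // e; case/negP: (ltnn m); rewrite -{1}e. Qed.

Arguments Xext : simpl never.

Lemma Xext_pr M n (v : Xn M n) m : (n <= m)%N -> Xpr (Xext (Xpr v) m) = Xext (Xpr v) m.
Proof.
move=> /subnK <-; elim: (m - n)%N => [|d IHd]; first by rewrite Xext_id XprK.
by rewrite addSn XextS ?leq_addl // Xpr_tstep IHd.
Qed.

Fact Xext_coh M n (v : Xn M n) : exists N, forall m, (N <= m)%N ->
  Xext (Xpr v) m.+1 = tstep (Xext (Xpr v) m) /\ Xpr (Xext (Xpr v) m) = Xext (Xpr v) m.
Proof. by exists n => m nm; rewrite XextS // Xext_pr. Qed.

Definition inj M n (v : Xn M n) : F0 M := cls (Germ (Xext_coh v)).

Lemma coherent_eq M n (u v : forall m, Xn M m) :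
  (forall m, (n <= m)%N -> u m.+1 = tstep (u m)) ->
  (forall m, (n <= m)%N -> v m.+1 = tstep (v m)) ->
  u n = v n -> forall m, (n <= m)%N -> u m = v m.
Proof.
move=> uS vS uv m /subnK <-; elim: (m - n)%N => [//|d IHd].
by rewrite addSn uS ?vS ?leq_addl // IHd.
Qed.

Lemma cls_inj M (g : germ M) n :
  (forall m, (n <= m)%N -> g m.+1 = tstep (g m)) -> Xpr (g n) = g n ->
  cls g = inj (g n).
Proof.
move=> gS gp; apply/clsP; exists n; apply: (coherent_eq gS) => [m nm|] /=.
  by rewrite XextS.
by rewrite Xext_id gp.
Qed.

Lemma inj_pr M n (v : Xn M n) : inj (Xpr v) = inj v.
Proof. by apply/clsP; exists n => m nm; rewrite /= XprK. Qed.

Fact inj_zmod_morphism M n : zmod_morphism (@inj M n).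
Proof.
move=> u v; rewrite /inj -raddfB; apply/clsP; exists n => m /=.
apply: (coherent_eq (u := fun m => Xext (Xpr (u - v)) m)
                    (v := fun m => Xext (Xpr u) m - Xext (Xpr v) m)) m.
- by move=> m nm; rewrite XextS.
- by move=> m nm; rewrite !XextS // tstepB.
- by rewrite !Xext_id XprB.
Qed.

HB.instance Definition _ M n :=
  GRing.isZmodMorphism.Build (Xn M n) (F0 M) (@inj M n) (@inj_zmod_morphism M n).

Lemma inj_tstep M n (v : Xn M n) : inj (tstep v) = inj v.
Proof.
rewrite /inj; apply/clsP; exists n.+1 => m; apply: coherent_eq m => /= [m nm|m nm|].
- by rewrite XextS.
- by rewrite XextS // ltnW.
- by rewrite Xext_id (XextS _ (leqnn n)) // Xext_id Xpr_tstep.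
Qed.

Lemma inj_surj_at M (u : F0 M) : exists N, forall n, (N <= n)%N ->
  exists v : Xn M n, u = inj v /\ Xpr v = v.
Proof.
have [g <-] := cls_surj u; have [N gN] := gf_coh g; exists N => n Nn.
exists (g n); split; last by case: (gN n Nn).
apply: cls_inj; last by case: (gN n Nn).
by move=> m nm; case: (gN m (leq_trans Nn nm)).
Qed.

Lemma inj_surj M (u : F0 M) : exists n (v : Xn M n), u = inj v /\ Xpr v = v.
Proof.
by have [N /(_ N (leqnn N))[v vP]] := inj_surj_at u; exists N, v.
Qed.

(** If a row vanishes after d steps its entries are killed by words of bounded length. *)
Lemma inj_eq0_ev M n (v : Xn M n) : inj v = 0 -> Xpr v = v ->
  exists e, Xkilled (fun u => u = 0) e v.
Proof.
rewrite -(raddf0 (@cls M)) => /clsP[N vN] vp.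
have {vN} : exists m, (n <= m)%N /\ Xext v m = 0.
  by exists (maxn n N); rewrite leq_maxl -{1}vp; split=> //; apply: vN (leq_maxr _ _).
move=> [m [/subnK/esym]]; move: (m - n)%N => d.
elim: d n v {vp} => [|d IHd] n v mE.
  subst m; rewrite Xext_id => ->; exists 0%N.
  by split=> i /=; rewrite mxE ?scaler0.
have -> : Xext v m = Xext (tstep v) m.
  apply: (coherent_eq (n := n.+1) (u := Xext v) (v := Xext (tstep v))).
  - by move=> l nl; rewrite XextS // ltnW.
  - by move=> l nl; rewrite XextS.
  - by rewrite Xext_id (XextS _ (leqnn n)) Xext_id.
  - by rewrite mE addSn ltnS leq_addl.
have {}mE : m = (d + n.+1)%N by rewrite mE addSnnS.
move=> /(IHd _ _ mE)[e h]; exists e.+1; apply: tstep_Xkilled h => // u ->;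
  exact: scaler0.
Qed.

Lemma inj_killed M e n (v : Xn M n) : Xkilled (fun u => u = 0) e v -> inj v = 0.
Proof.
elim: e n v => [|e IHe] n v ve; rewrite -inj_tstep; last first.
  exact/IHe/Xkilled_tstep.
rewrite (_ : tstep v = 0) ?raddf0 //; apply/Xmem_eq0.
by apply: Xkilled0_tstep ve => u ->; rewrite scaler0.
Qed.

Lemma inj_torsion M n (v : Xn M n) :
  (forall i, torsion (v.1 0 i)) -> (forall j, torsion (v.2 0 j)) -> inj v = 0.
Proof.
move=> v1 v2; have [e] : exists e, Xkilled (fun u => u = 0) e v.
  by apply: killed_Xkilled => // u ->; rewrite scaler0.
exact: inj_killed.
Qed.

Lemma inj_eq0 M n (v : Xn M n) : inj v = 0 -> Xpr v = v ->
  (forall i, torsion (v.1 0 i)) /\ (forall j, torsion (v.2 0 j)).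
Proof.
move=> v0 vp; have [e [v1 v2]] := inj_eq0_ev v0 vp.
by split=> i; [exists e.+1|exists e].
Qed.

(** ** The action of S *)

Fact germ_act_coh M (s : L) (g : germ M) : exists N, forall n, (N <= n)%N ->
  Xact (g n.+1) (rep s n.+1) = tstep (Xact (g n) (rep s n)) /\
  Xpr (Xact (g n) (rep s n)) = Xact (g n) (rep s n).
Proof.
have [N gN] := gf_coh g; have [N' sN] := rep_ev s; exists (maxn N N') => n.
rewrite geq_max => /andP[/gN[gS gp] Nn]; rewrite tstep_act gS Xpr_act gp; split=> //.
by congr (Xact _ _); apply: (@iot_eq _ L); rewrite iot_phi !sN // leqW.
Qed.

Definition germ_act M (s : L) (g : germ M) : germ M := Germ (germ_act_coh s g).

Definition F0_scale M (s : L^c) (u : F0 M) : F0 M := cls (germ_act s (repr u)).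

Lemma F0_scale_cls M (s : L^c) (g : germ M) : F0_scale s (cls g) = cls (germ_act s g).
Proof.
have /clsP[N gN] : cls (repr (cls g)) = cls g by rewrite /cls reprK.
by apply/clsP; exists N => n /gN /= ->.
Qed.

Lemma F0_scale_inj M n (v : Xn M n) (a : Sn k n) :
  F0_scale (iot L n a : L^c) (inj v) = inj (Xact v a).
Proof.
rewrite F0_scale_cls; have [N sN] := rep_ev (iot L n a).
apply/clsP; exists n => m nm /=.
apply: (coherent_eq (u := fun m => Xact (Xext (Xpr v) m) (rep (iot L n a) m))
  (v := Xext (Xpr (Xact v a)))) (nm) => [l nl|l nl|].
- rewrite tstep_act XextS //; congr (Xact _ _); apply: (@iot_eq _ L).
  rewrite iot_phi.
  have [b bE] := iot_le L a nl; rewrite -bE (rep_iot L b) -(iot_phi b) (rep_iot L (phi b)).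
  by rewrite iot_phi.
- by rewrite XextS.
- by rewrite !Xext_id rep_iot Xpr_act.
Qed.

Lemma F0_common M (s s' : L) (u u' : F0 M) : exists n (a a' : Sn k n) (v v' : Xn M n),
  [/\ s = iot L n a, s' = iot L n a', u = inj v & u' = inj v'].
Proof.
have [N NP] := inj_surj_at u; have [N' N'P] := inj_surj_at u'.
have [l [a <-]] := iot_surj s; have [l' [a' <-]] := iot_surj s'.
pose n := maxn (maxn N N') (maxn l l').
have [v [-> _]] := NP n (leq_trans (leq_maxl _ _) (leq_maxl _ _)).
have [v' [-> _]] := N'P n (leq_trans (leq_maxr _ _) (leq_maxl _ _)).
have [b <-] := iot_le L a (leq_trans (leq_maxl l l') (leq_maxr (maxn N N') _)).
have [b' <-] := iot_le L a' (leq_trans (leq_maxr l l') (leq_maxr (maxn N N') _)).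
by exists n, b, b', v, v'.
Qed.

Fact F0_scaleA M (s s' : L^c) (u : F0 M) :
  F0_scale s (F0_scale s' u) = F0_scale (s * s') u.
Proof.
have [n [a [a' [v [_ [-> -> -> _]]]]]] := F0_common s s' u u.
have -> : (iot L n a : L^c) * (iot L n a' : L^c) = iot L n (a' * a).
  by rewrite rmorphM.
by rewrite !F0_scale_inj XactA.
Qed.

Fact F0_scale1 M : left_id (1 : L^c) (@F0_scale M).
Proof.
move=> u; have [n [v [-> _]]] := inj_surj u.
have -> : (1 : L^c) = iot L n 1 by rewrite rmorph1.
by rewrite F0_scale_inj Xact1.
Qed.

Fact F0_scaleDr M : right_distributive (@F0_scale M) +%R.
Proof.
move=> s u u'; have [n [a [a' [v [v' [-> _ -> ->]]]]]] := F0_common s s u u'.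
by rewrite -raddfD !F0_scale_inj -raddfD XactDl.
Qed.

Fact F0_scaleDl M (u : F0 M) : {morph (@F0_scale M)^~ u : s s' / s + s'}.
Proof.
move=> s s'; have [n [a [a' [v [v' [-> -> -> _]]]]]] := F0_common s s' u u.
have -> : (iot L n a : L^c) + (iot L n a' : L^c) = iot L n (a + a').
  by rewrite raddfD.
by rewrite !F0_scale_inj -raddfD XactDr.
Qed.

HB.instance Definition _ M := GRing.Zmodule_isLmodule.Build L^c (F0 M)
  (@F0_scaleA M) (@F0_scale1 M) (@F0_scaleDr M) (@F0_scaleDl M).

Lemma inj_act M n (v : Xn M n) (a : Sn k n) :
  (iot L n a : L^c) *: inj v = inj (Xact v a).
Proof. exact: F0_scale_inj. Qed.

Section Lift.
Variables (M : grmod B) (N : lmodType L^c) (h : forall n, {additive Xn M n -> N}).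
Hypothesis hS : forall n (v : Xn M n), h n.+1 (tstep v) = h n v.
Hypothesis hZ : forall n (v : Xn M n) a, Xpr v = v ->
  h n (Xact v a) = (iot L n a : L^c) *: h n v.

Lemma lift_well_defined (u : F0 M) : exists z : N,
  forall n (v : Xn M n), u = inj v -> Xpr v = v -> h n v = z.
Proof.
have [n [v [-> vp]]] := inj_surj u; exists (h n v) => n' v' vv' v'p.
have hE m (w : Xn M m) l : (m <= l)%N -> h l (Xext w l) = h m w.
  move=> /subnK <-; elim: (l - m)%N => [|d IHd]; first by rewrite Xext_id.
  by rewrite addSn XextS ?leq_addl // hS.
have /clsP[l vvl] := vv'; pose l' := maxn l (maxn n n').
have := vvl l' (leq_maxl _ _); rewrite /= vp v'p => e.
rewrite -(hE _ v' l') ?leq_max ?leqnn ?orbT // -e.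
by rewrite hE // !leq_max leqnn orbT.
Qed.

Definition F0_lift_fun (u : F0 M) : N := sval (cid (lift_well_defined u)).

Lemma F0_lift_inj n (v : Xn M n) : Xpr v = v -> F0_lift_fun (inj v) = h n v.
Proof. by rewrite /F0_lift_fun; case: cid => z zP vp; rewrite (zP n v). Qed.

Fact F0_lift_linear : linear F0_lift_fun.
Proof.
move=> s u u'.
have [N1 uP] := inj_surj_at u; have [N2 u'P] := inj_surj_at u'.
have [l [a <-]] := iot_surj s; pose n := maxn (maxn N1 N2) l.
have [v [-> vp]] := uP n (leq_trans (leq_maxl _ _) (leq_maxl _ _)).
have [v' [-> v'p]] := u'P n (leq_trans (leq_maxr _ _) (leq_maxl _ _)).
have [b <-] := iot_le L a (leq_maxr (maxn N1 N2) l).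
rewrite -/(GRing.scale _ _) inj_act -raddfD !F0_lift_inj //.
  by rewrite raddfD hZ.
by rewrite XprD Xpr_act vp v'p.
Qed.

HB.instance Definition _ := GRing.isLinear.Build L^c (F0 M) N _ F0_lift_fun F0_lift_linear.

Definition F0_lift : {linear F0 M -> N} := F0_lift_fun.

Lemma F0_liftE n (v : Xn M n) : Xpr v = v -> F0_lift (inj v) = h n v.
Proof. exact: F0_lift_inj. Qed.

End Lift.
End F0.

Lemma linear_inj0 (A : pzRingType) (U V : lmodType A) (f : {linear U -> V}) :
  (forall u, f u = 0 -> u = 0) -> injective f.
Proof.
move=> f0 u v uv; apply/eqP; rewrite -subr_eq0; apply/eqP/f0.
by rewrite linearB /= uv subrr.
Qed.

Section F0Functor.
Variables (k : fieldType) (B : fibAlg k) (L : fibLim k).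
Local Notation x := (fx B).
Local Notation y := (fy B).
Local Notation FL := (F0 L).
Local Notation injL := (@inj k B L _ _).

Section Morphism.
Variables (M N : grmod B) (f : grhom M N).

Let h n : {additive Xn M n -> FL N} := (@inj k B L N n \o @Xmap k B M N f n).

Fact F0map_tstep n (v : Xn M n) : h n.+1 (tstep v) = h n v.
Proof. by rewrite /= Xmap_tstep inj_tstep. Qed.

Fact F0map_act n (v : Xn M n) a : Xpr v = v ->
  h n (Xact v a) = (iot L n a : L^c) *: h n v.
Proof. by move=> _; rewrite /= inj_act Xmap_act // => c u; exact: linearZ_LR. Qed.

Definition F0map : {linear FL M -> FL N} := F0_lift F0map_tstep F0map_act.

Lemma F0map_inj n (v : Xn M n) : F0map (injL v) = injL (Xmap f v).
Proof.
by rewrite -inj_pr F0_liftE ?XprK //= -Xpr_map inj_pr.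
Qed.

(** An extension of torsion by torsion is torsion. *)
Lemma F0map_injective : (forall m, f m = 0 -> torsion m) -> injective F0map.
Proof.
move=> ft; apply: linear_inj0 => u; have [n [v [-> vp]]] := inj_surj u.
rewrite F0map_inj => /inj_eq0[|v1 v2]; first by rewrite Xpr_map vp.
have tf m : torsion (f m) -> torsion m.
  move=> [e /killed_map me]; apply: (@killed_torsion _ _ _ e).
  by apply: killed_impl me => w /ft.
by apply: inj_torsion => i; apply: tf; [move: (v1 i)|move: (v2 i)]; rewrite mxE.
Qed.

(** Every step of the system multiplies the entries by words, so finitely many steps lead
    into Q. *)
Lemma inj_Xmem (Q : gsub N) n (v : Xn N n) :
  (forall i, exists e, killed Q e (v.1 0 i)) -> (forall j, exists e, killed Q e (v.2 0 j)) ->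
  exists n' (v' : Xn N n'), injL v = injL v' /\ Xmem Q v'.
Proof.
move=> v1 v2; have [e] : exists e, Xkilled Q e v.
  by apply: killed_Xkilled => // w; apply: gsZ.
elim: e n v {v1 v2} => [|e IHe] n v ve; rewrite -inj_tstep; last exact/IHe/Xkilled_tstep.
by exists n.+1, (tstep v); split=> //; apply: Xkilled0_tstep ve => w; apply: gsZ.
Qed.

Lemma F0map_surjective : (forall n : N, exists e, killed (gim f) e n) ->
  forall u, exists v, F0map v = u.
Proof.
move=> fe u; have [n0 [v0 [-> _]]] := inj_surj u.
have [n [v [-> [v1 v2]]]] := inj_Xmem (Q := gim f) (v := v0) (fun i => fe _) (fun j => fe _).
have /choice[w1 w1P] := v1; have /choice[w2 w2P] := v2.
exists (injL (\row_i w1 i, \row_j w2 j)); rewrite F0map_inj; congr inj.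
by case: v v1 v2 w1P w2P => v1 v2 /= _ _ w1P w2P; congr pair;
  apply/rowP => i; rewrite !mxE.
Qed.

End Morphism.

Lemma F0map_eq (M N : grmod B) (f g : grhom M N) : f =1 g -> F0map f =1 F0map g.
Proof.
move=> fg u; have [n [v [-> _]]] := inj_surj u; rewrite !F0map_inj.
have -> : Xmap f v = Xmap g v by congr pair; apply: eq_map_mx.
by [].
Qed.

Lemma F0map_id (M : grmod B) : F0map (grhom_id M) =1 id.
Proof.
move=> u; have [n [v [-> _]]] := inj_surj u; rewrite !F0map_inj.
have -> : Xmap (grhom_id M) v = v by case: v => v1 v2; congr pair; apply: map_mx_id.
by [].
Qed.

Lemma F0map_comp (M N P : grmod B) (g : grhom N P) (f : grhom M N) :
  F0map (grhom_comp g f) =1 F0map g \o F0map f.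
Proof.
move=> u; have [n [v [-> _]]] := inj_surj u.
transitivity (injL (Xmap (grhom_comp g f) v)); first exact: F0map_inj.
transitivity (F0map g (injL (Xmap f v))).
  have -> : Xmap (grhom_comp g f) v = Xmap g (Xmap f v).
    by case: v => v1 v2; congr pair; apply: map_mx_comp.
  by apply/esym; apply: F0map_inj.
by congr (F0map g _); apply/esym; apply: F0map_inj.
Qed.

Definition F0_functor : functor (Gr B) (RMod L) :=
  @Functor (Gr B) (RMod L) FL (fun M N f => F0map f) F0map_eq F0map_id F0map_comp.

End F0Functor.

Lemma Mod_invertible (A : pzRingType) (M N : Mod A) (f : hom M N) :
  injective f -> (forall u, exists v, f v = u) -> invertible f.
Proof.
move=> fI /choice[g fg].
have g_lin : linear g.
  by move=> a u v; apply: fI; rewrite linearP !fg.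
pose gl := GRing.isLinear.Build A N M _ g g_lin.
pose G : {linear N -> M} := HB.pack g gl.
by exists G; split=> u; [apply: fI|]; rewrite /= fg.
Qed.

(** ** Matrix units of S *)

Section MatrixUnits.
Variables (k : fieldType) (L : fibLim k).

Definition io n : 'I_(fib n.+1) := Ordinal (fib_gt0 n.+1).
Definition ro n : 'I_(fib n.+2) := rshift (fib n.+1) (Ordinal (fib_gt0 n)).

Definition E1 n (i j : 'I_(fib n.+1)) : L := iot L n (delta_mx i j, 0).
Definition E2 n (i j : 'I_(fib n)) : L := iot L n (0, delta_mx i j).

Lemma lshift_io n : lshift (fib n) (io n) = io n.+1.
Proof. exact: val_inj. Qed.

Lemma E1S n (i j : 'I_(fib n.+1)) :
  E1 i j = @E1 n.+1 (lshift (fib n) i) (lshift (fib n) j) + E2 i j.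
Proof.
rewrite /E1 /E2 -iot_phi -raddfD; congr (iot L _ _); congr pair => /=; last first.
  by rewrite add0r.
rewrite addr0; apply/matrixP => a b; rewrite !mxE.
by case: (split_ordP a) => a' ->; rewrite mxE; case: (split_ordP b) => b' ->;
  rewrite !mxE ?eq_lshift ?eq_rshift ?eq_lrshift ?eq_rlshift ?andbF.
Qed.

Lemma E2S n (i j : 'I_(fib n)) :
  E2 i j = @E1 n.+1 (rshift (fib n.+1) i) (rshift (fib n.+1) j).
Proof.
rewrite /E1 /E2 -iot_phi; congr (iot L _ _); congr pair => /=.
apply/matrixP => a b; rewrite !mxE.
by case: (split_ordP a) => a' ->; rewrite mxE; case: (split_ordP b) => b' ->;
  rewrite !mxE ?eq_lshift ?eq_rshift ?eq_lrshift ?eq_rlshift ?andbF.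
Qed.

Lemma Sn_fst_sum n I (r : seq I) (P : pred I) (F : I -> Sn k n) :
  (\sum_(i <- r | P i) F i).1 = \sum_(i <- r | P i) (F i).1.
Proof. exact: (big_morph (fun a : Sn k n => a.1)). Qed.

Lemma Sn_snd_sum n I (r : seq I) (P : pred I) (F : I -> Sn k n) :
  (\sum_(i <- r | P i) F i).2 = \sum_(i <- r | P i) (F i).2.
Proof. exact: (big_morph (fun a : Sn k n => a.2)). Qed.

Lemma E1_mul n i j (a : Sn k n) : E1 i j * iot L n a = \sum_l a.1 j l *: E1 i l.
Proof.
rewrite /E1 -rmorphM.
under eq_bigr => l _ do rewrite -linearZ.
rewrite -raddf_sum; congr (iot L n _); rewrite [RHS]surjective_pairing; congr pair.
  rewrite Sn_fst_sum /=; apply/matrixP => b c; rewrite mxE summxE.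
  rewrite (bigD1 j) //= big1 => [|l lj]; last by rewrite mxE (negPf lj) andbF mul0r.
  rewrite (bigD1 c) //= big1 => [|l lc].
    by rewrite !mxE !eqxx andbT !addr0 mulrC.
  by rewrite !mxE [c == l]eq_sym (negPf lc) andbF mulr0.
rewrite Sn_snd_sum /= big1 => [|l _]; last exact: scaler0.
exact: mul0mx.
Qed.

Lemma E1M n i j j' l : @E1 n i j * E1 j' l = E1 i l *+ (j == j').
Proof.
rewrite {2}/E1 E1_mul (bigD1 l) //= big1 => [|l' ll]; last first.
  by rewrite mxE (negPf ll) andbF scale0r.
by rewrite mxE eqxx andbT addr0; case: (j == j'); rewrite ?scale1r ?scale0r.
Qed.

Lemma E1_id n i j l : @E1 n i j * E1 j l = E1 i l.
Proof. by rewrite E1M eqxx. Qed.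

Lemma E1_sum n : \sum_i @E1 n i i + \sum_j @E2 n j j = 1.
Proof.
rewrite /E1 /E2 -!raddf_sum -raddfD -(rmorph1 (iot L n)); congr (iot L n _).
rewrite [LHS]surjective_pairing; congr pair.
  transitivity ((\sum_(i < fib n.+1) ((delta_mx i i, 0) : Sn k n)).1
    + (\sum_(i < fib n) ((0, delta_mx i i) : Sn k n)).1) => //.
  by rewrite !Sn_fst_sum /= [X in _ + X]big1 // addr0 [RHS]mx1_sum_delta.
transitivity ((\sum_(i < fib n.+1) ((delta_mx i i, 0) : Sn k n)).2
    + (\sum_(i < fib n) ((0, delta_mx i i) : Sn k n)).2) => //.
by rewrite !Sn_snd_sum /= [X in X + _]big1 // add0r [RHS]mx1_sum_delta.
Qed.

End MatrixUnits.

Section RightAction.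
Variables (A : pzRingType) (N : lmodType A^c).

(** A module over the converse ring, with the products written in the order of A. *)
Definition ract (v : N) (s : A) : N := (s : A^c) *: v.

Lemma ractM v s t : ract (ract v s) t = ract v (s * t).
Proof. by rewrite /ract scalerA. Qed.

Lemma ract1 v : ract v 1 = v.
Proof. exact: scale1r. Qed.

Lemma ractDl u v s : ract (u + v) s = ract u s + ract v s.
Proof. exact: scalerDr. Qed.

Lemma ractBl u v s : ract (u - v) s = ract u s - ract v s.
Proof. exact: scalerBr. Qed.

Lemma ractDr v s t : ract v (s + t) = ract v s + ract v t.
Proof. exact: scalerDl. Qed.

Lemma ractBr v s t : ract v (s - t) = ract v s - ract v t.
Proof. exact: scalerBl. Qed.

Lemma ract0l s : ract 0 s = 0.
Proof. exact: scaler0. Qed.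

Lemma ract0r v : ract v 0 = 0.
Proof. exact: scale0r. Qed.

Lemma ract_suml I (r : seq I) (P : pred I) (v : I -> N) s :
  ract (\sum_(i <- r | P i) v i) s = \sum_(i <- r | P i) ract (v i) s.
Proof. exact: scaler_sumr. Qed.

Lemma ract_sumr I (r : seq I) (P : pred I) v (s : I -> A) :
  ract v (\sum_(i <- r | P i) s i) = \sum_(i <- r | P i) ract v (s i).
Proof. exact: scaler_suml. Qed.

End RightAction.

Lemma ract_map (A : pzRingType) (N N' : lmodType A^c) (f : {linear N -> N'}) v (s : A) :
  f (ract v s) = ract (f v) s.
Proof. exact: linearZ_LR. Qed.

Local Notation "v <*> s" := (ract v s) (at level 40, left associativity).

Section Generators.
Variables (k : fieldType) (B : fibAlg k) (L : fibLim k).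
Local Notation x := (fx B).
Local Notation y := (fy B).
Local Notation FL := (F0 L).
Local Notation injL := (@inj k B L _ _).
Local Notation E1L := (@E1 k L _).

Lemma ract_inj (M : grmod B) n (v : Xn M n) a :
  (injL v : FL M) <*> iot L n a = injL (Xact v a).
Proof. exact: inj_act. Qed.

Definition Xunit (V : lmodType B) n (m : V) : Xn V n :=
  (\row_i (m *+ (i == io n)), 0).

Fact Xunit_zmod_morphism (V : lmodType B) n : zmod_morphism (@Xunit V n).
Proof.
move=> u v; congr pair; last by rewrite subr0.
by apply/rowP => i; rewrite !mxE mulrnBl.
Qed.

HB.instance Definition _ (V : lmodType B) n :=
  GRing.isZmodMorphism.Build V (Xn V n) (@Xunit V n) (@Xunit_zmod_morphism V n).

Variable M : grmod B.
Implicit Types m : M.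

(** The class of the row of level n whose only entry is m, in the first block; only the
    component of m of degree n + 1 counts. *)
Definition jn n m : FL M := injL (Xunit n m).

Fact jn_zmod_morphism n : zmod_morphism (jn n).
Proof. by move=> u v; rewrite /jn !raddfB. Qed.

HB.instance Definition _ n :=
  GRing.isZmodMorphism.Build M (FL M) (jn n) (jn_zmod_morphism n).

Lemma jn_gpr n m : jn n (gpr n.+1%:Z m) = jn n m.
Proof.
rewrite /jn -[RHS]inj_pr; congr inj; congr pair; last by rewrite map_mx0.
by apply/rowP => i; rewrite !mxE raddfMn.
Qed.

Lemma inj_E1 n (v : Xn M n) i : injL v <*> E1L i (io n) = jn n (v.1 0 i).
Proof.
rewrite ract_inj; congr inj; congr pair; first exact: rmul_delta.
by apply/rowP => j; rewrite !mxE big1 // => l _; rewrite mxE !scale0r.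
Qed.

Lemma inj_E1r n (v : Xn M n) j :
  injL v <*> @E1 k L n.+1 (rshift (fib n.+1) j) (io n.+1) = jn n.+1 (v.2 0 j).
Proof. by rewrite -inj_tstep inj_E1 /= row_mxEr. Qed.

Lemma inj_sum n (v : Xn M n) :
  injL v = \sum_i jn n (v.1 0 i) <*> E1L (io n) i
    + \sum_j jn n.+1 (v.2 0 j) <*> @E1 k L n.+1 (io n.+1) (rshift (fib n.+1) j).
Proof.
rewrite -[LHS]ract1 -(E1_sum L n) ractDr !ract_sumr; congr (_ + _).
  by apply: eq_bigr => i _; rewrite -inj_E1 ractM E1_id.
by apply: eq_bigr => j _; rewrite -inj_E1r ractM E1_id E2S.
Qed.

Lemma tstep_Xunit n m :
  tstep (Xunit n m) = (\row_i ((x *: m) *+ (i == io n.+1)), \row_i (x *: (y *: m) *+ (i == io n))).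
Proof.
congr pair; last by apply/rowP => i; rewrite !mxE raddfMn.
apply/rowP => i; rewrite [RHS]mxE; case: (split_ordP i) => i' ->.
  by rewrite row_mxEl !mxE raddfMn -lshift_io eq_lshift.
rewrite row_mxEr mxE -lshift_io eq_rlshift.
by [].
Qed.

(** By jn_x and jn_y the generators of B act on these elements through matrix units of S.
    Hence M can be recovered from F0 M up to torsion. *)
Lemma jn_x n m : jn n.+1 (x *: m) = jn n m <*> E1L (io n.+1) (io n.+1).
Proof. by rewrite -[jn n m]inj_tstep inj_E1 tstep_Xunit mxE eqxx. Qed.

(** Of the two entries x m and x y m that replace m the second is 0. *)
Lemma jn_yker n m : y *: m = 0 -> jn n m = jn n.+1 (x *: m).
Proof.
move=> m0; rewrite /jn -[LHS]inj_tstep tstep_Xunit m0 scaler0; congr inj.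
by congr pair; apply/rowP => i; rewrite !mxE mul0rn.
Qed.

Lemma jn_y n m : jn n.+1 (y *: m) = jn n m <*> E1L (ro n.+1) (io n.+2).
Proof.
rewrite jn_yker ?yyv // -[jn n m]inj_tstep inj_E1r tstep_Xunit mxE.
by have -> : (Ordinal (fib_gt0 n.+1) == io n) = true by [].
Qed.

Lemma jn_E1 n m : jn n m <*> E1L (io n) (io n) = jn n m.
Proof. by rewrite inj_E1 mxE eqxx. Qed.

Lemma jn_scalar n m (c : k) : jn n (c%:A *: m) = jn n m <*> c%:A.
Proof.
have -> : (c%:A : L) = iot L n (c%:A) by rewrite linearZ_LR rmorph1.
rewrite ract_inj; congr inj; congr pair; last by rewrite /= rmul0l.
apply/rowP => i; rewrite !mxE (bigD1 i) //= big1 ?addr0 => [|j ji].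
  by rewrite !mxE eqxx mulr1n mulr1 scalerMnr.
by rewrite !mxE (negPf ji) mulr0n mulr0 !scale0r.
Qed.

Lemma jn_eq0 n m : gm_comp n.+1%:Z m -> jn n m = 0 -> torsion m.
Proof.
move=> mn /inj_eq0[|/(_ (io n)) + _]; last by rewrite mxE eqxx.
congr pair; last exact: map_mx0.
apply/rowP => i; rewrite !mxE raddfMn /= /gpr pr_id //.
Qed.

(** Matrix units move each entry of a row into column 0 and back. *)
Lemma F0_generated (I : FL M -> Prop) :
  (forall u v, I u -> I v -> I (u + v)) -> (forall u s, I u -> I (u <*> s)) ->
  (forall n m, gm_comp n.+1%:Z m -> I (jn n m)) -> forall u, I u.
Proof.
move=> ID Is Ij u; have [n [v [-> vp]]] := inj_surj u.
have I0 : I 0.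
  rewrite -(ract0l (A := L) _ 1) -(raddf0 (jn 0)).
  exact/Is/Ij/(grading0 (gm_grading M)).
rewrite inj_sum; apply: (ID); apply: (big_ind _ I0 ID) => i _; apply/Is/Ij.
  exact: Xpr_homog1.
exact: Xpr_homog2.
Qed.

End Generators.

Section GeneratorsMap.
Variables (k : fieldType) (B : fibAlg k) (L : fibLim k).

Lemma F0map_jn (M N : grmod B) (f : grhom M N) n (m : M) :
  F0map L f (jn L n m) = jn L n (f m).
Proof.
rewrite F0map_inj; congr inj; congr pair; last exact: map_mx0.
by apply/rowP => i; rewrite !mxE raddfMn.
Qed.

End GeneratorsMap.

(** * The functor from S-modules to graded B-modules *)

Section MoreUnits.
Variables (k : fieldType) (L : fibLim k).

Lemma E2E1 n i j i' j' : @E2 k L n i j * @E1 k L n i' j' = 0.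
Proof.
rewrite /E1 /E2 -rmorphM (_ : _ * _ = 0) ?raddf0 //.
by congr pair; [apply: mul0mx|apply: mulmx0].
Qed.

Lemma E1_E1S n (i j j' : 'I_(fib n.+1)) l :
  E1 L i j * @E1 k L n.+1 (lshift (fib n) j') l =
  @E1 k L n.+1 (lshift (fib n) i) l *+ (j == j').
Proof. by rewrite E1S mulrDl E2E1 addr0 E1M eq_lshift. Qed.

Lemma E1_E1r n (i j : 'I_(fib n.+1)) (j' : 'I_(fib n)) l :
  E1 L i j * @E1 k L n.+1 (rshift (fib n.+1) j') l = 0.
Proof. by rewrite E1S mulrDl E2E1 addr0 E1M eq_lrshift. Qed.

Lemma scalar_central (c : k) (s : L) : c%:A * s = s * c%:A.
Proof. by rewrite mulr_algl mulr_algr. Qed.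

End MoreUnits.

Section Gvec.
Variables (k : fieldType) (L : fibLim k) (N : lmodType L^c).

(** The element of index n will have degree n + 1; degrees up to 0 are torsion and can be
    left out. *)
Definition Gvec : Type := {malg N[nat]}.
HB.instance Definition _ := GRing.Zmodule.on Gvec.
Implicit Types g : Gvec.

Lemma GvecP g h : (forall n, g@_n = h@_n) -> g = h.
Proof. by move=> gh; apply/malgP. Qed.

Definition gscale (c : k) g : Gvec :=
  [malg n in msupp g => (g@_n : N) <*> (c%:A : L)].

Lemma gscaleE c g n : (gscale c g)@_n = g@_n <*> (c%:A : L).
Proof. by rewrite mcoeffE; case: msuppP; rewrite ?ract0l. Qed.

Fact gscaleA c d g : gscale c (gscale d g) = gscale (c * d) g.
Proof.
by apply: GvecP => n; rewrite !gscaleE ractM -scalerAl mul1r scalerA mulrC.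
Qed.
Fact gscale1 : left_id 1 gscale.
Proof. by move=> g; apply: GvecP => n; rewrite gscaleE scale1r ract1. Qed.
Fact gscaleDr : right_distributive gscale +%R.
Proof. by move=> c g h; apply: GvecP => n; rewrite mcoeffD !gscaleE mcoeffD ractDl. Qed.
Fact gscaleDl g : {morph gscale^~ g : c d / c + d}.
Proof. by move=> c d; apply: GvecP => n; rewrite mcoeffD !gscaleE scalerDl ractDr. Qed.

HB.instance Definition _ := GRing.Zmodule_isLmodule.Build k Gvec
  gscaleA gscale1 gscaleDr gscaleDl.

Lemma GvecZ (c : k) g n : (c *: g)@_n = g@_n <*> (c%:A : L).
Proof. exact: gscaleE. Qed.

Definition gshift (s : nat -> L) g : Gvec :=
  [malg n in [fset i.+1 | i in msupp g]%fset =>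
     if n is n'.+1 then (g@_n' : N) <*> s n' else 0].

Lemma gshiftS s g n : (gshift s g)@_n.+1 = g@_n <*> s n.
Proof.
rewrite mcoeffE; case: ifPn => // /negP ng.
rewrite mcoeff_outdom ?ract0l //; apply/negP => gn; apply: ng.
by apply/imfsetP; exists n.
Qed.

Lemma gshift0 s g : (gshift s g)@_0%N = 0.
Proof. by rewrite mcoeffE if_same. Qed.

Fact gshift_linear s : linear (gshift s).
Proof.
move=> c g h; apply: GvecP => -[|n]; rewrite mcoeffD GvecZ.
  by rewrite !gshift0 ract0l addr0.
rewrite !gshiftS mcoeffD GvecZ ractDl !ractM.
by rewrite scalar_central.
Qed.

HB.instance Definition _ s :=
  GRing.isLinear.Build k Gvec Gvec _ (gshift s) (gshift_linear s).

(** The formulas of jn_x and jn_y. *)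
Definition xshift : {linear Gvec -> Gvec} :=
  gshift (fun n => E1 L (io n.+1) (io n.+1)).
Definition yshift : {linear Gvec -> Gvec} :=
  gshift (fun n => E1 L (ro n.+1) (io n.+2)).

Lemma yshiftK g : yshift (yshift g) = 0.
Proof.
apply: GvecP => -[|[|n]]; rewrite mcoeff0 ?gshift0 // gshiftS ?gshift0 ?ract0l //.
by rewrite gshiftS ractM E1_E1r ract0r.
Qed.

End Gvec.

Section G0.
Variables (k : fieldType) (B : fibAlg k) (L : fibLim k).
Local Notation x := (fx B).
Local Notation y := (fy B).

Section Object.
Variable N : lmodType L^c.

Definition gact : B -> Gvec N -> Gvec N := 
  sval (cid (@fa_act k B _ (xshift N) (yshift N) (@yshiftK k L N))).

Lemma gactP : [/\ forall a b v, gact (a + b) v = gact a v + gact b v,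
        forall a c u v, gact a (c *: u + v) = c *: gact a u + gact a v,
        forall c a v, gact (c *: a) v = c *: gact a v,
        forall a b v, gact (a * b) v = gact a (gact b v)
      & forall v, [/\ gact 1 v = v, gact x v = xshift N v & gact y v = yshift N v]].
Proof. by rewrite /gact; case: cid. Qed.

(** The type records B so that the structure of a module over B can be inferred from it. *)
Definition Gmod : Type := let _ := B in Gvec N.
HB.instance Definition _ := GRing.Zmodule.on Gmod.

Fact gactA a b (g : Gmod) : gact a (gact b g) = gact (a * b) g.
Proof. by case: gactP. Qed.
Fact gact1 : left_id 1 (gact : B -> Gmod -> Gmod).
Proof. by move=> g; case: gactP => _ _ _ _ /(_ g)[]. Qed.
Fact gactDr : right_distributive (gact : B -> Gmod -> Gmod) +%R.
Proof.
move=> a g h; case: gactP => _ /(_ a 1 g h) + _ _ _.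
by rewrite !scale1r.
Qed.
Fact gactDl (g : Gmod) : {morph (gact : B -> Gmod -> Gmod)^~ g : a b / a + b}.
Proof. by move=> a b; case: gactP. Qed.

HB.instance Definition _ := GRing.Zmodule_isLmodule.Build B Gmod
  gactA gact1 gactDr gactDl.

Implicit Types g : Gmod.

Lemma Gmod_x g : x *: g = xshift N (g : Gvec N).
Proof. by case: gactP => _ _ _ _ /(_ g)[]. Qed.

Lemma Gmod_y g : y *: g = yshift N (g : Gvec N).
Proof. by case: gactP => _ _ _ _ /(_ g)[]. Qed.

Lemma Gmod_scalar (c : k) g : (c%:A : B) *: g = gscale c g.
Proof.
have [_ _ /(_ c 1 g) h _ /(_ g)[h1 _ _]] := gactP.
by rewrite h1 in h.
Qed.

Definition gcoef n g : N := mcoeff n g.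

Fact gcoef_zmod_morphism n : zmod_morphism (gcoef n).
Proof. by move=> g h; apply: mcoeffB. Qed.

HB.instance Definition _ n :=
  GRing.isZmodMorphism.Build Gmod N (gcoef n) (gcoef_zmod_morphism n).

Lemma gcoefB n g h : gcoef n (g - h) = gcoef n g - gcoef n h.
Proof. exact: raddfB. Qed.

Lemma gcoefP g h : (forall n, gcoef n g = gcoef n h) -> g = h.
Proof. exact: GvecP. Qed.

Lemma gcoef_xS n g : gcoef n.+1 (x *: g) = gcoef n g <*> E1 L (io n.+1) (io n.+1).
Proof. by rewrite Gmod_x; apply: gshiftS. Qed.

Lemma gcoef_yS n g : gcoef n.+1 (y *: g) = gcoef n g <*> E1 L (ro n.+1) (io n.+2).
Proof. by rewrite Gmod_y; apply: gshiftS. Qed.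

Lemma gcoef_x0 g : gcoef 0 (x *: g) = 0.
Proof. by rewrite Gmod_x; apply: gshift0. Qed.

Lemma gcoef_y0 g : gcoef 0 (y *: g) = 0.
Proof. by rewrite Gmod_y; apply: gshift0. Qed.

Lemma gcoef_scalar n (c : k) g : gcoef n (c%:A *: g) = gcoef n g <*> (c%:A : L).
Proof. by rewrite Gmod_scalar; apply: gscaleE. Qed.

Definition gmon n (v : N) : Gmod := << v *g n >>.

Lemma gcoef_mon n v m : gcoef m (gmon n v) = v *+ (n == m).
Proof. exact: mcoeffU. Qed.

Fact gmon_zmod_morphism n : zmod_morphism (gmon n).
Proof.
by move=> u v; apply: gcoefP => m; rewrite raddfB /= !gcoef_mon mulrnBl.
Qed.

HB.instance Definition _ n :=
  GRing.isZmodMorphism.Build N Gmod (gmon n) (gmon_zmod_morphism n).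

Lemma gmon_sum g : exists s : seq nat, g = \sum_(n <- s) gmon n (gcoef n g).
Proof. by exists (msupp (g : Gvec N)); apply: (monalgE (g : Gvec N)). Qed.

Lemma gmon_x n v : x *: gmon n v = gmon n.+1 (v <*> E1 L (io n.+1) (io n.+1)).
Proof.
apply: gcoefP => -[|m]; first by rewrite gcoef_x0 gcoef_mon.
by rewrite gcoef_xS !gcoef_mon eqSS; case: eqP => [->|_] //; rewrite ract0l.
Qed.

Lemma gmon_y n v : y *: gmon n v = gmon n.+1 (v <*> E1 L (ro n.+1) (io n.+2)).
Proof.
apply: gcoefP => -[|m]; first by rewrite gcoef_y0 gcoef_mon.
by rewrite gcoef_yS !gcoef_mon eqSS; case: eqP => [->|_] //; rewrite ract0l.
Qed.

Definition gcomp (i : int) g : Prop := forall n, gcoef n g != 0 -> n.+1%:Z = i.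

Lemma gcomp_mon n v : gcomp n.+1%:Z (gmon n v).
Proof. by move=> m; rewrite gcoef_mon; have [->|_] := eqVneq n m; rewrite ?mulr0n ?eqxx. Qed.

Fact ggrading : is_grading gcomp.
Proof.
split.
- by move=> i n; rewrite raddf0 eqxx.
- move=> i g h gi hi n; rewrite raddfB /=.
  by have [->|/gi//] := eqVneq (gcoef n g) 0; rewrite sub0r oppr_eq0 => /hi.
- move=> g; exists [seq n.+1%:Z | n : nat <- msupp (g : Gvec N)].
  exists (fun i => if i is Posz n.+1 then gmon n (gcoef n g) else 0); split.
  + rewrite map_inj_uniq ?fset_uniq //.
    by move=> i j [].
  + move=> [[|n]|n]; [|exact: gcomp_mon|]; by move=> m; rewrite raddf0 eqxx.
  + by rewrite big_map; apply: (monalgE (g : Gvec N)).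
- move=> s u us uV u0 i is_; apply: gcoefP => n; rewrite raddf0.
  have [//|/eqP un] := eqVneq (gcoef n (u i)) 0.
  have ni : n.+1%:Z = i by apply: uV; apply/eqP.
  have := congr1 (gcoef n) u0; rewrite raddf_sum raddf0 (bigD1_seq i) //=.
  rewrite big1 ?addr0 // => j ji; apply/eqP/negPn/negP => /uV nj.
  by rewrite -nj ni eqxx in ji.
Qed.

Fact ggm_scale i j (a : B) g : ga_comp i a -> gcomp j g -> gcomp (i + j) (a *: g).
Proof.
apply: xy_graded => {i j a g}.
- by move=> i n; rewrite raddf0 eqxx.
- move=> i g h gi hi n; rewrite raddfD /=.
  by have [->|/gi//] := eqVneq (gcoef n g) 0; rewrite add0r => /hi.
- move=> i c g gi n; rewrite gcoef_scalar.
  by have [->|/gi//] := eqVneq (gcoef n g) 0; rewrite ract0l eqxx.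
- move=> i g gi [|n]; first by rewrite gcoef_x0 eqxx.
  rewrite gcoef_xS; have [->|/gi] := eqVneq (gcoef n g) 0; first by rewrite ract0l eqxx.
  by move=> <- _; lia.
- move=> i g gi [|n]; first by rewrite gcoef_y0 eqxx.
  rewrite gcoef_yS; have [->|/gi] := eqVneq (gcoef n g) 0; first by rewrite ract0l eqxx.
  by move=> <- _; lia.
Qed.

Definition G0 : grmod B := GrMod ggrading ggm_scale.

Lemma gpr_gcoef n g : gpr (M := G0) n.+1%:Z g = gmon n (gcoef n g).
Proof.
apply: (decomposition_pr ggrading (w := fun i =>
  if i is Posz n.+1 then gmon n (gcoef n g) else 0) _ n.+1%:Z).
split; first by move=> [[|m]|m]; [|exact: gcomp_mon|]; move=> l; rewrite raddf0 eqxx.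
exists [seq n.+1%:Z | n : nat <- msupp (g : Gvec N)]; split.
- by rewrite map_inj_uniq ?fset_uniq //; move=> i j [].
- move=> [[|m]|m] // mg; rewrite (_ : gcoef m g = 0) ?raddf0 //.
  apply: mcoeff_outdom; apply: contra mg => mg.
  exact: (map_f (fun n : nat => n.+1%:Z) mg).
- by rewrite big_map; apply: (monalgE (g : Gvec N)).
Qed.

End Object.

Section Morphism.
Variables (N N' : lmodType L^c) (f : {linear N -> N'}).

Definition gmap (g : Gmod N) : Gmod N' := [malg n in msupp (g : Gvec N) => f (gcoef n g)].

Lemma gmapE g n : gcoef n (gmap g) = f (gcoef n g).
Proof. by rewrite /gmap /gcoef mcoeffE; case: msuppP => // _; rewrite raddf0. Qed.

Fact gmap_zmod_morphism : zmod_morphism gmap.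
Proof. by move=> g h; apply: gcoefP => n; rewrite gmapE !gcoefB !gmapE; exact: raddfB. Qed.

HB.instance Definition _ :=
  GRing.isZmodMorphism.Build (Gmod N) (Gmod N') gmap gmap_zmod_morphism.

Fact gmap_scalable : scalable gmap.
Proof.
apply: xy_scalable => [c g|g|g]; apply: gcoefP => n.
- by rewrite gmapE !gcoef_scalar gmapE ract_map.
- by case: n => [|n]; rewrite gmapE ?gcoef_x0 ?raddf0 // !gcoef_xS gmapE ract_map.
- by case: n => [|n]; rewrite gmapE ?gcoef_y0 ?raddf0 // !gcoef_yS gmapE ract_map.
Qed.

HB.instance Definition _ :=
  GRing.isScalable.Build B (Gmod N) (Gmod N') _ gmap gmap_scalable.

Fact gmap_degree i (g : G0 N) : gm_comp i g -> gm_comp (g := G0 N') i (gmap g).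
Proof.
move=> gi n; rewrite gmapE => fn; apply: gi.
by apply: contraNneq fn => ->; rewrite raddf0.
Qed.

Definition G0map : grhom (G0 N) (G0 N') :=
  @GrHom k B (G0 N) (G0 N') (gmap : {linear Gmod N -> Gmod N'}) gmap_degree.

End Morphism.

Definition G0_functor : functor (RMod L) (Gr B).
Proof.
refine (@Functor (RMod L) (Gr B) G0 (fun N N' f => G0map f) _ _ _).
- by move=> N N' f g fg u; apply: gcoefP => n; rewrite !gmapE fg.
- by move=> N u; apply: gcoefP => n; rewrite gmapE.
- by move=> N N' N'' g f u; apply: gcoefP => n; rewrite !gmapE.
Defined.

End G0.

(** * The equivalence *)

Lemma E1_io (k : fieldType) (L : fibLim k) n (i : 'I_(fib n.+1)) :
  E1 L (io n) i = @E1 k L n.+1 (io n.+1) (lshift (fib n) i)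
    + @E1 k L n.+2 (ro n.+1) (rshift (fib n.+2) i).
Proof. by rewrite E1S E2S lshift_io. Qed.

Lemma E1E2 (k : fieldType) (L : fibLim k) n i j i' j' : @E1 k L n i j * @E2 k L n i' j' = 0.
Proof.
rewrite /E1 /E2 -rmorphM (_ : _ * _ = 0) ?raddf0 //.
by congr pair; [apply: mulmx0|apply: mul0mx].
Qed.

Section Counit.
Variables (k : fieldType) (B : fibAlg k) (L : fibLim k).
Local Notation x := (fx B).
Local Notation y := (fy B).
Local Notation G0 := (G0 B).
Local Notation Gmod N := (Gmod B N).

Section Object.
Variable N : lmodType L^c.

(** If the entries come from an element w of N they are w E_(i,0), and this is the sum of
    the w E_(i,0) E_(0,i), which is w because the diagonal matrix units have sum 1. *)
Definition rho n (v : Xn (Gmod N) n) : N :=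
  \sum_i gcoef n (v.1 0 i) <*> E1 L (io n) i
  + \sum_j gcoef n.+1 (v.2 0 j) <*> @E1 k L n.+1 (io n.+1) (rshift (fib n.+1) j).

Fact rho_zmod_morphism n : zmod_morphism (@rho n).
Proof.
move=> u v; rewrite /rho opprD addrACA -!sumrB; congr (_ + _);
  by apply: eq_bigr => i _; rewrite -ractBl -gcoefB !mxE.
Qed.

HB.instance Definition _ n :=
  GRing.isZmodMorphism.Build (Xn (Gmod N) n) N (@rho n) (@rho_zmod_morphism n).

Fact rho_tstep n (v : Xn (Gmod N) n) : rho (tstep v) = rho v.
Proof.
rewrite /rho big_split_ord /= -addrA addrC [RHS]addrC -addrA; congr (_ + _).
  by apply: eq_bigr => j _; rewrite row_mxEr.
rewrite addrC -big_split; apply: eq_bigr => i _ /=.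
rewrite row_mxEl !mxE /xmul /xymul !gcoef_xS gcoef_yS !ractM -ractDr.
rewrite !E1_id; congr (_ <*> _); apply/esym; exact: E1_io.
Qed.

Fact rho_act n (v : Xn (Gmod N) n) a : Xpr (M := G0 N) v = v ->
  rho (Xact v a) = (iot L n a : L^c) *: rho v.
Proof.
move=> _; rewrite -/(ract _ (iot L n a)) /rho ractDl !ract_suml; congr (_ + _).
  under [RHS]eq_bigr => i _ do rewrite ractM E1_mul ract_sumr.
  rewrite exchange_big; apply: eq_bigr => l _ /=.
  rewrite mxE raddf_sum ract_suml; apply: eq_bigr => i _.
  by rewrite /= gcoef_scalar ractM mulr_algl.
under [RHS]eq_bigr => i _ do rewrite ractM -iot_phi E1_mul big_split_ord ractDr
  !ract_sumr.
rewrite big_split /= [X in _ = X + _]big1 ?add0r => [|i _]; last first.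
  by rewrite big1 // => l _; rewrite block_mxEdl mxE scale0r ract0r.
rewrite exchange_big; apply: eq_bigr => l _ /=.
rewrite mxE raddf_sum ract_suml; apply: eq_bigr => i _.
by rewrite /= gcoef_scalar ractM mulr_algl block_mxEdr.
Qed.

Definition counit : {linear F0 L (G0 N) -> N} :=
  @F0_lift k B L (G0 N) N (fun n => @rho n : {additive Xn (G0 N) n -> N})
    rho_tstep rho_act.

Lemma counit_inj n (v : Xn (Gmod N) n) : Xpr (M := G0 N) v = v ->
  counit (inj L (M := G0 N) v) = rho v.
Proof. exact: F0_liftE. Qed.

Lemma rho_E1 n (v : Xn (Gmod N) n) i :
  rho v <*> E1 L i (io n) = gcoef n (v.1 0 i) <*> E1 L (io n) (io n).
Proof.
rewrite ractDl !ract_suml [X in _ + X]big1 ?addr0 => [|j _]; last first.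
  by rewrite ractM [E1 L i _]E1S mulrDr E1M eq_rlshift E1E2 addr0 ract0r.
rewrite (bigD1 i) //= big1 ?addr0 => [|i' ii]; first by rewrite ractM E1_id.
by rewrite ractM E1M (negPf ii) ract0r.
Qed.

(** The matrix units by which x and y act on degree n + 1 have the form e u with the
    idempotent e = E1 io io of level n. *)
Lemma gmon_torsion n (g : G0 N) : gm_comp n.+1%:Z g ->
  gcoef n g <*> E1 L (io n) (io n) = 0 -> torsion g.
Proof.
move=> gn; have -> : g = gmon B n (gcoef n g).
  by rewrite -gpr_gcoef /gpr pr_id.
rewrite gcoef_mon eqxx mulr1n => g0; exists 1%N => /=; rewrite gmon_x gmon_y.
have -> : E1 L (io n.+1) (io n.+1) = E1 L (io n) (io n) * E1 L (io n.+1) (io n.+1).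
  by have := E1_E1S L (io n) (io n) (io n) (io n.+1); rewrite lshift_io eqxx => ->.
have -> : E1 L (ro n.+1) (io n.+2) = E1 L (io n) (io n) * E1 L (ro n.+1) (io n.+2).
  rewrite E1_io mulrDl [X in X + _]E1_E1r add0r; apply/esym; exact: E1_id.
by rewrite -!ractM g0 !ract0l raddf0.
Qed.

(** The coordinates of an element can be read off with matrix units (rho_E1), up to parts
    that are torsion. *)
Lemma counit_injective : injective counit.
Proof.
apply: linear_inj0 => u; have [n [v [-> vp]]] := inj_surj u.
rewrite counit_inj // => v0; apply: inj_torsion => i.
  apply: (@gmon_torsion n); first exact: Xpr_homog1.
  by rewrite -rho_E1 v0 ract0l.
apply: (@gmon_torsion n.+1); first exact: Xpr_homog2.
have := rho_E1 (tstep v) (rshift (fib n.+1) i).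
by rewrite rho_tstep v0 ract0l /= row_mxEr.
Qed.

Lemma counit_surjective w : exists u, counit u = w.
Proof.
exists (inj L (M := G0 N) (Xpr (M := G0 N) (n := 0%N)
  (\row_i gmon B 0 (w <*> E1 L i (io 0)), \row_j gmon B 1 (w <*> @E1 k L 1 (rshift 1 j) (io 1))))).
rewrite counit_inj ?XprK // -[RHS](ract1 w) -(E1_sum L 0) ractDr !ract_sumr /rho.
congr (_ + _); apply: eq_bigr => i _; rewrite !mxE gpr_gcoef !gcoef_mon eqxx ractM E1_id //.
by rewrite E2S.
Qed.

End Object.

Lemma counit_natural (N N' : lmodType L^c) (f : {linear N -> N'}) (u : F0 L (G0 N)) :
  counit N' (F0map L (G0map B f) u) = f (counit N u).
Proof.
have [n [v [-> vp]]] := inj_surj u; rewrite F0map_inj !counit_inj //; last first.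
  by rewrite Xpr_map vp.
rewrite /rho raddfD !raddf_sum; congr (_ + _); apply: eq_bigr => i _;
  by rewrite mxE /= gmapE ract_map.
Qed.

End Counit.

Section Unit.
Variables (k : fieldType) (B : fibAlg k) (L : fibLim k).
Local Notation x := (fx B).
Local Notation y := (fy B).
Local Notation G0 := (G0 B).
Local Notation Gmod N := (Gmod B N).

Section Object.
Variable M : grmod B.

Definition pos_gsub : gsub M.
Proof.
refine (@GSub _ _ M (fun m => forall i : int, (i <= 0)%R -> gpr i m = 0) _ _ _ _).
- by move=> i _; rewrite raddf0.
- by move=> u v u0 v0 i i0; rewrite raddfB /= u0 // v0 // subrr.
- apply: stable_ind => [i _|u v u0 v0 i i0|c u u0 i i0|u u0 i i0|u u0 i i0].
  + by rewrite raddf0.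
  + by rewrite raddfD /= u0 // v0 // addr0.
  + by rewrite gpr_scalar u0 // scaler0.
  + by rewrite gpr_x u0 ?scaler0 //; lia.
  + by rewrite gpr_y u0 ?scaler0 //; lia.
- by move=> i u u0 j j0; rewrite /gpr pr_pr; case: eqP => // ij; rewrite -ij; apply: u0.
Defined.

(** The levels start in degree 1, so F0 sees only this part; the rest is torsion modulo it. *)
Definition pos : grmod B := gs_grmod pos_gsub.
Definition pos_incl : grhom pos M := gs_incl pos_gsub.

Lemma pos_inclE (m : pos) i : (i <= 0)%R -> gpr i (pos_incl m) = 0.
Proof. exact: (gs_incl_mem m i). Qed.

Lemma pos_incl_W : iso_mod (@Fdim k B) pos_incl.
Proof.
apply: iso_mod_FdimI => [m m0|n].
  have -> : m = 0 by exact: (gs_incl_inj (etrans m0 (esym (raddf0 pos_incl)))).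
  exact: torsion0.
have [D DP] := pr_bound (gm_grading M) n; exists D.+1.
suff h : forall (d : nat) (m : M), (forall i : int, (i <= - d%:Z)%R -> gpr i m = 0) ->
    killed (gim pos_incl) d m.
  by apply: h => i iD; apply/eqP/negPn/negP => /DP; lia.
elim=> [|d IHd] m md; first exact: (@gs_incl_surj _ _ _ pos_gsub).
split; apply: IHd => i id_; rewrite ?gpr_x ?gpr_y md ?scaler0 //; lia.
Qed.

(** The sum is finite since jn n m depends on the component of degree n + 1 only. *)
Fact Jfun_exists (m : M) : exists g : Gmod (F0 L M), forall n, gcoef n g = jn L n m.
Proof.
have [D DP] := pr_bound (gm_grading M) m.
exists (\sum_(n < D.+1) gmon B n (jn L n m)) => n.
rewrite raddf_sum /=; under eq_bigr do rewrite gcoef_mon.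
have [nD|Dn] := ltnP n D.+1.
  rewrite (bigD1 (Ordinal nD)) //= eqxx big1 ?addr0 // => i ii.
  by rewrite (_ : (val i == n) = false) //; apply/negbTE; apply: contraNneq ii => e;
    apply/eqP/val_inj.
rewrite big1 => [|i _]; last by rewrite ltn_eqF // (leq_trans (ltn_ord i)).
rewrite -jn_gpr (_ : gpr _ m = 0) ?raddf0 //.
by apply/eqP/negPn/negP => /DP; lia.
Qed.

Definition Jfun (m : pos) : G0 (F0 L M) := sval (cid (Jfun_exists (pos_incl m))).

Lemma JfunE (m : pos) n : gcoef n (Jfun m) = jn L n (pos_incl m).
Proof. by rewrite /Jfun; case: cid. Qed.

Fact Jfun_zmod_morphism : zmod_morphism Jfun.
Proof. by move=> u v; apply: gcoefP => n; rewrite gcoefB !JfunE !raddfB. Qed.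

HB.instance Definition _ :=
  GRing.isZmodMorphism.Build pos (G0 (F0 L M)) Jfun Jfun_zmod_morphism.

Lemma jn0_shift (m : pos) b : ga_comp 1 b -> jn L 0 (b *: pos_incl m) = 0.
Proof.
move=> b1; rewrite -jn_gpr (gpr_scale _ _ b1) (gs_incl_mem m) ?scaler0 ?raddf0 //.
Qed.

Fact Jfun_scalable : scalable Jfun.
Proof.
apply: xy_scalable => [c m|m|m]; apply: gcoefP => n.
- by rewrite gcoef_scalar !JfunE linearZ_LR jn_scalar.
- rewrite JfunE linearZ_LR; case: n => [|n].
    by rewrite gcoef_x0 jn0_shift //; apply: fx_deg.
  by rewrite gcoef_xS JfunE jn_x.
- rewrite JfunE linearZ_LR; case: n => [|n].
    by rewrite gcoef_y0 jn0_shift //; apply: fy_deg.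
  by rewrite gcoef_yS JfunE jn_y.
Qed.

HB.instance Definition _ :=
  GRing.isScalable.Build B pos (Gmod (F0 L M)) _ Jfun Jfun_scalable.

Fact Jfun_degree i (m : pos) : gm_comp i m -> gm_comp (g := G0 (F0 L M)) i (Jfun m).
Proof.
move=> mi n; rewrite JfunE -jn_gpr /gpr.
rewrite (pr_of_homog _ (gh_degree pos_incl mi)).
have [//|_] := eqVneq n.+1%:Z i.
by rewrite raddf0 eqxx.
Qed.

(** The comparison of M with the graded module built from F0 M. *)
Definition Jmap : grhom pos (G0 (F0 L M)) :=
  @GrHom k B pos (G0 (F0 L M)) (Jfun : {linear pos -> Gmod (F0 L M)}) Jfun_degree.

Lemma torsion_inj (V V' : lmodType B) (f : {linear V -> V'}) (v : V) :
  injective f -> torsion (f v) -> torsion v.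
Proof.
move=> fI [n nv]; exists n; move/killed_map: nv; apply: killed_impl => u u0.
by apply: fI; rewrite u0 raddf0.
Qed.

(** The components of an element of the kernel are torsion by jn_eq0. *)
Lemma Jmap_ker (m : pos) : Jmap m = 0 -> torsion m.
Proof.
move=> Jm; apply: (@torsion_inj _ _ pos_incl); first exact: gs_incl_inj.
have [s [_ _ ->]] := gpr_sum (pos_incl m).
apply: torsion_sum => i _.
have [i0|i0] := boolP (i <= 0)%R; first by rewrite pos_inclE //; apply: torsion0.
have [n ->] : exists n : nat, i = n.+1%:Z by exists (absz i).-1; lia.
apply: (@jn_eq0 _ _ L _ n); first exact: gpr_homog.
by rewrite jn_gpr -JfunE Jm raddf0.
Qed.

Lemma gmon_jn n (m : M) : gim Jmap (gmon B n (jn L n m)).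
Proof.
have [u uE] : exists u : pos, pos_incl u = gpr n.+1%:Z m.
  apply: gs_incl_surj => i i0; rewrite /gpr pr_pr.
  by have -> : (i == n.+1%:Z) = false by lia.
exists u; apply: gcoefP => l; rewrite JfunE uE gcoef_mon.
case: eqP => [<-|/eqP nl]; first by rewrite jn_gpr.
rewrite -jn_gpr /gpr pr_pr.
have -> : (l.+1%:Z == n.+1%:Z) = false by lia.
exact: raddf0.
Qed.

(** Each letter raises the index n but not the level l of the coefficient; once the index
    has passed the level, the coefficient is an element jn, which comes from M. *)
Lemma killed_gmon d n l (v : Xn M l) : l = (d + n.+1)%N ->
  killed (gim Jmap) d.+2 (gmon B n (inj L v)).
Proof.
elim: d n l v => [|d IHd] n l v lE.
  rewrite add0n in lE; subst l; split; rewrite ?gmon_x ?gmon_y.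
    rewrite inj_E1; apply: (@killed_stable _ _ _ _ 1) (gmon_jn _ _) => w; exact: gsZ.
  rewrite -inj_tstep inj_E1; split; rewrite ?gmon_x ?gmon_y.
    by rewrite jn_E1; apply: gmon_jn.
  by rewrite -jn_E1 ractM E1_E1r ract0r raddf0; apply: gs0.
have h (s : nat) (a : Sn k s) : (s <= l)%N -> exists v' : Xn M l,
    inj L v <*> iot L s a = inj L v'.
  by move=> sl; have [b <-] := iot_le L a sl; exists (Xact v b); rewrite ract_inj.
split; rewrite ?gmon_x ?gmon_y.
  have [|v' ->] := @h n.+1 (delta_mx (io n.+1) (io n.+1), 0); first by lia.
  by apply: IHd; lia.
have [|v' ->] := @h n.+2 (delta_mx (ro n.+1) (io n.+2), 0); first by lia.
by apply: IHd; lia.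
Qed.

Lemma Jmap_coker (g : G0 (F0 L M)) : exists a, killed (gim Jmap) a g.
Proof.
have [s ->] := gmon_sum g.
apply: (big_ind (fun g : G0 (F0 L M) => exists a, killed (gim Jmap) a g))
  => [|u v [a ua] [b vb]|n _].
- by exists 0%N; apply: gs0.
- exists (maxn a b); apply: killedD; first exact: gsD.
    by apply: killed_le (leq_maxl _ _) ua => w; apply: gsZ.
  by apply: killed_le (leq_maxr _ _) vb => w; apply: gsZ.
- have [N NP] := inj_surj_at (gcoef n g).
  have [v [-> _]] := NP (N + n.+1)%N (leq_addr _ _).
  by exists N.+2; apply: killed_gmon.
Qed.

Lemma Jmap_W : iso_mod (@Fdim k B) Jmap.
Proof. exact: iso_mod_FdimI Jmap_ker Jmap_coker. Qed.

End Object.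

Lemma pos_map_exists (M M' : grmod B) (f : grhom M M') :
  exists g : grhom (pos M) (pos M'), forall m, pos_incl M' (g m) = f (pos_incl M m).
Proof.
apply: (gs_lift (K := pos_gsub M') (f := grhom_comp f (pos_incl M))) => m i i0.
by rewrite (gpr_hom f) pos_inclE // raddf0.
Qed.

Lemma Jmap_natural (M M' : grmod B) (f : grhom M M') (g : grhom (pos M) (pos M')) :
  (forall m, pos_incl M' (g m) = f (pos_incl M m)) ->
  forall m, G0map B (F0map L f) (Jmap M m) = Jmap M' (g m).
Proof.
move=> gE m; apply: gcoefP => n; rewrite gmapE !JfunE gE; exact: F0map_jn.
Qed.

End Unit.

Section QGrEquivalence.
Variables (k : fieldType) (B : fibAlg k) (L : fibLim k).

Lemma F0_inverts (M N : Gr B) (f : hom M N) :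
  iso_mod (@Fdim k B) f -> invertible (fmap (F0_functor B L) f).
Proof.
move=> fW; apply: Mod_invertible.
  exact: F0map_injective (iso_mod_Fdim_ker fW).
exact: F0map_surjective (iso_mod_Fdim_coker fW).
Qed.

Definition FQ : functor (QGr B) (RMod L) := loc_lift F0_inverts.
Definition GQ : functor (RMod L) (QGr B) :=
  functor_comp (loc_functor (C := Gr B) (iso_mod (@Fdim k B))) (G0_functor B L).

Lemma FG_nat_iso : nat_iso (functor_comp FQ GQ) (functor_id (RMod L)).
Proof.
have cI (N : RMod L) : invertible (C := RMod L) (counit B N).
  by apply: Mod_invertible; [apply: counit_injective|apply: counit_surjective].
exists (fun N => counit B N), (fun N => sval (cid (cI N))); split.
- by move=> N; case: cid => g [].
- by move=> N; case: cid => g [].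
- by move=> N N' f u; apply: counit_natural.
Qed.

Lemma GF_nat_iso : nat_iso (functor_comp GQ FQ) (functor_id (QGr B)).
Proof.
pose W : forall x y : Gr B, hom x y -> Prop := iso_mod (@Fdim k B).
pose a (M : QGr B) : hom (functor_comp GQ FQ M) M :=
  @cmp (QGr B) _ (pos M) _ (Loc W (pos_incl M)) (@LocInv (Gr B) W _ _ (Jmap L M) (Jmap_W L M)).
pose b (M : QGr B) : hom M (functor_comp GQ FQ M) :=
  @cmp (QGr B) _ (pos M) _ (Loc W (Jmap L M)) (@LocInv (Gr B) W _ _ (pos_incl M) (pos_incl_W M)).
have iI (M : grmod B) :=
  @invertible_Loc (Gr B) W _ _ (pos_incl M) (pos_incl_W M).
have jI (M : grmod B) :=
  @invertible_Loc (Gr B) W _ _ (Jmap L M) (Jmap_W L M).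
have aJ (M : grmod B) : heq (cmp (a M) (Loc W (Jmap L M))) (Loc W (pos_incl M) : @hom (QGr B) _ _).
  rewrite /a; apply: heq_trans (heq_sym (cmpA _ _ _)) _.
  apply: heq_trans (cmp_congr_l _ _) (cmpm1 _); exact: loc_VK.
have bi (M : grmod B) : heq (cmp (b M) (Loc W (pos_incl M))) (Loc W (Jmap L M) : @hom (QGr B) _ _).
  rewrite /b; apply: heq_trans (heq_sym (cmpA _ _ _)) _.
  apply: heq_trans (cmp_congr_l _ _) (cmpm1 _); exact: loc_VK.
exists a, b; split.
- move=> M; apply: (invertible_epi (jI M)).
  apply: heq_trans (heq_sym (cmpA _ _ _)) _.
  apply: heq_trans (cmp_congr_l _ (aJ M)) _.
  exact: heq_trans (bi M) (heq_sym (cmp1m _)).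
- move=> M; apply: (invertible_epi (iI M)).
  apply: heq_trans (heq_sym (cmpA _ _ _)) _.
  apply: heq_trans (cmp_congr_l _ (bi M)) _.
  exact: heq_trans (aJ M) (heq_sym (cmp1m _)).
- apply: loc_natural => M M' f; apply: (invertible_epi (jI M)).
  have [g gE] := pos_map_exists f.
  apply: heq_trans (heq_sym (cmpA _ _ _)) _.
  refine (@heq_trans (QGr B) _ _ _ (@cmp (QGr B) _ _ _ (a M')
    (@cmp (QGr B) _ _ _ (Loc W (Jmap L M')) (Loc W g))) _ _ _).
    apply: cmp_congr_l.
    refine (loc_trans (loc_sym (@loc_cmp (Gr B) W _ _ _ (G0map B (F0map L f)) (Jmap L M))) _).
    refine (loc_trans _ (@loc_cmp (Gr B) W _ _ _ (Jmap L M') g)).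
    by apply: (@loc_heq (Gr B) W) => m; apply: Jmap_natural.
  apply: heq_trans (cmpA _ _ _) _; apply: heq_trans (cmp_congr_r _ (aJ M')) _.
  apply: heq_sym; apply: heq_trans (heq_sym (cmpA _ _ _)) _.
  apply: heq_trans (cmp_congr_l _ (aJ M)) _.
  refine (loc_trans (loc_sym (@loc_cmp (Gr B) W _ _ _ f (pos_incl M))) _).
  refine (loc_trans _ (@loc_cmp (Gr B) W _ _ _ (pos_incl M') g)).
  by apply: (@loc_heq (Gr B) W) => m; apply/esym/gE.
Qed.

Lemma FQ_equivalence : is_equivalence FQ.
Proof. by exists GQ; split; [apply: GF_nat_iso|apply: FG_nat_iso]. Qed.

End QGrEquivalence.

(** * Free graded modules *)

Section RowLinear.
Variables (A : pzRingType) (V : lmodType A) (r : nat).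
Implicit Types m : 'I_r -> V.

Definition row_lin m (u : 'rV[A]_r) : V := \sum_l u 0 l *: m l.

Fact row_lin_linear m : linear (row_lin m).
Proof.
move=> a u v; rewrite /row_lin scaler_sumr -big_split; apply: eq_bigr => l _ /=.
by rewrite !mxE scalerDl scalerA.
Qed.

HB.instance Definition _ m :=
  GRing.isLinear.Build A 'rV[A]_r V _ (row_lin m) (row_lin_linear m).

Lemma row_lin_delta m l : row_lin m (delta_mx 0 l) = m l.
Proof.
rewrite /row_lin (bigD1 l) //= big1 => [|l' l'l].
  by rewrite addr0 mxE !eqxx scale1r.
by rewrite mxE eqxx (negPf l'l) scale0r.
Qed.

Lemma row_linE (f : {linear 'rV[A]_r -> V}) u :
  f u = \sum_l u 0 l *: f (delta_mx 0 l).
Proof.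
rewrite {1}[u]row_sum_delta linear_sum.
by apply: eq_bigr => l _; rewrite linearZ_LR.
Qed.

End RowLinear.

Section FreeModules.
Variables (k : fieldType) (B : fibAlg k).
Local Notation x := (fx B).
Local Notation y := (fy B).

Section Shifted.
Variables (r : nat) (d : 'I_r -> int).

Definition pd_comp (i : int) (u : 'rV[B]_r) : Prop := forall l, ga_comp (i - d l) (u 0 l).

Fact pd_grading : is_grading pd_comp.
Proof.
have gr := ga_grading B; split.
- by move=> i l; rewrite mxE; apply: grading0 gr _.
- by move=> i u v ui vi l; rewrite !mxE; apply: gradingB.
- move=> u; pose w i : 'rV[B]_r := \row_l pr gr (i - d l) (u 0 l).
  have /choice[s sP] l := pr_sum gr (u 0 l).
  pose S := undup (flatten [seq [seq i + d l | i <- s l] | l <- enum 'I_r]).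
  exists S, w; split; first exact: undup_uniq.
    by move=> i l; rewrite mxE; apply: pr_homog.
  apply/rowP => l; rewrite summxE; under eq_bigr do rewrite mxE.
  have [sU s0 sE] := sP l; rewrite {1}sE.
  rewrite (@big_widen _ [seq i + d l | i <- s l] S (fun i => pr gr (i - d l) (u 0 l))).
  + by rewrite big_map; apply: eq_bigr => i _; rewrite addrK.
  + by rewrite map_inj_uniq //; apply: addIr.
  + exact: undup_uniq.
  + move=> i is_; rewrite mem_undup; apply/flatten_mapP; exists l => //.
    by rewrite mem_enum.
  + move=> i is_; apply: s0; apply: contra is_ => is_.
    by apply/mapP; exists (i - d l); rewrite ?subrK.
- move=> s u us uV u0 i is_; apply/rowP => l; rewrite mxE.
  have [_ _ _] := gr.
  move=> /(_ [seq i - d l | i <- s] (fun j => u (j + d l) 0 l)) h.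
  have -> : u i 0 l = u (i - d l + d l) 0 l by rewrite subrK.
  apply: h.
  + by rewrite map_inj_uniq //; apply: addIr.
  + by move=> j; have := uV (j + d l) l; rewrite addrK.
  + rewrite big_map; under eq_bigr do rewrite subrK.
    by have := congr1 (fun u : 'rV_r => u 0 l) u0; rewrite summxE mxE.
  + exact: (map_f (fun i => i - d l)).
Qed.

Fact pd_gm_scale i j (a : B) (u : 'rV[B]_r) :
  ga_comp i a -> pd_comp j u -> pd_comp (i + j) (a *: u).
Proof. by move=> ai uj l; rewrite mxE -addrA; apply: ga_mul. Qed.

Definition Pd : grmod B := GrMod pd_grading pd_gm_scale.

Definition pe (l : 'I_r) : Pd := (delta_mx 0 l : 'rV[B]_r).

Lemma pe_homog l : gm_comp (d l) (pe l).
Proof.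
move=> l'; rewrite mxE eqxx /=; case: eqP => [->|_].
  by rewrite subrr; apply: ga_one.
exact: grading0 (ga_grading B) _.
Qed.

Lemma Pd_sum (u : Pd) : u = \sum_l (u : 'rV[B]_r) 0 l *: pe l.
Proof. exact: row_sum_delta. Qed.

Lemma Pd_free (b : 'I_r -> B) : \sum_l b l *: pe l = 0 -> forall l, b l = 0.
Proof.
move=> b0 l; have := congr1 (fun u : 'rV[B]_r => u 0 l) b0.
rewrite (summxE _ _ (fun l => b l *: (pe l : 'rV[B]_r))) mxE (bigD1 l) //= big1.
  by rewrite addr0 !mxE !eqxx mulr1.
by move=> l' l'l; rewrite !mxE eqxx eq_sym (negPf l'l) mulr0.
Qed.

Lemma Pd_finitely_presented : finitely_presented (Pd : lmodType B).
Proof.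
exists r, 0%N, (\0 : {linear 'rV[B]_0 -> 'rV[B]_r}), (idfun : {linear 'rV[B]_r -> Pd}).
split; last by move=> u; exists u.
by move=> u /=; split=> [->|[_ <-]] //; exists 0.
Qed.

Section Hom.
Variables (M : grmod B) (m : 'I_r -> M).
Hypothesis mh : forall l, gm_comp (d l) (m l).

Fact pd_fun_degree i (u : Pd) : gm_comp i u -> gm_comp i (row_lin m u).
Proof.
move=> ui; apply: (grading_sum (gm_grading M)) => l _.
by have := gm_scale (ui l) (mh l); rewrite subrK.
Qed.

Definition pd_hom : grhom Pd M :=
  @GrHom k B Pd M (row_lin m : {linear 'rV[B]_r -> M}) pd_fun_degree.

Lemma pd_homE l : pd_hom (pe l) = m l.
Proof. exact: row_lin_delta. Qed.

End Hom.

Lemma pd_hom_eq (M : lmodType B) (f g : {linear Pd -> M}) :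
  (forall l, f (pe l) = g (pe l)) -> f =1 g.
Proof.
move=> fg u; rewrite [LHS](row_linE f) [RHS](row_linE g).
by apply: eq_bigr => l _; congr (_ *: _); apply: fg.
Qed.

End Shifted.

(** ** Multiplication by x is injective on free modules *)

Lemma fx_inj (b : B) : x * b = 0 -> b = 0.
Proof. by move=> b0; have [] := @fxy_inj _ B b 0; rewrite ?mulr0 ?addr0. Qed.

Lemma fy_ker (b : B) : y * b = 0 -> exists c, b = y * c.
Proof. by move=> b0; have [] := @fxy_inj _ B 0 b; rewrite ?mulr0 ?add0r. Qed.

Lemma killed_x (V : lmodType B) n (v : V) :
  (forall v : V, x *: v = 0 -> v = 0) -> killed (fun u => u = 0) n v -> v = 0.
Proof. by move=> xI; elim: n v => [//|n IHn] v [/IHn /xI]. Qed.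

Definition freely (M : lmodType B) r (g : 'I_r -> M) : Prop :=
  (forall m, exists b : 'I_r -> B, m = \sum_l b l *: g l) /\
  (forall b : 'I_r -> B, \sum_l b l *: g l = 0 -> forall l, b l = 0).

Lemma Pd_freely r (d : 'I_r -> int) : freely (@pe r d).
Proof.
split; last exact: Pd_free.
by move=> u; exists (fun l => (u : 'rV[B]_r) 0 l); apply: Pd_sum.
Qed.

Lemma structure_freely : freely (M := B^o) (fun _ : 'I_1 => 1 : B^o).
Proof.
split=> [b|b b0 l]; first by exists (fun _ => b); rewrite big_ord1 /GRing.scale /= mulr1.
by move: b0; rewrite big_ord1 /GRing.scale /= mulr1 (ord1 l).
Qed.

(** A torsion element is killed by a power of x, which is injective on a free module. *)
Lemma freely_torsion (M : lmodType B) r (g : 'I_r -> M) : freely g ->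
  forall m : M, torsion m -> m = 0.
Proof.
move=> [gs gf] m [n]; apply: killed_x => u; have [b ->] := gs u.
rewrite scaler_sumr; under eq_bigr do rewrite scalerA.
move=> /gf b0; rewrite big1 // => l _; by rewrite (fx_inj (b0 l)) scale0r.
Qed.

(** ** Words in x and x y *)

Lemma ga_neg (b : B) i : (i < 0)%R -> pr (ga_grading B) i b = 0.
Proof.
elim/fa_ind: b i => [a b IHa IHb|c a IHa||a IHa|a IHa] i i0.
- by rewrite raddfD /= IHa // IHb // addr0.
- by rewrite ga_pr_scale IHa // scaler0.
- rewrite (pr_of_homog _ (ga_one B)); by case: eqP => // i00; rewrite i00 in i0.
- by rewrite (ga_pr_mul _ _ (fx_deg B)) IHa ?mulr0 //; lia.
- by rewrite (ga_pr_mul _ _ (fy_deg B)) IHa ?mulr0 //; lia.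
Qed.

(** The row of level n that represents the generator 1. Its entries are words with the
    syllables x and x y, of length n + 1 in the first block and n + 2 in the second. *)
Fixpoint bseq n : Xn (structure_module B) n :=
  if n is n'.+1 then tstep (bseq n')
  else (const_mx (x : B^o), const_mx (x * y : B^o)).

Lemma bseq_homog n : Xpr (bseq n) = bseq n.
Proof.
elim: n => [|n IHn]; last by rewrite /= Xpr_tstep IHn.
congr pair; apply/rowP => i; rewrite !mxE; apply: pr_id; first exact: fx_deg.
exact: (ga_mul (fx_deg B) (fy_deg B)).
Qed.

(** Distinct words without y y are independent in B. Along tstep the words get a new
    syllable in front, which can be cancelled because x is injective and y b = 0 only for b
    in y B; the words themselves start with x, so their combinations meet y B in 0. *)
Lemma bseq_independent n :
  [/\ forall i, exists b, (bseq n).1 0 i = x * b,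
      forall j, exists b, (bseq n).2 0 j = x * (y * b),
      forall c : 'I_(fib n.+1) -> k, \sum_i (c i)%:A * ((bseq n).1 0 i : B) = 0 ->
        forall i, c i = 0
    & forall c : 'I_(fib n) -> k, \sum_i (c i)%:A * ((bseq n).2 0 i : B) = 0 ->
        forall i, c i = 0].
Proof.
have A0 (c : k) : (c%:A : B) = 0 -> c = 0.
  by move/eqP; rewrite scaler_eq0 oner_eq0 orbF => /eqP.
have AC (c : k) (a b : B) : c%:A * (a * b) = a * (c%:A * b).
  by rewrite !mulr_algl scalerAr.
have sumx (I : finType) (c : I -> k) (a : B) (u b : I -> B) :
    (forall i, u i = a * b i) -> \sum_i (c i)%:A * u i = a * \sum_i (c i)%:A * b i.
  by move=> ub; rewrite mulr_sumr; apply: eq_bigr => i _; rewrite ub AC.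
elim: n => [|n [/choice[b bP] /choice[d dP] f1 f2]].
  have e1 i : (bseq 0).1 0 i = x * 1 by rewrite mxE mulr1.
  have e2 j : (bseq 0).2 0 j = x * (y * 1) by rewrite mxE mulr1.
  split=> [i|j|c|c]; [by exists 1|by exists 1| |].
    rewrite (sumx _ _ _ _ _ e1) big_ord1 mulr1 => /fx_inj/A0 c0 i.
    by rewrite (ord1 i).
  rewrite (sumx _ _ _ _ _ e2) big_ord1 AC mulr1 => /fx_inj.
  move=> /fy_ker[e ce] i; rewrite (ord1 i); apply: A0; rewrite ce.
  have := ga_comp_scalar B (c ord0); rewrite ce => /(pr_id (ga_grading B)) <-.
  by rewrite (ga_pr_mul _ _ (fy_deg B)) ga_neg ?mulr0.
pose S1 (c : 'I_(fib n.+1) -> k) := \sum_i (c i)%:A * ((bseq n).1 0 i : B).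
have S1x c : S1 c = x * \sum_i (c i)%:A * b i by apply: sumx bP.
have S1y c e : S1 c + y * e = 0 -> (forall i, c i = 0) /\ y * e = 0.
  rewrite S1x => h; have [h0 _] := fxy_inj h.
  have S0 : S1 c = 0 by rewrite S1x h0 mulr0.
  by split; [apply: f1|rewrite -h h0 mulr0 add0r].
have E1 i : (bseq n.+1).1 0 (lshift (fib n) i) = x * (bseq n).1 0 i.
  by rewrite /= row_mxEl mxE.
have E2 j : (bseq n.+1).1 0 (rshift (fib n.+1) j) = x * (y * d j).
  by rewrite /= row_mxEr dP.
have E3 j : (bseq n.+1).2 0 j = x * (y * (bseq n).1 0 j) by rewrite /= mxE.
split=> [i|j|c|c].
- case: (split_ordP i) => i' ->; first by rewrite E1; exists ((bseq n).1 0 i').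
  by rewrite E2; exists (y * d i').
- by rewrite E3; exists ((bseq n).1 0 j).
- rewrite big_split_ord /= (sumx _ _ _ _ _ E1) (sumx _ _ _ _ _ E2) -mulrDr.
  rewrite (sumx _ _ y _ d (fun j => erefl)) => /fx_inj /S1y[c1 c2] i.
  case: (split_ordP i) => i' -> //.
  apply: (f2 (fun j => c (rshift (fib n.+1) j))).
  by rewrite (sumx _ _ _ _ _ dP) (sumx _ _ y _ d (fun j => erefl)) c2 mulr0.
- rewrite (sumx _ _ _ _ _ E3) (sumx _ _ y _ _ (fun j => erefl)) => /fx_inj/fy_ker[e he].
  have := S1y c (- e); rewrite /S1 he mulrN subrr => /(_ erefl)[] //.
Qed.

End FreeModules.

Lemma scale_ract (A : pzRingType) (N : lmodType A^c) (a : A^c) (v : N) :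
  a *: v = ract v (a : A).
Proof. by []. Qed.

Section DegreeZero.
Variables (k : fieldType) (B : fibAlg k) (L : fibLim k) (M : grmod B).
Local Notation x := (fx B).
Local Notation y := (fy B).
Implicit Types m : M.

Definition Xhat m : Xn M 0 := (const_mx (x *: m), const_mx (x *: (y *: m))).

(** An element of degree 0 lies one degree below level 0, and enters it by a trade. *)
Definition hat m : F0 L M := inj L (Xhat m).

Fact hat_zmod_morphism : zmod_morphism hat.
Proof.
move=> u v; rewrite /hat -raddfB; congr inj; congr pair;
  by apply/rowP => i; rewrite !mxE ?scalerBr.
Qed.

HB.instance Definition _ := GRing.isZmodMorphism.Build M (F0 L M) hat hat_zmod_morphism.

Lemma hat_E1 m : hat m <*> E1 L (io 0) (io 0) = jn L 0 (x *: m).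
Proof. by rewrite inj_E1 mxE. Qed.

Lemma hat_ro m : hat m <*> E1 L (ro 0) (io 1) = jn L 0 (y *: m).
Proof. by rewrite inj_E1r mxE [RHS]jn_yker ?yyv. Qed.

Lemma hat_scalar m (c : k) : hat (c%:A *: m) = hat m <*> c%:A.
Proof.
have -> : (c%:A : L) = iot L 0 (c%:A) by rewrite linearZ_LR rmorph1.
rewrite ract_inj; congr inj; congr pair; apply/rowP => i;
  rewrite !mxE big_ord1 !mxE !ord1 eqxx mulr1n mulr1 //.
  by rewrite scalar_comm.
by rewrite !scalar_comm.
Qed.

Lemma hat_power m n : jn L n (iter n.+1 (fun u => x *: u) m) = hat m <*> E1 L (io n) (io n).
Proof.
elim: n => [|n IHn]; first by rewrite hat_E1.
rewrite iterS jn_x IHn ractM.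
by have := E1_E1S L (io n) (io n) (io n) (io n.+1); rewrite lshift_io eqxx => ->.
Qed.

(** By jn_x and jn_y multiplication by x and y stays within the submodule; the step from
    degree 0 to degree 1 is covered by hat_E1 and hat_ro. *)
Lemma generated_multiples (I : F0 L M -> Prop) m :
  (forall u v, I u -> I v -> I (u + v)) -> (forall u s, I u -> I (u <*> s)) ->
  (forall i : int, (i < 0)%R -> gpr i m = 0) -> I (hat (gpr 0 m)) ->
  (forall n, I (jn L n m)) -> forall (b : B) n, I (jn L n (b *: m)).
Proof.
move=> ID Is m0 mh mj b.
suff : [/\ forall i : int, (i < 0)%R -> gpr i (b *: m) = 0,
  I (hat (gpr 0 (b *: m))) & forall n, I (jn L n (b *: m))] by case.
elim/fa_ind: b => [a b [a1 a2 a3] [b1 b2 b3]|c a [a1 a2 a3]||a [a1 a2 a3]|a [a1 a2 a3]].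
- split=> [i i0||n]; rewrite scalerDl raddfD /=.
  + by rewrite a1 // b1 // addr0.
  + by rewrite raddfD; apply: (ID).
  + exact: (ID).
- rewrite -[c *: a]mulr_algl -scalerA; split=> [i i0||n].
  + by rewrite gpr_scalar a1 ?scaler0.
  + by rewrite gpr_scalar hat_scalar; apply: (Is).
  + by rewrite jn_scalar; apply: (Is).
- by rewrite scale1r.
- rewrite -scalerA; split=> [i i0||[|n]].
  + by rewrite gpr_x a1 ?scaler0 //; lia.
  + by rewrite gpr_x a1 ?scaler0 // raddf0 -(ract0r (hat (gpr 0 (a *: m)))); apply: (Is).
  + by rewrite -jn_gpr gpr_x -hat_E1; apply: (Is).
  + by rewrite jn_x; apply: (Is).
- rewrite -scalerA; split=> [i i0||[|n]].
  + by rewrite gpr_y a1 ?scaler0 //; lia.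
  + by rewrite gpr_y a1 ?scaler0 // raddf0 -(ract0r (hat (gpr 0 (a *: m)))); apply: (Is).
  + by rewrite -jn_gpr gpr_y -hat_ro; apply: (Is).
  + by rewrite jn_y; apply: (Is).
Qed.

Lemma generated_homog (I : F0 L M -> Prop) m d :
  (forall u v, I u -> I v -> I (u + v)) -> (forall u s, I u -> I (u <*> s)) ->
  gm_comp d.+1%:Z m -> I (jn L d m) -> forall (b : B) n, I (jn L n (b *: m)).
Proof.
move=> ID Is md mj.
have I0 : I 0 by rewrite -(ract0r (jn L d m)); apply: (Is).
have m0 i : i != d.+1%:Z -> gpr i m = 0.
  by rewrite /gpr (pr_of_homog _ md) => /negPf->.
apply: generated_multiples => // [i i0||n]; rewrite ?m0 ?raddf0 //; try lia.
have [->//|nd] := eqVneq n d.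
by rewrite -jn_gpr m0 ?raddf0.
Qed.

(** ** Free modules on generators of degree 0 *)

Section Basis.
Variables (r : nat) (g : 'I_r -> M).
Hypothesis gh : forall l, gm_comp 0 (g l).
Hypothesis gfree : freely g.

Fact rmult_linear l : linear (fun b : structure_module B => (b : B) *: g l).
Proof. by move=> a u v; rewrite scalerDl scalerA. Qed.

Definition rmult l : structure_module B -> M := fun b => (b : B) *: g l.

HB.instance Definition _ l :=
  GRing.isLinear.Build B (structure_module B) M _ (rmult l) (rmult_linear l).

Fact rmult_degree l i (b : structure_module B) : gm_comp i b -> gm_comp i (rmult l b).
Proof. by move=> bi; have := gm_scale bi (gh l); rewrite addr0. Qed.

Definition rmult_hom l : grhom (structure_module B) M :=
  @GrHom k B (structure_module B) M (rmult l : {linear structure_module B -> M})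
    (@rmult_degree l).

Lemma hat_bseq l n : hat (g l) = inj L (Xmap (rmult l) (bseq B n)).
Proof.
elim: n => [|n ->]; last by rewrite /= Xmap_tstep inj_tstep.
by congr inj; congr pair; apply/rowP => i; rewrite !mxE /rmult ?scalerA.
Qed.

Definition hat_sum : {linear 'rV[L^c]_r -> F0 L M} := row_lin (fun l => hat (g l)).

Lemma common_level (I : finType) (s : I -> L) : exists n (a : I -> Sn k n),
  forall i, s i = iot L n (a i).
Proof.
have /choice[N NP] i := rep_ev (s i).
exists (\max_i N i)%N, (fun i => rep (s i) _) => i.
by rewrite NP // (leq_bigmax (F := N)).
Qed.

(** At a level n that contains all coefficients the image is the row of the combinations of
    words bseq with these coefficients as matrices, and the words are independent. *)
Lemma hat_sum_injective : injective hat_sum.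
Proof.
apply: linear_inj0 => s.
have [n [a aP]] := common_level (fun l => s 0 l : L).
pose v : Xn M n := \sum_l Xact (Xmap (rmult l) (bseq B n)) (a l).
have sE : hat_sum s = inj L v.
  rewrite /v raddf_sum; apply: eq_bigr => l _.
  by rewrite -[LHS]/(hat (g l) <*> (s 0 l : L)) aP (hat_bseq l n) ract_inj.
have vp : Xpr v = v.
  rewrite /v raddf_sum; apply: eq_bigr => l _ /=; rewrite Xpr_act.
  by rewrite (Xpr_map (rmult_hom l)) bseq_homog.
have v1E i' : v.1 0 i' = \sum_l (\sum_i ((a l).1 i i')%:A * ((bseq B n).1 0 i : B)) *: g l.
  rewrite (_ : v.1 = \sum_l (Xact (Xmap (rmult l) (bseq B n)) (a l)).1); last first.
    exact: (big_morph (fun v : Xn M n => v.1)).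
  rewrite summxE; apply: eq_bigr => l _; rewrite mxE scaler_suml.
  by apply: eq_bigr => i _; rewrite mxE /rmult scalerA.
have v2E i' : v.2 0 i' = \sum_l (\sum_i ((a l).2 i i')%:A * ((bseq B n).2 0 i : B)) *: g l.
  rewrite (_ : v.2 = \sum_l (Xact (Xmap (rmult l) (bseq B n)) (a l)).2); last first.
    exact: (big_morph (fun v : Xn M n => v.2)).
  rewrite summxE; apply: eq_bigr => l _; rewrite mxE scaler_suml.
  by apply: eq_bigr => i _; rewrite mxE /rmult scalerA.
move=> s0; have [v1 v2] := inj_eq0 (etrans (esym sE) s0) vp.
have [_ _ f1 f2] := bseq_independent B n.
apply/rowP => l; rewrite aP mxE (_ : a l = 0) ?raddf0 //.
rewrite [LHS]surjective_pairing; congr pair; apply/matrixP => i i'; rewrite [RHS]mxE.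
  move: (freely_torsion gfree (v1 i')); rewrite v1E => /(proj2 gfree) /(_ l) h.
  exact: f1 h i.
move: (freely_torsion gfree (v2 i')); rewrite v2E => /(proj2 gfree) /(_ l) h.
exact: f2 h i.
Qed.

Lemma hat_sum_surjective u : exists s, hat_sum s = u.
Proof.
have ID u1 u2 : (exists s, hat_sum s = u1) -> (exists s, hat_sum s = u2) ->
    exists s, hat_sum s = u1 + u2.
  by move=> [s <-] [t <-]; exists (s + t); rewrite raddfD.
have Is u1 (t : L) : (exists s, hat_sum s = u1) -> exists s, hat_sum s = u1 <*> t.
  by move=> [s <-]; exists ((t : L^c) *: s); rewrite linearZ_LR.
apply: (F0_generated (I := fun u => exists s, hat_sum s = u)) u => // n m _.
have [b ->] := proj1 gfree m; rewrite raddf_sum.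
apply: (big_ind (fun u => exists s, hat_sum s = u)) => [||l _]; first by exists 0; rewrite raddf0.
  exact: ID.
have g0 i : gpr i (g l) = if i == 0 then g l else 0 by apply: pr_of_homog.
have hg : exists s, hat_sum s = hat (g l).
  by exists (delta_mx 0 l); apply: row_lin_delta.
apply: (generated_multiples (I := fun u => exists s, hat_sum s = u)) => //.
- by move=> i; rewrite g0; case: eqP => // ->.
- by rewrite g0 eqxx.
- by move=> l'; rewrite -jn_gpr g0 raddf0; exists 0; rewrite raddf0.
Qed.

End Basis.
End DegreeZero.

Lemma same_kernel_isomorphic (A : pzRingType) (U : lmodType A) (M N : Mod A)
    (f : {linear U -> M}) (g : {linear U -> N}) :
  surjective f -> surjective g -> (forall u, f u = 0 <-> g u = 0) -> isomorphic M N.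
Proof.
move=> /choice[s fs] gs fg.
have E u : g (s (f u)) = g u.
  apply/eqP; rewrite -subr_eq0 -linearB; apply/eqP/fg.
  by rewrite linearB /= fs subrr.
have h_lin : linear (fun m => g (s m)).
  move=> a m n; rewrite -linearP -[in LHS](fs m) -[in LHS](fs n) -linearP E.
  by [].
pose h m := g (s m).
pose hl := GRing.isLinear.Build A M N _ h h_lin.
pose H : {linear M -> N} := HB.pack h hl.
have [|n|h' h'P] := @Mod_invertible A M N H; last by exists H, h'.
  apply: linear_inj0 => m; rewrite /= /h => /fg.
  by rewrite fs.
by have [u <-] := gs n; exists (f u); apply: E.
Qed.

Lemma finitely_presented_iso (A : pzRingType) (M N : Mod A) :
  isomorphic M N -> finitely_presented M -> finitely_presented N.
Proof.
move=> [f [f' [f'f ff']]] [p [q [h [g [hg gs]]]]].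
exists p, q, h, (f \o g : {linear _ -> _}); split.
  move=> u; rewrite -hg; split=> /= [fu|->]; last exact: raddf0.
  by rewrite -[g u]f'f /= fu raddf0.
by move=> n; have [u gu] := gs (f' n); exists u; rewrite /= gu; apply: ff'.
Qed.

Section PositiveDegrees.
Variables (k : fieldType) (B : fibAlg k) (L : fibLim k).
Local Notation x := (fx B).

(** The generator of degree d + 1 contributes the right ideal e_d S, where e_d = E1 io io,
    whose relations are generated by 1 - e_d. There are no others: sending the generators
    to powers of x in a module with generators of degree 0 maps the image into a free
    S-module, where relations can be compared. *)
Lemma F0_Pd_finitely_presented r (d : 'I_r -> nat) :
  finitely_presented (F0 L (Pd B (fun l => (d l).+1%:Z)) : lmodType L^c).
Proof.
pose P := Pd B (fun l => (d l).+1%:Z); pose e l : L := E1 L (io (d l)) (io (d l)).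
pose P0 := Pd B (fun _ : 'I_r => 0).
pose g : {linear 'rV[L^c]_r -> F0 L P} := row_lin (fun l => jn L (d l) (pe B _ l)).
pose hfun (s : 'rV[L^c]_r) : 'rV[L^c]_r := \row_l ((1 - e l) * (s 0 l : L)).
have h_lin : linear hfun.
  by move=> a u v; apply/rowP => l; rewrite !mxE mulrDr mulrA.
pose h : {linear 'rV[L^c]_r -> 'rV[L^c]_r} :=
  HB.pack hfun (GRing.isLinear.Build L^c _ _ _ hfun h_lin).
have ge (s : 'rV[L^c]_r) : g s = 0 -> forall l, e l * (s 0 l : L) = 0.
  pose m l : P0 := iter (d l).+1 (fun u => x *: u) (pe B (fun=> 0) l).
  have mh l : gm_comp (d l).+1%:Z (m l).
    rewrite /m; elim: (d l).+1 => [|n IHn]; first exact: pe_homog.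
    by have := x_homog IHn; rewrite iterS; congr gm_comp; lia.
  move=> gs0; pose t : 'rV[L^c]_r := \row_l (e l * (s 0 l : L)).
  suff t0 : t = 0 by move=> l; have := congr1 (fun t : 'rV[L^c]_r => t 0 l) t0; rewrite !mxE.
  have E : @hat_sum k B L P0 r (@pe k B r (fun=> 0)) t = F0map L (pd_hom mh) (g s).
    rewrite [RHS](linear_sum (F0map L (pd_hom mh))); apply: eq_bigr => l _.
    by rewrite ract_map F0map_jn pd_homE mxE /m hat_power ractM.
  apply: (@hat_sum_injective k B L P0 r _ (@pe_homog k B r (fun=> 0))
    (@Pd_freely k B r (fun=> 0))).
  exact: (etrans E (etrans (congr1 _ gs0) (etrans (raddf0 _) (esym (raddf0 _))))).
exists r, r, h, g; split.
  move=> u; split=> [/ge u0|[t <-]].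
    by exists u; apply/rowP => l; rewrite mxE mulrBl mul1r u0 subr0.
  rewrite /= /row_lin big1 // => l _; rewrite scale_ract mxE -ractM ractBr ract1 jn_E1.
  by rewrite subrr ract0l.
have ID u1 u2 : (exists s, g s = u1) -> (exists s, g s = u2) -> exists s, g s = u1 + u2.
  by move=> [s <-] [t <-]; exists (s + t); rewrite raddfD.
have Is u1 (t : L) : (exists s, g s = u1) -> exists s, g s = u1 <*> t.
  by move=> [s <-]; exists ((t : L^c) *: s); rewrite linearZ_LR.
apply: F0_generated => // n m _; rewrite (Pd_sum m) raddf_sum.
apply: (big_ind (fun u => exists s, g s = u)) => [||l _]; first by exists 0; rewrite raddf0.
  exact: ID.
apply: (generated_homog (I := fun u => exists s, g s = u) (d := d l)) => //.
  exact: pe_homog.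
by exists (delta_mx 0 l); apply: row_lin_delta.
Qed.

End PositiveDegrees.

(** * Finitely presented graded modules *)

Section FinitelyGenerated.
Variables (k : fieldType) (B : fibAlg k).
Local Notation x := (fx B).
Local Notation y := (fy B).
Implicit Types M : grmod B.

Definition generates (M : lmodType B) q (u : 'I_q -> M) : Prop :=
  forall m, exists b : 'I_q -> B, m = \sum_l b l *: u l.

Lemma finitely_presented_generates (M : lmodType B) : finitely_presented M ->
  exists q (u : 'I_q -> M), generates u.
Proof.
move=> [p [q [h [g [_ gs]]]]]; exists p, (fun l => g (delta_mx 0 l)) => m.
by have [v <-] := gs m; exists (fun l => v 0 l); apply: row_linE.
Qed.

(** Schanuel: if a and b lift f and the given presentation to each other, the kernel of f
    is generated by the images under a of the relations and by the differences u - a (b u). *)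
Lemma finitely_presented_kernel (M : lmodType B) r (f : {linear 'rV[B]_r -> M}) :
  finitely_presented M -> surjective f ->
  exists q (w : 'I_q -> 'rV[B]_r), (forall l, f (w l) = 0) /\
    forall u, f u = 0 -> exists b : 'I_q -> B, u = \sum_l b l *: w l.
Proof.
move=> [p [q [h [g [hg gs]]]]] fs.
have /choice[a0 a0P] l := fs (g (delta_mx 0 l : 'rV_p)).
have /choice[b0 b0P] l := gs (f (delta_mx 0 l : 'rV_r)).
pose a : {linear 'rV[B]_p -> 'rV[B]_r} := row_lin a0.
pose b : {linear 'rV[B]_r -> 'rV[B]_p} := row_lin b0.
have fa v : f (a v) = g v.
  rewrite (row_linE g) /= /row_lin linear_sum; apply: eq_bigr => l _.
  by rewrite linearZ_LR a0P.
have gb v : g (b v) = f v.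
  rewrite (row_linE f) /= /row_lin linear_sum; apply: eq_bigr => l _.
  by rewrite linearZ_LR b0P.
exists (q + r)%N, (fun l => match split l with
   | inl l => a (h (delta_mx 0 l)) | inr l => delta_mx 0 l - a (b (delta_mx 0 l)) end).
split=> [l|u fu].
  case: (split l) => l'; first by rewrite fa; apply/hg; exists (delta_mx 0 l').
  by rewrite linearB /= fa gb subrr.
have [v vE] : exists v, h v = b u by apply/hg; rewrite gb.
exists (fun l => match split l with inl l => v 0 l | inr l => u 0 l end).
rewrite big_split_ord /=.
under eq_bigr do rewrite (unsplitK (inl _)).
under [X in _ + X]eq_bigr do rewrite (unsplitK (inr _)).
rewrite -(row_linE (a \o h : {linear _ -> _})).
rewrite -(row_linE (idfun \- (a \o b) : {linear _ -> _})) /= vE.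
by rewrite addrC subrK.
Qed.

Lemma fa_decomp_homog i (b : B) : ga_comp i b -> exists (c : k) b1 b2,
  [/\ b = c%:A + x * b1 + y * b2, ga_comp (i - 1) b1, ga_comp (i - 1) b2
    & i != 0 -> c = 0].
Proof.
move=> bi; have [c [b1 [b2 bE]]] := fa_decomp b.
pose gr := ga_grading B.
exists (if i == 0 then c else 0), (pr gr (i - 1) b1), (pr gr (i - 1) b2); split.
- rewrite -{1}(pr_id gr bi) {1}bE !raddfD /=.
  rewrite (ga_pr_mul _ _ (fx_deg B)) (ga_pr_mul _ _ (fy_deg B)); congr (_ + _ + _).
  rewrite (pr_of_homog _ (ga_comp_scalar B c)).
  by case: eqP => // _; rewrite scale0r.
- exact: pr_homog.
- exact: pr_homog.
- by move=> /negPf->.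
Qed.

Lemma generates_bound M q (u : 'I_q -> M) : exists D : nat, forall l (i : int),
  (i < - D%:Z)%R \/ (D%:Z < i)%R -> gpr i (u l) = 0.
Proof.
have /choice[D DP] l := pr_bound (gm_grading M) (u l).
exists (\max_l D l)%N => l i iD; apply/eqP/negPn/negP => /DP.
by have := leq_bigmax (F := D) l; lia.
Qed.

Lemma generates_step M q (u : 'I_q -> M) i (m : M) : generates u -> gm_comp (i + 1) m ->
  exists (c : 'I_q -> k) a b, [/\ gm_comp i a, gm_comp i b &
    m = \sum_l (c l)%:A *: gpr (i + 1) (u l) + x *: a + y *: b].
Proof.
move=> ug mi; have [b bE] := ug m.
have /choice[c /choice[b1 /choice[b2 bP]]] l := fa_decomp (b l).
exists c, (gpr i (\sum_l b1 l *: u l)), (gpr i (\sum_l b2 l *: u l)).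
split; [exact: gpr_homog|exact: gpr_homog|].
have mE : m = \sum_l (c l)%:A *: u l + x *: (\sum_l b1 l *: u l)
    + y *: (\sum_l b2 l *: u l).
  rewrite bE !scaler_sumr -!big_split; apply: eq_bigr => l _ /=.
  by rewrite bP !scalerDl !scalerA.
have <- : gpr (i + 1) m = m by exact: pr_id.
rewrite {1}mE !raddfD /= gpr_x gpr_y addrK raddf_sum; congr (_ + _ + _).
by apply: eq_bigr => l _; apply: gpr_scalar.
Qed.

(** A coefficient of positive degree is a combination of multiples of x and y. *)
Lemma generates_tail M q (u : 'I_q -> M) : generates u -> exists D : nat,
  forall (i : int) (m : M), (D%:Z <= i)%R -> gm_comp (i + 1) m ->
  exists a b, [/\ gm_comp i a, gm_comp i b & m = x *: a + y *: b].
Proof.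
move=> ug; have [D DP] := generates_bound u; exists D => i m Di mi.
have [c [a [b [ai bi ->]]]] := generates_step ug mi; exists a, b; split=> //.
rewrite big1 ?add0r // => l _; rewrite DP ?scaler0 //; right; lia.
Qed.

Lemma generates_lower M q (u : 'I_q -> M) (D : int) : generates u ->
  (forall l i, (i < D)%R -> gpr i (u l) = 0) ->
  forall (m : M) i, (i < D)%R -> gpr i m = 0.
Proof.
move=> ug uD m; have [b ->] := ug m => i iD; rewrite raddf_sum big1 // => l _ /=.
elim/fa_ind: (b l) i iD => [a c IHa IHc|c a IHa||a IHa|a IHa] i iD.
- by rewrite scalerDl raddfD /= IHa // IHc // addr0.
- by rewrite -[c *: a]mulr_algl -scalerA gpr_scalar IHa // scaler0.
- by rewrite scale1r uD.
- by rewrite -scalerA gpr_x IHa ?scaler0 //; lia.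
- by rewrite -scalerA gpr_y IHa ?scaler0 //; lia.
Qed.

Lemma kspan_sum (V : lmodType B) (S : seq V) I (r : seq I) (P : pred I) (u : I -> V) :
  (forall i, P i -> kspan S (u i)) -> kspan S (\sum_(i <- r | P i) u i).
Proof. by move=> h; apply: big_ind => //; [apply: kspan0|apply: kspanD]. Qed.

Lemma kspan_image (V : lmodType B) (b : B) (S : seq V) u :
  kspan S u -> kspan [seq b *: v | v <- S] (b *: u).
Proof.
apply: (@kspan_ind k B V S (fun u => kspan [seq b *: v | v <- S] (b *: u)))
  => [|{}u v|c {}u|v vS].
- by rewrite scaler0; apply: kspan0.
- by rewrite scalerDr; apply: kspanD.
- by rewrite -scalar_comm; apply: kspanZ.
- by apply: kspan_mem; apply: map_f.
Qed.

(** Upward induction on the degree: there is nothing below the generators, and each degree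
    is spanned by generators and by the multiples by x and y of the previous degree. *)
Lemma locally_finite M q (u : 'I_q -> M) : generates u -> forall i : int,
  exists S : seq M, {in S, forall v, gm_comp i v} /\ forall m, gm_comp i m -> kspan S m.
Proof.
move=> ug; have [D DP] := generates_bound u.
suff h (j : nat) : exists S : seq M,
    {in S, forall v, gm_comp (j%:Z - D%:Z - 1) v} /\
    forall m, gm_comp (j%:Z - D%:Z - 1) m -> kspan S m.
  move=> i; have [iD|iD] := boolP (i < - D%:Z)%R.
    exists [::]; split=> // m /(pr_id (gm_grading M)) <-.
    by apply: (generates_lower ug _ _ iD) => l i' i'D; apply: DP; left.
  have [S] := h (absz (i + D%:Z + 1)).
  suff -> : (absz (i + D%:Z + 1))%:Z - D%:Z - 1 = i by exists S.
  by rewrite gez0_abs; lia.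
elim: j => [|j [S [Si SP]]].
  exists [::]; split=> // m /(pr_id (gm_grading M)) <-.
  apply: (generates_lower (D := - D%:Z) ug) => [l i' i'D|]; last by lia.
  by apply: DP; left.
set i := (j%:Z - D%:Z - 1) in Si SP.
have -> : (j.+1%:Z - D%:Z - 1) = i + 1 by rewrite /i; lia.
exists ([seq gpr (i + 1) (u l) | l <- enum 'I_q] ++
  ([seq x *: v | v <- S] ++ [seq y *: v | v <- S])); split=> [v|m mi].
  rewrite !mem_cat => /orP[/mapP[l _ ->]|/orP[/mapP[w /Si wi ->]|/mapP[w /Si wi ->]]].
  - exact: gpr_homog.
  - exact: x_homog.
  - exact: y_homog.
have [c [a [b [ai bi ->]]]] := generates_step ug mi.
apply: kspanD; last by apply/kspan_catr/kspan_catr/kspan_image/SP.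
apply: kspanD; last by apply/kspan_catr/kspan_catl/kspan_image/SP.
apply: kspan_catl; apply: kspan_sum => l _; apply: kspanZ; apply: kspan_mem.
by apply/mapP; exists l; rewrite ?mem_enum.
Qed.

Fixpoint kfree (V : lmodType B) (S : seq V) : Prop :=
  if S is v :: S' then ~ kspan S' v /\ kfree S' else True.

Lemma kfree_basis (V : lmodType B) (S : seq V) : exists S' : seq V,
  [/\ {subset S' <= S}, kfree S' & forall v, kspan S v -> kspan S' v].
Proof.
elim: S => [|v S [S' [S'S S'f S'P]]]; first by exists [::].
have sub : {subset S' <= v :: S} by move=> w /S'S wS; rewrite inE wS orbT.
have [vS'|vS'] := pselect (kspan S' v).
  exists S'; split=> // w [c wc].
  by rewrite -[w](subrK ((c%:A : B) *: v)); apply: kspanD; [apply: S'P|apply: kspanZ].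
exists (v :: S'); split=> //.
  by move=> w; rewrite inE => /orP[/eqP->|/sub//]; apply: mem_head.
by move=> w [c wc]; exists c; apply: S'P.
Qed.

Lemma kspan_comb (V : lmodType B) (S : seq V) (c : 'I_(size S) -> k) :
  kspan S (\sum_i (c i)%:A *: tnth (in_tuple S) i).
Proof. by apply: kspan_sum => i _; apply/kspanZ/kspan_mem/mem_tnth. Qed.

Lemma kfree_coef (V : lmodType B) (S : seq V) (c : 'I_(size S) -> k) : kfree S ->
  \sum_i (c i)%:A *: tnth (in_tuple S) i = 0 -> forall i, c i = 0.
Proof.
elim: S c => [|v S IHS] c; first by move=> _ _ [].
move=> [vS Sf]; rewrite big_ord_recl.
have E : \sum_(i < size S) (c (lift ord0 i))%:A *: tnth (in_tuple (v :: S)) (lift ord0 i)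
       = \sum_i (c (lift ord0 i))%:A *: tnth (in_tuple S) i.
  by apply: eq_bigr => i _; rewrite !(tnth_nth 0).
rewrite E (tnth_nth 0) /= => e.
have c0 : c ord0 = 0.
  apply/eqP/negPn/negP => c0; apply: vS.
  have -> : v = (- (c ord0)^-1)%:A *:
      (\sum_i (c (lift ord0 i))%:A *: tnth (in_tuple S) i).
    have -> : \sum_i (c (lift ord0 i))%:A *: tnth (in_tuple S) i
      = - ((c ord0)%:A *: v) by apply/eqP; rewrite -addr_eq0 addrC e.
    rewrite scalerN scalerA mulr_algl scalerA -scaleNr -scaleNr mulNr opprK.
    by rewrite mulVf // scale1r scale1r.
  by apply/kspanZ/kspan_comb.
move: e; rewrite c0 !scale0r add0r => /(IHS _ Sf) h i.
by case: (unliftP ord0 i) => [j ->|->].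
Qed.

(** The structure of a free module in degrees above its generators: M_(i+1) is the direct sum
    of x M_i and y M_i, x is injective, and y has kernel y M_(i-1). *)
Definition tame M (D : nat) : Prop := forall i : int, (D%:Z <= i)%R ->
  (forall m : M, gm_comp (i + 1) m ->
     exists a b : M, [/\ gm_comp i a, gm_comp i b & m = x *: a + y *: b]) /\
  (forall a b : M, gm_comp i a -> gm_comp i b -> x *: a + y *: b = 0 ->
     a = 0 /\ exists2 e, gm_comp (i - 1) e & b = y *: e).

(** The homogeneous components of the given generators. *)
Lemma homogeneous_generators M q (u : 'I_q -> M) : generates u ->
  exists r (d : 'I_r -> int) (m : 'I_r -> M) (mh : forall l, gm_comp (d l) (m l)),
    surjective (pd_hom mh).
Proof.
move=> ug; have [D DP] := generates_bound u.
pose I : finType := ('I_q * 'I_(D + D).+1)%type.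
pose deg (j : I) := j.2%:Z - D%:Z; pose elt (j : I) : M := gpr (deg j) (u j.1).
exists #|I|, (fun l => deg (enum_val l)), (fun l => elt (enum_val l)).
exists (fun l => gpr_homog _ _) => m.
set f := pd_hom _; have [b ->] := ug m.
have uf l : gim f (u l).
  have -> : u l = \sum_(j < (D + D).+1) elt (l, j).
    have [s [us s0 ->]] := gpr_sum (u l).
    transitivity (\sum_(i <- [seq j%:Z - D%:Z | j <- iota 0 (D + D).+1]) gpr i (u l)).
      have sw (s1 s2 : seq int) : uniq s1 -> uniq s2 ->
          (forall i, i \notin s1 -> gpr i (u l) = 0) ->
          (forall i, i \notin s2 -> gpr i (u l) = 0) ->
          \sum_(i <- s1) gpr i (u l) = \sum_(i <- s2) gpr i (u l).
        move=> u1 u2 h1 h2; transitivity (\sum_(i <- undup (s1 ++ s2)) gpr i (u l)).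
          apply/esym/big_widen => //; first exact: undup_uniq.
          by move=> i i1; rewrite mem_undup mem_cat i1.
        apply: big_widen => //; first exact: undup_uniq.
        by move=> i i1; rewrite mem_undup mem_cat i1 orbT.
      apply: sw => //.
        rewrite map_inj_uniq ?iota_uniq // => i j /eqP.
        by rewrite (inj_eq (addIr _)) => /eqP[].
      move=> i iN; apply: DP; have [|iD] := boolP (i < - D%:Z)%R; [by left|right].
      have [//|iD'] := boolP (D%:Z < i)%R; case/negP: iN; apply/mapP; exists (absz (i + D%:Z)).
        by rewrite mem_iota /=; lia.
      by rewrite gez0_abs; lia.
    by rewrite big_map -(big_mkord xpredT (fun j => gpr (j%:Z - D%:Z) (u l))) /index_iota subn0.
  apply: gs_sum => j _; exists (pe _ _ (enum_rank ((l, j) : I))).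
  by rewrite pd_homE /= enum_rankK.
by apply: (gs_sum (K := gim f)) => l _; apply: gsZ; apply: uf.
Qed.

(** In degrees where the kernel of a presentation is itself spanned by multiples by x and y,
    a relation x a + y b = 0 lifts to a relation in the free module. *)
Lemma finitely_presented_tame M : finitely_presented (M : lmodType B) ->
  exists D, tame M D.
Proof.
move=> Mfp; have [q [u ug]] := finitely_presented_generates Mfp.
have [r [d [m [mh fs]]]] := homogeneous_generators ug; set f := pd_hom mh in fs.
have [q' [w [fw wP]]] := @finitely_presented_kernel M r f Mfp fs.
have /choice[w' w'P] l := gs_incl_surj (fw l : gker f (w l)).
have w'g : generates (w' : 'I_q' -> gs_grmod (gker f)).
  move=> v; have [b bE] := wP (gs_incl _ v) (gs_incl_mem v); exists b.
  apply: (@gs_incl_inj _ _ _ (gker f)); rewrite bE linear_sum.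
  by apply: eq_bigr => l _; rewrite linearZ_LR; congr (_ *: _); exact/esym/w'P.
have [D1 D1P] := generates_tail ug; have [D2 D2P] := generates_tail w'g.
exists (maxn D1 D2) => i iD; split; first by move=> v; apply: D1P; lia.
move=> a b ai bi ab0.
have lift_homog j (v : M) : gm_comp j v -> exists2 v' : Pd B d, gm_comp j v' & f v' = v.
  move=> vj; have [v' v'E] := fs v; exists (gpr j v'); first exact: gpr_homog.
  by rewrite -gpr_hom v'E; apply: pr_id.
have [a' a'i a'E] := lift_homog _ _ ai; have [b' b'i b'E] := lift_homog _ _ bi.
have [z zE] : exists z : gs_grmod (gker f), gs_incl _ z = x *: a' + y *: b'.
  by apply: gs_incl_surj; rewrite /= linearD !linearZ_LR /= a'E b'E.
have zi : gm_comp (i + 1) z.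
  change (gm_comp (i + 1) (gs_incl (gker f) z)); rewrite zE.
  by apply: (gradingD (gm_grading (Pd B d))); [apply: x_homog|apply: y_homog].
have [|z1 [z2 [z1i z2i zE2]]] := D2P _ _ _ zi; first by lia.
pose k1 : Pd B d := gs_incl (gker f) z1; pose k2 : Pd B d := gs_incl (gker f) z2.
have k10 : f k1 = 0 by exact: gs_incl_mem z1.
have k20 : f k2 = 0 by exact: gs_incl_mem z2.
have E : x *: (a' - k1) + y *: (b' - k2) = 0.
  rewrite !scalerBr addrACA -opprD -zE zE2 linearD !linearZ_LR.
  exact: subrr.
have ak : a' - k1 = 0.
  apply/rowP => l; have := congr1 (fun u : 'rV[B]_r => u 0 l) E.
  by rewrite !mxE => /fxy_inj[].
have /choice[e eP] : forall l, exists e : B, (b' - k2 : 'rV[B]_r) 0 l = y * e.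
  move=> l; have := congr1 (fun u : 'rV[B]_r => u 0 l) E.
  by rewrite !mxE => /fxy_inj[].
pose e' : Pd B d := (\row_l e l : 'rV[B]_r).
have ye : b' - k2 = y *: e' by apply/rowP => l; rewrite eP !mxE.
split; first by rewrite -a'E -[a'](subrK k1) ak add0r.
exists (gpr (i - 1) (f e')); first exact: gpr_homog.
rewrite -gpr_y -linearZ_LR -ye linearB /= k20 subr0 b'E; apply/esym; exact: pr_id.
Qed.

(** ** Free tails of finitely presented modules *)

Lemma finite_dimensional_torsion M r (d : 'I_r -> int) (m : 'I_r -> M)
    (mh : forall l, gm_comp (d l) (m l)) :
  generates m -> (forall v : M, torsion v) -> finite_dimensional M.
Proof.
move=> mg Mt; have [||S [S1 S2 S3]] := @torsion_span _ _ M [seq m l | l <- enum 'I_r].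
- by move=> v /mapP[l _ ->]; exists (d l).
- by move=> v _; apply: Mt.
apply: (finite_dimensional_kspan (L := S)) => v; have [b ->] := mg v.
apply: kspan_sum => l _.
apply: (gsZ (g := kspan_gsub S2 S3)); apply: S1.
by apply/mapP; exists l; rewrite ?mem_enum.
Qed.

End FinitelyGenerated.

Section FreeTail.
Variables (k : fieldType) (B : fibAlg k) (M : grmod B) (D0 n : nat).
Hypothesis Mtame : tame M D0.
Hypothesis Dn : (D0 <= n)%N.
Local Notation x := (fx B).
Local Notation y := (fy B).

Variables (S1 S2 : seq M).
Hypothesis S1P : forall m : M, gm_comp n%:Z m -> kspan S1 (x *: m).
Hypothesis S2P : forall m : M, gm_comp n%:Z m -> kspan S2 (x *: (y *: m)).
Hypothesis S1x : {in S1, forall v, exists2 m : M, gm_comp n%:Z m & v = x *: m}.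
Hypothesis S2x : {in S2, forall v, exists2 m : M, gm_comp n%:Z m & v = x *: (y *: m)}.
Hypothesis S1f : kfree S1.
Hypothesis S2f : kfree S2.

Local Notation r1 := (size S1).
Local Notation r2 := (size S2).

(** The entries of S1 are multiples x m and those of S2 are multiples x y m of elements m of
    degree n. *)
Definition ft_deg (l : 'I_(r1 + r2)) : nat := if split l is inl _ then n else n.+1.
Definition ft_elt (l : 'I_(r1 + r2)) : M :=
  match split l with
  | inl l => tnth (in_tuple S1) l
  | inr l => tnth (in_tuple S2) l
  end.

Fact ft_homog l : gm_comp (ft_deg l).+1%:Z (ft_elt l).
Proof using S1x S2x.
rewrite /ft_deg /ft_elt; case: (split l) => l'.
  have [m mn ->] := S1x (mem_tnth l' (in_tuple S1)).
  by have := x_homog mn; rewrite addrC -intS.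
have [m mn ->] := S2x (mem_tnth l' (in_tuple S2)).
by have := x_homog (y_homog mn); rewrite addrC [_ + 1]addrC -!intS.
Qed.

Definition ft_mod : grmod B := Pd B (fun l => (ft_deg l).+1%:Z).
Definition ft_hom : grhom ft_mod M := pd_hom ft_homog.
Local Notation P := ft_mod.
Local Notation p := ft_hom.

Lemma ft_gen1 (m : M) : gm_comp n%:Z m -> gim p (x *: m).
Proof.
move=> /S1P /kspan_coef[c ->]; apply: (gs_sum (K := gim p)) => l _; apply: gsZ.
exists (pe B _ (lshift r2 l)); rewrite pd_homE /ft_elt.
by rewrite (unsplitK (inl l)).
Qed.

Lemma ft_gen2 (m : M) : gm_comp n%:Z m -> gim p (x *: (y *: m)).
Proof.
move=> /S2P /kspan_coef[c ->]; apply: (gs_sum (K := gim p)) => l _; apply: gsZ.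
exists (pe B _ (rshift r1 l)); rewrite pd_homE /ft_elt.
by rewrite (unsplitK (inr l)).
Qed.

Lemma tame_gen i (m : M) : (n%:Z <= i)%R -> gm_comp (i + 1) m ->
  exists a b : M, [/\ gm_comp i a, gm_comp i b & m = x *: a + y *: b].
Proof. by move=> ni; apply: (proj1 (Mtame _)); lia. Qed.

Lemma tame_rel i (a b : M) : (n%:Z <= i)%R -> gm_comp i a -> gm_comp i b ->
  x *: a + y *: b = 0 -> a = 0 /\ exists2 e, gm_comp (i - 1) e & b = y *: e.
Proof. by move=> ni; apply: (proj2 (Mtame _)); lia. Qed.

(** Elements of degree n + 1 are sums x a + y b, and y b becomes x y b after multiplication
    by x. From then on y b can be rewritten with b = x c + y d, where y y d = 0. *)
Lemma ft_x (j : nat) (m : M) : gm_comp (n%:Z + j%:Z) m -> gim p (x *: m).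
Proof.
suff h : forall j, (forall m : M, gm_comp (n%:Z + j%:Z) m -> gim p (x *: m)) /\
    (forall m : M, gm_comp (n%:Z + j.+1%:Z) m -> gim p (x *: m)).
  by apply: (proj1 (h j)).
elim=> {j m} [|j [IH0 IH1]].
  split=> m; first by rewrite addr0; apply: ft_gen1.
  move=> /tame_gen[|a [b [an bn ->]]]; first by lia.
  rewrite scalerDr.
  by apply: gsD; [apply/gsZ/ft_gen1|apply: ft_gen2].
split=> // m; have -> : n%:Z + j.+2%:Z = n%:Z + j.+1%:Z + 1 by lia.
move=> /tame_gen[|a [b [ai bi ->]]]; first by lia.
apply: gsZ; apply: gsD; first exact: IH1.
move: bi; have -> : n%:Z + j.+1%:Z = n%:Z + j%:Z + 1 by lia.
move=> /tame_gen[|c [d [ci di ->]]]; first by lia.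
by rewrite scalerDr yyv addr0; apply/gsZ/IH0.
Qed.

Lemma ft_image i (m : M) : (n%:Z + 2 <= i)%R -> gm_comp i m -> gim p m.
Proof.
move=> ni; have -> : i = (i - 1) + 1 by lia.
move=> /tame_gen[|a [b [ai bi ->]]]; first by lia.
have [j ij] : exists j : nat, i - 1 = n%:Z + j.+1%:Z by exists (absz (i - n%:Z - 2)%R); lia.
apply: gsD; first by apply: (@ft_x j.+1); rewrite -ij.
move: bi; rewrite ij; have -> : n%:Z + j.+1%:Z = n%:Z + j%:Z + 1 by lia.
move=> /tame_gen[|c [d [ci di ->]]]; first by lia.
by rewrite scalerDr yyv addr0; apply/gsZ/(@ft_x j).
Qed.

Lemma ft_preimage i (m : M) : gim p m -> gm_comp i m -> exists2 u : P, gm_comp i u & p u = m.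
Proof.
move=> [u <-] ui; exists (gpr i u); first exact: gpr_homog.
by rewrite -gpr_hom; apply: pr_id.
Qed.

Lemma ft_low i (u : P) : (i <= n%:Z)%R -> gm_comp i u -> u = 0.
Proof.
move=> ni ui; apply/rowP => l; rewrite mxE.
rewrite -(pr_id (ga_grading B) (ui l)); apply: ga_neg.
by rewrite /ft_deg; case: (split l) => _; lia.
Qed.

(** In degree n + 1 only generators from S1 occur, with scalar coefficients. *)
Lemma ft_first (u : P) : gm_comp (n%:Z + 1) u -> exists2 a : M, gm_comp n%:Z a & p u = x *: a.
Proof.
move=> ui.
have /choice[a aP] l : exists a : M, gm_comp n%:Z a /\
    (u : 'rV[B]_(r1 + r2)) 0 l *: ft_elt l = x *: a.
  have := ui l; rewrite /ft_deg /ft_elt; case: (split l) => l' ul.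
    have [m mn ->] := S1x (mem_tnth l' (in_tuple S1)).
    have [|c [b1 [b2 [-> b1i b2i _]]]] := @fa_decomp_homog _ B 0 (u 0 l).
      by move: ul; congr ga_comp; lia.
    exists (c%:A *: m); split; first exact: gm_comp_scalar.
    rewrite -(pr_id (ga_grading B) b1i) ga_neg // mulr0 addr0.
    by rewrite -(pr_id (ga_grading B) b2i) ga_neg // mulr0 addr0 scalar_comm.
  exists 0; split; first exact: grading0 (gm_grading M) _.
  rewrite -(pr_id (ga_grading B) ul) ga_neg ?scale0r ?scaler0 //; lia.
exists (\sum_l a l); first by apply: (grading_sum (gm_grading M)) => l _; case: (aP l).
by rewrite scaler_sumr; apply: eq_bigr => l _; case: (aP l).
Qed.

Definition scalar_row (c : 'I_(r1 + r2) -> k) : P := (\row_l (c l)%:A : 'rV[B]_(r1 + r2)).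

Lemma ft_decomp (j : nat) (u : P) : gm_comp (n%:Z + j.+1%:Z) u ->
  exists (c : 'I_(r1 + r2) -> k) (u1 u2 : P),
  [/\ u = scalar_row c + x *: u1 + y *: u2,
      gm_comp (n%:Z + j%:Z) u1, gm_comp (n%:Z + j%:Z) u2
    & forall l, (ft_deg l <> n + j)%N -> c l = 0].
Proof.
move=> ui; have /choice[c /choice[b1 /choice[b2 bP]]] l := fa_decomp_homog (ui l).
exists c, (\row_l b1 l), (\row_l b2 l); split.
- by apply/rowP => l; rewrite !mxE; case: (bP l).
- by move=> l; rewrite mxE; case: (bP l) => _ + _ _; congr ga_comp; lia.
- by move=> l; rewrite mxE; case: (bP l) => _ _ + _; congr ga_comp; lia.
- by move=> l dl; case: (bP l) => _ _ _; apply; lia.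
Qed.

(** Induction on the degree: the relations of tame separate the parts of an element that
    start with x and with y, and each of them has a smaller degree. *)
Lemma ft_injective_homog (j : nat) (u : P) : gm_comp (n%:Z + j%:Z) u -> p u = 0 -> u = 0.
Proof.
elim/ltn_ind: j u => -[|j] IH u; first by rewrite addr0 => /ft_low h _; apply: h.
move=> /ft_decomp[c [u1 [u2 [uE u1i u2i c0]]]] pu.
pose cr := scalar_row c.
have crE : p cr = \sum_l (c l)%:A *: ft_elt l by apply: eq_bigr => l _; rewrite mxE.
have {}pu : p cr + x *: p u1 + y *: p u2 = 0.
  by rewrite -pu uE; rewrite -!linearZ_LR -!linearD.
suff [cr0 u10 u20] : [/\ cr = 0, u1 = 0 & y *: u2 = 0].
  by rewrite uE -/cr cr0 u10 u20 scaler0 !add0r.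
have p1i := gh_degree p u1i; have p2i := gh_degree p u2i.
case: j => [|[|j]] in IH u1i u2i c0 p1i p2i *.
- rewrite addr0 in u1i u2i; have u10 : u1 = 0 by apply: ft_low u1i.
  have u20 : u2 = 0 by apply: ft_low u2i.
  split=> //; last by rewrite u20 scaler0.
  move: pu; rewrite u10 u20 !raddf0 ?scaler0 !addr0 crE big_split_ord /=.
  rewrite [X in _ + X]big1 ?addr0 => [|l _]; last first.
    by rewrite c0 ?scale0r // /ft_deg (unsplitK (inr l)); lia.
  have E (l : 'I_r1) : ft_elt (lshift r2 l) = tnth (in_tuple S1) l.
    by rewrite /ft_elt (unsplitK (inl l)).
  under eq_bigr do rewrite E.
  move=> /(kfree_coef S1f) cl0; apply/rowP => l; rewrite !mxE.
  case: (split_ordP l) => l' ->; first by rewrite cl0 scale0r.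
  by rewrite c0 ?scale0r // /ft_deg (unsplitK (inr l')); lia.
(* Degree n + 2: the image of cr is x y A, so p u1 = - y A by the relation between x and y;
   as p u1 = x a by ft_first, the relation x a + y A = 0 gives a = 0 and A in y M. *)
- have /choice[d dP] (l : 'I_r2) : exists d : M, gm_comp n%:Z d /\
      tnth (in_tuple S2) l = x *: (y *: d).
    by have [d dn ->] := S2x (mem_tnth l (in_tuple S2)); exists d.
  pose A : M := \sum_l (c (rshift r1 l))%:A *: d l.
  have An : gm_comp n%:Z A.
    apply: (grading_sum (gm_grading M)) => l _; apply: gm_comp_scalar.
    by case: (dP l).
  have cl l : c (lshift r2 l) = 0.
    by rewrite c0 // /ft_deg (unsplitK (inl l)); lia.
  have crA : p cr = x *: (y *: A).
    rewrite crE big_split_ord /= big1 ?add0r => [|l _]; last by rewrite cl !scale0r.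
    rewrite !scaler_sumr; apply: eq_bigr => l _.
    by rewrite /ft_elt (unsplitK (inr l)) (proj2 (dP l)) !scalar_comm.
  have [a an aE] := ft_first u1i; have [b bn bE] := ft_first u2i.
  have A'i : gm_comp (n%:Z + 1%:Z) (y *: A + p u1).
    apply: (gradingD (gm_grading M)) => //.
    by have := y_homog An; congr gm_comp; lia.
  have pu' : x *: (y *: A + p u1) + y *: p u2 = 0 by rewrite scalerDr -crA.
  have [|pA [w wi p2w]] := tame_rel _ A'i p2i pu'; first by lia.
  have aA : x *: a + y *: A = 0 by rewrite -aE addrC.
  have [//|a0 [e _ Ae]] := tame_rel _ an An aA.
  have p10 : p u1 = 0 by rewrite aE a0 scaler0.
  have wn : gm_comp n%:Z w by move: wi; congr gm_comp; lia.
  have [b0 _] : b = 0 /\ exists2 e, gm_comp (n%:Z - 1) e & - w = y *: e.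
    apply: tame_rel => //; first exact: (gradingN (gm_grading M)).
    by rewrite -bE p2w scalerN subrr.
  have p20 : p u2 = 0 by rewrite bE b0 scaler0.
  split; [|exact: (IH 1%N)|by rewrite (IH 1%N _ u2 u2i p20) ?scaler0].
  have S20 : \sum_l (c (rshift r1 l))%:A *: tnth (in_tuple S2) l = 0.
    transitivity (p cr); last by rewrite crA Ae yyv scaler0.
    rewrite crE big_split_ord /= [X in _ = X + _]big1 ?add0r => [|l _]; last by rewrite cl !scale0r.
    by apply: eq_bigr => l _; rewrite /ft_elt (unsplitK (inr l)).
  apply/rowP => l; case: (split_ordP l) => l' ->; rewrite !mxE; first by rewrite cl !scale0r.
  by rewrite (kfree_coef S2f S20 l') scale0r.
(* Higher degrees: the image of u2 is y w with w = x w1 + y w2, and a preimage z of x w1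
   satisfies u2 = y z, so y u2 = 0. *)
- have c00 l : c l = 0 by apply: c0; rewrite /ft_deg; case: (split l) => _; lia.
  have cr0 : cr = 0 by apply/rowP => l; rewrite !mxE c00 scale0r.
  have pu' : x *: p u1 + y *: p u2 = 0 by rewrite -pu cr0 raddf0 add0r.
  have [|p10 [w wi p2w]] := tame_rel _ p1i p2i pu'; first by lia.
  have u10 : u1 = 0 by apply: (IH j.+2).
  split=> //; move: wi; have -> : n%:Z + j.+2%:Z - 1 = n%:Z + j%:Z + 1 by lia.
  move=> /tame_gen[|w1 [w2 [w1i w2i wE]]]; first by lia.
  have w1' : gm_comp (n%:Z + j.+1%:Z) (x *: w1).
    by have := x_homog w1i; congr gm_comp; lia.
  have [z zi zE] := ft_preimage (@ft_x j w1 w1i) w1'.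
  have u2z : u2 - y *: z = 0.
    apply: (IH j.+2) => //.
      apply: (gradingB (gm_grading P)) => //.
      by have := y_homog zi; congr gm_comp; lia.
    rewrite linearB linearZ_LR [X in _ - _ *: X]zE p2w wE scalerDr yyv addr0.
    exact: subrr.
  have -> : u2 = y *: z by apply/eqP; rewrite -subr_eq0 u2z.
  exact: yyv.
Qed.

Lemma ft_injective : injective p.
Proof.
apply: linear_inj0 => u pu; apply: gpr_eq0 => i.
have [ni|ni] := boolP (i <= n%:Z)%R; first by apply: ft_low ni _; apply: gpr_homog.
have [j ->] : exists j : nat, i = n%:Z + j%:Z by exists (absz (i - n%:Z)%R); lia.
apply: (@ft_injective_homog j); first exact: gpr_homog.
by rewrite -gpr_hom; rewrite [X in gpr _ X]pu raddf0.
Qed.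

Lemma ft_killed (m : M) : exists e, killed (gim p) e m.
Proof.
have [D DP] := pr_bound (gm_grading M) m; exists (D + n + 2)%N.
suff h : forall (e : nat) (m : M), (forall i : int, (i < n%:Z + 2 - e%:Z)%R -> gpr i m = 0) ->
    killed (gim p) e m.
  by apply: h => i iD; apply/eqP/negPn/negP => /DP; lia.
elim=> [|e IHe] w wi.
  have [s [_ _ ->]] := gpr_sum w; apply: (gs_sum (K := gim p)) => i _.
  have [ni|ni] := boolP (i < n%:Z + 2)%R; first by rewrite wi ?subr0 //; apply: gs0.
  by apply: (ft_image (i := i)); [lia|apply: gpr_homog].
by split; apply: IHe => i ie; rewrite ?gpr_x ?gpr_y wi ?scaler0 //; lia.
Qed.

End FreeTail.

Section FreeTailExists.
Variables (k : fieldType) (B : fibAlg k).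
Local Notation x := (fx B).
Local Notation y := (fy B).

(** Take bases of x M_n and of x y M_n as generators, for a large n; by finite generation
    their span has finite codimension. *)
Lemma free_tail (M : grmod B) (N : nat) : finitely_presented (M : lmodType B) ->
  exists r (d : 'I_r -> nat) (p : grhom (Pd B (fun l => (d l).+1%:Z)) M),
    (forall l, (N <= d l)%N) /\ iso_mod (@finite_dimensional k B) p.
Proof.
move=> Mfp; have [D Mt] := finitely_presented_tame Mfp.
have [q [u ug]] := finitely_presented_generates Mfp.
pose n := maxn D N; have Dn : (D <= n)%N by apply: leq_maxl.
have [S [Sn SP]] := locally_finite ug n%:Z.
have [S1 [S1S S1f S1P]] := kfree_basis [seq x *: v | v <- S].
have [S2 [S2S S2f S2P]] := kfree_basis [seq x *: v | v <- [seq y *: v | v <- S]].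
have h1 (m : M) : gm_comp n%:Z m -> kspan S1 (x *: m).
  by move=> mn; apply/S1P/kspan_image/SP.
have h2 (m : M) : gm_comp n%:Z m -> kspan S2 (x *: (y *: m)).
  by move=> mn; apply/S2P/kspan_image/kspan_image/SP.
have h3 : {in S1, forall v, exists2 m : M, gm_comp n%:Z m & v = x *: m}.
  by move=> v /S1S/mapP[m /Sn mn ->]; exists m.
have h4 : {in S2, forall v, exists2 m : M, gm_comp n%:Z m & v = x *: (y *: m)}.
  by move=> v /S2S/mapP[w /mapP[m /Sn mn ->] ->]; exists m.
exists (size S1 + size S2)%N, (@ft_deg k B M n S1 S2), (ft_hom h3 h4); split.
  move=> l; rewrite /ft_deg; case: (split l) => _; first exact: leq_maxr.
  exact/leqW/leq_maxr.
set p := ft_hom h3 h4.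
apply: iso_mod_canonical.
  apply: (@gs_finite_dimensional _ _ _ _ [::]) => // m m0.
  exact: (ft_injective Mt Dn h1 h2 S1f S2f (etrans m0 (esym (raddf0 p)))).
have [r' [d' [m' [m'h fs]]]] := homogeneous_generators ug.
apply: (@finite_dimensional_torsion _ _ _ r' d' (fun l => gq_proj (gim p) (m' l))).
- by move=> l; apply: gh_degree.
- move=> v; have [w <-] := gq_proj_surj v; have [z zw] := fs w.
  exists (fun l => (z : 'rV[B]_r') 0 l); rewrite -zw [X in gq_proj _ X]/= /row_lin linear_sum.
  by apply: eq_bigr => l _; rewrite linearZ_LR.
- move=> v; have [w <-] := gq_proj_surj v.
  have [e we] := ft_killed Mt Dn h1 h2 h3 h4 w; exists e.
  by apply/killed_map; apply: killed_impl we => z /gq_projP.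
Qed.

End FreeTailExists.

(** * Deep tails and essential surjectivity *)

Section KilledDegree.
Variables (k : fieldType) (B : fibAlg k).
Local Notation x := (fx B).
Local Notation y := (fy B).

Lemma killed_last (V : lmodType B) (Q : V -> Prop) n m : killed Q n.+1 m <->
  killed (fun v => Q (x *: v) /\ Q (y *: v)) n m.
Proof.
elim: n m => [|n IHn] m; first by [].
by split=> -[/IHn hx /IHn hy]; split.
Qed.

Lemma killed_pr (V : lmodType B) (Q : V -> Prop) n m (b : B) :
  Q 0 -> (forall u v, Q u -> Q v -> Q (u + v)) -> (forall (c : k) u, Q u -> Q (c%:A *: u)) ->
  killed Q n m -> Q (pr (ga_grading B) n%:Z b *: m).
Proof.
elim/fa_ind: b Q n => [a b IHa IHb|c a IHa||a IHa|a IHa] Q n Q0 QD Qc.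
- move=> nm; rewrite raddfD scalerDl; apply: (QD).
    exact: (IHa Q n Q0 QD Qc nm).
  exact: (IHb Q n Q0 QD Qc nm).
- move=> nm; rewrite ga_pr_scale -[c *: _]mulr_algl -scalerA; apply: (Qc).
  exact: (IHa Q n Q0 QD Qc nm).
- rewrite (pr_of_homog _ (ga_one B)); case: n => [|n] nm; first by rewrite scale1r.
  by rewrite scale0r.
- case: n => [|n]; first by rewrite (ga_pr_mul _ _ (fx_deg B)) ga_neg // mulr0 scale0r.
  move=> /killed_last h; rewrite (ga_pr_mul _ _ (fx_deg B)).
  have -> : n.+1%:Z - 1 = n%:Z by lia.
  rewrite -scalerA; apply: (proj1 (IHa (fun v => Q (x *: v) /\ Q (y *: v)) n _ _ _ h)).
  + by rewrite !scaler0.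
  + by move=> u v [? ?] [? ?]; rewrite !scalerDr; split; apply: QD.
  + by move=> c u [? ?]; rewrite -!scalar_comm; split; apply: Qc.
- case: n => [|n]; first by rewrite (ga_pr_mul _ _ (fy_deg B)) ga_neg // mulr0 scale0r.
  move=> /killed_last h; rewrite (ga_pr_mul _ _ (fy_deg B)).
  have -> : n.+1%:Z - 1 = n%:Z by lia.
  rewrite -scalerA; apply: (proj2 (IHa (fun v => Q (x *: v) /\ Q (y *: v)) n _ _ _ h)).
  + by rewrite !scaler0.
  + by move=> u v [? ?] [? ?]; rewrite !scalerDr; split; apply: QD.
  + by move=> c u [? ?]; rewrite -!scalar_comm; split; apply: Qc.
Qed.

(** A homogeneous element of degree at least n is a combination of words of length at
    least n. *)
Lemma killed_degree (M : grmod B) (Q : gsub M) n m (b : B) i : killed Q n m ->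
  (n%:Z <= i)%R -> ga_comp i b -> Q (b *: m).
Proof.
move=> nm ni bi; have [j ij] : exists j : nat, i = j%:Z by exists (absz i); lia.
rewrite -(pr_id (ga_grading B) bi) ij; apply: killed_pr.
- exact: gs0.
- exact: gsD.
- by move=> c u; apply: gsZ.
- by apply: (@killed_le _ _ _ _ n) nm => [v|v|]; [apply: gsZ|apply: gsZ|lia].
Qed.

Definition gzero (M : grmod B) : gsub M := gker (grhom_id M).

Local Notation Pn d := (Pd B (fun l => (d l).+1%:Z)).

(** The generators of the tail are combinations of the old ones with coefficients of degree
    d' j - d l, which is at least e l. *)
Lemma tail_degree r (d : 'I_r -> nat) r' (d' : 'I_r' -> nat) (s : grhom (Pn d') (Pn d))
    (M : grmod B) (Q : gsub M) (e : 'I_r -> nat) (m : 'I_r -> M) :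
  (forall l, killed Q (e l) (m l)) -> (forall l j, (d l + e l <= d' j)%N) ->
  forall j, Q (\sum_l (s (pe B _ j) : 'rV[B]_r) 0 l *: m l).
Proof.
move=> me dd' j; apply: gs_sum => l _.
have sj : gm_comp (d' j).+1%:Z (s (pe B _ j)) := gh_degree s (pe_homog B _ j).
by apply: killed_degree (me l) _ (sj l); have := dd' l j; lia.
Qed.

Lemma deep_tail r (d e : 'I_r -> nat) : exists r' (d' : 'I_r' -> nat) (s : grhom (Pn d') (Pn d)),
  (forall l j, (d l + e l <= d' j)%N) /\ iso_mod (@finite_dimensional k B) s.
Proof.
have [r' [d' [s [d'P sW]]]] := free_tail (\max_l (d l + e l)) (Pd_finitely_presented B
  (fun l => (d l).+1%:Z)).
exists r', d', s; split=> // l j; apply: leq_trans (d'P j).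
exact: (leq_bigmax (F := fun l => d l + e l)%N).
Qed.

End KilledDegree.

Section EssentialSurjectivity.
Variables (k : fieldType) (B : fibAlg k) (L : fibLim k).
Local Notation x := (fx B).
Local Notation y := (fy B).

(** The relations of a presentation of N are represented by rows of a single level n over
    a free graded module; dividing by the entries of these rows gives M. *)
Lemma F0_essentially_surjective (N : lmodType L^c) : finitely_presented N ->
  exists M : grmod B, finitely_presented (M : lmodType B) /\
    isomorphic (C := RMod L) (F0 L M) N.
Proof.
move=> [p [q [h [g [hg gs]]]]].
pose P := Pd B (fun _ : 'I_p => 0).
have eh := pe_homog B (fun _ : 'I_p => 0); have ef := Pd_freely B (fun _ : 'I_p => 0).
pose H : {linear 'rV[L^c]_p -> F0 L P} := @hat_sum k B L P p (@pe k B p (fun=> 0)).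
have HI : injective H := @hat_sum_injective k B L P p _ eh ef.
have HS u : exists s, H s = u := @hat_sum_surjective k B L P p _ eh ef u.
(* A level at which all relations of N are represented. *)
have [n [v vP]] : exists n (v : 'I_q -> Xn P n), forall t,
    H (h (delta_mx 0 t)) = inj L (v t) /\ Xpr (v t) = v t.
  have /choice[N0 N0P] t := inj_surj_at (H (h (delta_mx 0 t : 'rV_q))).
  pose n := (\max_t N0 t)%N; exists n.
  have /choice[v vP] t := N0P t n (leq_bigmax (F := N0) t).
  by exists v => t; case: (vP t) => -> ->.
pose J : finType := ('I_q * ('I_(fib n.+1) + 'I_(fib n)))%type.
pose elt (j : J) : P := match j.2 with inl i => (v j.1).1 0 i | inr i => (v j.1).2 0 i end.
pose deg (j : J) : nat := match j.2 with inl _ => n | inr _ => n.+1 end.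
have eltd (l : 'I_#|J|) : gm_comp (deg (enum_val l)).+1%:Z (elt (enum_val l)).
  case: (enum_val l) => t [i|i]; rewrite /elt /deg /=.
    exact: (Xpr_homog1 i (proj2 (vP t))).
  exact: (Xpr_homog2 i (proj2 (vP t))).
pose K := gspan eltd; pose M := gq_grmod K; pose f : grhom P M := gq_proj K.
have Kelt j : K (elt j).
  exists (fun l => (l == enum_rank j)%:R); rewrite (bigD1 (enum_rank j)) //= eqxx.
  by rewrite big1 ?addr0 ?scale1r ?enum_rankK // => l /negPf ->; rewrite scale0r.
exists M; split.
  pose h' : {linear 'rV[B]_#|J| -> 'rV[B]_p} := row_lin (fun l => elt (enum_val l)).
  exists p, #|J|, h', (f : {linear 'rV[B]_p -> M}); split; last exact: gq_proj_surj.
  move=> u; rewrite (gq_projP K); split=> [[b ->]|[b <-]].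
    by exists (\row_l b l); rewrite /= /row_lin; apply: eq_bigr => l _; rewrite mxE.
  by exists (fun l => b 0 l).
have fH : surjective (F0map L f \o H : {linear 'rV[L^c]_p -> F0 L M}).
  move=> u; have [|w <-] := @F0map_surjective _ _ L _ _ f _ u.
    by move=> w; exists 0%N; apply: gq_proj_surj.
  by have [s <-] := HS w; exists s.
apply: (@same_kernel_isomorphic L^c _ (F0 L M) N _ g fH gs) => s.
rewrite hg; split=> [/= fs|[t <-]]; last first.
  have f0 l : F0map L f (H (h (delta_mx 0 l))) = 0.
    rewrite (proj1 (vP l)) F0map_inj (_ : Xmap f (v l) = 0) ?raddf0 //.
    apply/Xmem_eq0; split=> i; rewrite mxE; apply/gq_projP.
      exact: (Kelt (l, inl i)).
    exact: (Kelt (l, inr i)).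
  have fZ c l : F0map L f (H (h (c *: delta_mx 0 l))) = 0.
    by rewrite (linearZ_LR h) (linearZ_LR H) (linearZ_LR (F0map L f)) f0 scaler0.
  rewrite [t]row_sum_delta /= (linear_sum h) (linear_sum H) (linear_sum (F0map L f)).
  by rewrite big1.
pose I u := exists t, H (h t) = u.
have ID u1 u2 : I u1 -> I u2 -> I (u1 + u2).
  by move=> [s1 <-] [s2 <-]; exists (s1 + s2); rewrite !raddfD.
have Is u1 (t : L) : I u1 -> I (u1 <*> t).
  by move=> [s1 <-]; exists ((t : L^c) *: s1); rewrite !linearZ_LR.
have I0 : I 0 by exists 0; rewrite !raddf0.
(* Conversely an element that dies in F0 M is represented by a row with entries in K, and
   the entries of the relations generate K. *)
suff [t tE] : I (H s) by exists t; apply: HI.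
have [n0 [w [wE wp]]] := inj_surj (H s).
have fw : F0map L f (inj L w) = 0 by rewrite -wE.
move: fw; rewrite F0map_inj => /inj_eq0[|w1 w2]; first by rewrite Xpr_map wp.
rewrite wE.
have Kt (z : P) : torsion (f z) -> exists e, killed K e z.
  by move=> [e /killed_map ze]; exists e; apply: killed_impl ze => a /gq_projP.
have [||n1 [w' [-> [w'1 w'2]]]] := @inj_Xmem _ B L _ K _ w.
- by move=> i; apply: Kt; have := w1 i; rewrite mxE.
- by move=> i; apply: Kt; have := w2 i; rewrite mxE.
have Ielt t : I (inj L (v t)) by rewrite -(proj1 (vP t)); exists (delta_mx 0 t).
have IK a (z : P) : K z -> I (jn L a z).
  move=> [b ->]; rewrite raddf_sum; apply: (big_ind I) => [//|//|l _].
  apply: (generated_homog ID Is (eltd l)).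
  case: (enum_val l) => t [i|i]; rewrite /elt /deg /=.
    by rewrite -inj_E1; apply: Is.
  by rewrite -inj_E1r; apply: Is.
rewrite inj_sum; apply: (ID).
  by apply: (big_ind I) => [//|//|i _]; apply/Is/IK.
by apply: (big_ind I) => [//|//|i _]; apply/Is/IK.
Qed.

End EssentialSurjectivity.

(** * The quotient category of finitely presented modules *)

Section Lifting.
Variables (k : fieldType) (B : fibAlg k).

Local Notation Pn d := (Pd B (fun l => (d l).+1%:Z)).

(** The generators of a deep tail are mapped into the image of w, since their coefficients
    have large degree; and a free module can be mapped arbitrarily. *)
Lemma tail_lift (N N' : grmod B) (w : grhom N N') r (d : 'I_r -> nat)
    (f : grhom (Pn d) N') :
  (forall n : N', exists e, killed (gim w) e n) ->
  exists r' (d' : 'I_r' -> nat) (s : grhom (Pn d') (Pn d)) (g : grhom (Pn d') N),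
    iso_mod (@finite_dimensional k B) s /\ forall u, w (g u) = f (s u).
Proof.
move=> wt; have /choice[e eP] l := wt (f (pe B _ l)).
have [r' [d' [s [dd' sW]]]] := deep_tail B d e.
have fE j : f (s (pe B _ j)) = \sum_l (s (pe B _ j) : 'rV[B]_r) 0 l *: f (pe B _ l).
  exact: (row_linE f).
have /choice[u uP] : forall j, exists u, w u = f (s (pe B _ j)).
  by move=> j; rewrite fE; apply: (tail_degree (Q := gim w) s eP dd' j).
pose t j := gpr (d' j).+1%:Z (u j).
have th j : gm_comp (d' j).+1%:Z (t j) by apply: gpr_homog.
exists r', d', s, (pd_hom th); split=> // v.
apply: (pd_hom_eq (f := w \o pd_hom th : {linear _ -> _}) (g := f \o s : {linear _ -> _})) => j.
rewrite /= -[X in w X]/(pd_hom th (pe B _ j)) pd_homE /t -gpr_hom uP.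
exact/pr_id/gh_degree/gh_degree/pe_homog.
Qed.

Lemma pd_pos_lift r (d : 'I_r -> nat) : exists q : grhom (Pn d) (pos (Pn d)),
  forall v, pos_incl (Pn d) (q v) = v.
Proof.
apply: (gs_lift (K := pos_gsub (Pn d)) (f := grhom_id (Pn d))) => u i i0.
apply/rowP => l; rewrite mxE -(pr_id (ga_grading B) (gpr_homog i u l)).
by apply: ga_neg; lia.
Qed.

End Lifting.

Section FinitelyPresentedQuotient.
Variables (k : fieldType) (B : fibAlg k) (L : fibLim k).

Local Notation Pn d := (Pd B (fun l => (d l).+1%:Z)).
Local Notation W f := (@iso_mod k B (@finite_dimensional k B) (sval _) (sval _) f).

Definition fpd r (d : 'I_r -> nat) : gr B :=
  exist (fun M : Gr B => finitely_presented (M : lmodType B)) (Pn d)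
    (@Pd_finitely_presented k B r (fun l => (d l).+1%:Z)).

Definition qF : functor (qgr B) (RMod L) := functor_comp (FQ B L) (qgr_QGr B).

Definition is_fpd (M : gr B) : Prop := exists r (d : 'I_r -> nat), M = fpd d.

Lemma fpd_cover (M : gr B) : exists p : gr B, is_fpd p /\ exists f : hom p M, W f.
Proof.
have [r [d [p [_ pW]]]] := free_tail 0 (svalP M).
by exists (fpd d); split; [exists r, d|exists p].
Qed.

Lemma fpd_lift (M N p : gr B) (w : hom M N) (f : hom p N) : W w -> is_fpd p ->
  exists q (s : hom q p) (g : hom q M), [/\ is_fpd q, W s & heq (cmp w g) (cmp f s)].
Proof.
move=> Ww [r [d pE]]; subst p.
have [r' [d' [s [g [sW gE]]]]] := tail_lift f (iso_mod_Fdim_coker (iso_mod_Fdim Ww)).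
by exists (fpd d'), s, g; split=> //; exists r', d'.
Qed.

(** Two morphisms with the same image under F0 differ by torsion elements on the generators,
    and a deep tail kills these. *)
Lemma F0map_eq_tail (M : grmod B) r (d : 'I_r -> nat) (f g : grhom (Pn d) M) :
  F0map L f =1 F0map L g -> exists r' (d' : 'I_r' -> nat) (s : grhom (Pn d') (Pn d)),
    iso_mod (@finite_dimensional k B) s /\ f \o s =1 g \o s.
Proof.
move=> fg; pose v l := f (pe B (fun l => (d l).+1%:Z) l) - g (pe B _ l).
have vt l : torsion (v l).
  apply: (@jn_eq0 _ _ L _ (d l)).
    by apply: (gradingB (gm_grading M)); apply/gh_degree/pe_homog.
  by rewrite raddfB /= -!F0map_jn fg subrr.
have /choice[e eP] : forall l, exists e, killed (gzero M) e (v l) := vt.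
have [r' [d' [s [dd' sW]]]] := deep_tail B d e.
exists r', d', s; split=> //.
apply: (pd_hom_eq (f := f \o s : {linear _ -> _}) (g := g \o s : {linear _ -> _})) => j.
have := tail_degree (Q := gzero M) s eP dd' j.
rewrite /= /v; set u := s _; under eq_bigr do rewrite scalerBr.
rewrite sumrB => /eqP; rewrite subr_eq0 => /eqP E.
have H (h : grhom (Pn d) M) : h u = \sum_l (u : 'rV[B]_r) 0 l *: h (pe B _ l).
  exact: (row_linE h).
by rewrite !H.
Qed.

Lemma qF_faithful (M M' : qgr B) (h h' : hom M M') :
  heq (fmap qF h) (fmap qF h') -> heq h h'.
Proof.
apply: (@loc_faithful (gr B) (RMod L) _ is_fpd qF fpd_cover fpd_lift).
move=> p y f g [r [d pE]]; subst p => fg.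
have [r' [d' [s [sW sE]]]] := F0map_eq_tail (f := f : grhom (Pn d) _) fg.
by exists (fpd d'), s.
Qed.

(** Through Jmap a linear map between the images under F0 gives a graded map into
    G0 (F0 M'), which lifts along Jmap for M' on a deep tail. *)
Lemma qF_full (M M' : qgr B) (h : hom (qF M) (qF M')) : exists f, heq (fmap qF f) h.
Proof.
move: M M' h; apply: (@loc_full (gr B) (RMod L) _ is_fpd qF fpd_cover).
move=> p M' h [r [d pE]]; subst p.
have [q qE] := pd_pos_lift B d.
pose h0 : {linear F0 L (Pn d) -> F0 L (sval M')} := h.
pose f : grhom (Pn d) (G0 B (F0 L (sval M'))) := grhom_comp (G0map B h0) (grhom_comp (Jmap L _) q).
have [r' [d' [s [g [sW gE]]]]] := tail_lift f (@Jmap_coker k B L (sval M')).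
pose g' : grhom (Pn d') (sval M') := grhom_comp (pos_incl (sval M')) g.
have gF u : F0map L g' u = h0 (F0map L s u).
  move: u; apply: F0_generated => [u v|u t|n m _].
  - by move=> uE vE; rewrite !linearD uE vE.
  - by move=> uE; rewrite !ract_map uE.
  rewrite !F0map_jn -[LHS]/(jn L n (pos_incl (sval M') (g m))) -JfunE.
  rewrite -[Jfun _ _]/(Jmap L (sval M') (g m)) gE.
  change (gcoef n (gmap h0 (Jmap L (Pn d) (q (s m)))) = h0 (jn L n (s m))).
  by rewrite gmapE -[Jmap _ _ _]/(Jfun L _) JfunE qE.
by exists (fpd d'), s, g'.
Qed.

Lemma F0_finitely_presented (M : grmod B) : finitely_presented (M : lmodType B) ->
  finitely_presented (F0 L M : lmodType L^c).
Proof.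
move=> Mfp; have [r [d [p [_ pW]]]] := free_tail 0 Mfp.
have [p' pp'] := F0_inverts L (iso_mod_Fdim pW : @iso_mod k B _ (Pn d : Gr B) M p).
apply: (@finitely_presented_iso L^c (F0 L (Pn d)) (F0 L M)); last exact: F0_Pd_finitely_presented.
by exists (F0map L p), p'.
Qed.

Definition fpF : functor (qgr B) (fpRMod L) :=
  corestriction (F := qF) (fun M : qgr B => F0_finitely_presented (svalP (M : gr B))).

Lemma fpF_equivalence : is_equivalence fpF.
Proof.
apply: full_faithful_equivalence.
- move=> N; have [M [Mfp MN]] := F0_essentially_surjective B (svalP N).
  by exists (exist _ M Mfp : gr B).
- exact: qF_full.
- exact: qF_faithful.
Qed.

Lemma fpF_restricts : nat_iso (functor_comp (FQ B L) (qgr_QGr B))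
  (functor_comp (fpRMod_RMod L) fpF).
Proof. exact: corestrictionK. Qed.

Lemma F0_structure_module : @isomorphic (RMod L) (F0 L (structure_module B)) (L^c)^o.
Proof.
have gh : forall l : 'I_1, gm_comp (g := structure_module B) 0 (1 : B^o).
  by move=> _; apply: ga_one.
pose H : {linear 'rV[L^c]_1 -> F0 L (structure_module B)} :=
  @hat_sum k B L (structure_module B) 1 (fun=> 1 : B^o).
have HI : injective H := hat_sum_injective gh (structure_freely B).
have HS u : exists s, H s = u := hat_sum_surjective gh (structure_freely B) u.
have e_lin : linear (fun u : 'rV[L^c]_1 => u 0 0 : (L^c)^o) by move=> a u v; rewrite !mxE.
pose e : {linear 'rV[L^c]_1 -> (L^c)^o} :=
  HB.pack (fun u : 'rV[L^c]_1 => u 0 0 : (L^c)^o) (GRing.isLinear.Build L^c _ _ _ _ e_lin).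
apply: (@same_kernel_isomorphic L^c _ (F0 L (structure_module B)) (L^c)^o H e HS).
  by move=> s; exists (const_mx s); rewrite /= mxE.
move=> u; split=> [u0|u0]; first by rewrite (HI u 0) ?raddf0.
rewrite (_ : u = 0) ?raddf0 //.
by apply/rowP => i; rewrite (ord1 i) [RHS]mxE.
Qed.

End FinitelyPresentedQuotient.

(** * The equivalences over a field *)

Theorem QGr_equivalence (k : fieldType) (S : algType k)
    (iota : forall n : nat, {lrmorphism Sn k n -> S})
    (S_lim : is_direct_limit (A := fun n => Sn k n)
               (fun n => @phi k n : {lrmorphism Sn k n -> Sn k n.+1}) iota) :
  exists F : functor (QGr (B k)) (RMod S),
    [/\ is_equivalence F,
        exists G : functor (qgr (B k)) (fpRMod S),
          is_equivalence G /\
          nat_iso (functor_comp F (qgr_QGr (B k)))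
                  (functor_comp (fpRMod_RMod S) G)
      & isomorphic (F (structure_module (B k))) ((S^c)^o : RMod S)].
Proof.
have [L LS] := fibLim_exists S_lim; subst S.
exists (FQ (B_fib k) L); split.
- refine (@FQ_equivalence k (B_fib k) L).
- exists (fpF (B_fib k) L); split; first exact: (@fpF_equivalence k (B_fib k) L).
  exact: (@fpF_restricts k (B_fib k) L).
- exact: (@F0_structure_module k (B_fib k) L).
Qed.

Local Open Scope complex_scope.

Theorem theorem1p1 (R : realType) (S : algType R[i])
    (iota : forall n : nat, {lrmorphism Sn R[i] n -> S})
    (S_lim : is_direct_limit (A := fun n => Sn R[i] n)
               (fun n => @phi R[i] n : {lrmorphism Sn R[i] n -> Sn R[i] n.+1})
               iota) :
  exists F : functor (QGr (B R[i])) (RMod S),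
    [/\ is_equivalence F,
        exists G : functor (qgr (B R[i])) (fpRMod S),
          is_equivalence G /\
          nat_iso (functor_comp F (qgr_QGr (B R[i])))
                  (functor_comp (fpRMod_RMod S) G)
      & isomorphic (F (structure_module (B R[i]))) ((S^c)^o : RMod S)].
Proof. exact: QGr_equivalence S_lim. Qed.
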